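(* Let $R$ be a noetherian integral domain with fraction field $K$ and let $A$ be a cellular $R$-algebra of finite dimension (i.e. with finite cellular basis over $R$) such that $A^K=K\otimes_R A$ is semisimple. Then $\mathrm{DecGen}(A)=\mathrm{BlGen}(A)$.
   Context: ''Cellular'' is in the sense of Graham and Lehrer; in particular $A$ is free of finite rank over $R$, all specializations $A(\mathfrak{p})=\mathrm{k}(\mathfrak{p})\otimes_R A$ (with $\mathrm{k}(\mathfrak{p})=\operatorname{Frac}(R/\mathfrak{p})$, $\mathfrak{p}\in\operatorname{Spec}(R)$) are cellular and split, and perfect $A$-gates exist in all non-zero primes. $\mathrm{G}_0(B)$ denotes the Grothendieck group of finitely generated modules of a finite-dimensional algebra $B$. For non-zero $\mathfrak{p}$, a perfect $A$-gate in $\mathfrak{p}$ is a discrete valuation ring $\mathscr{O}$ with fraction field $K$ and maximal ideal $\mathfrak{m}$ which dominates $R_{\mathfrak{p}}$ (i.e. $R_{\mathfrak{p}}\subseteq\mathscr{O}$ and $\mathfrak{m}\cap R_{\mathfrak{p}}$ is the maximal ideal of $R_{\mathfrak p}$) and such that the scalar extension map $\mathrm{d}_A^{\mathfrak{p},\mathfrak{m}}:\mathrm{G}_0(A(\mathfrak{p}))\to\mathrm{G}_0(A^{\mathscr{O}}(\mathfrak{m}))$ is an isomorphism; here $A^{\mathscr{O}}=\mathscr{O}\otimes_R A$ and $A^{\mathscr{O}}(\mathfrak{m})=A^{\mathscr{O}}/\mathfrak{m}A^{\mathscr{O}}$. The decomposition map $\mathrm{d}_A^{\mathfrak{p},\mathscr{O}}:\mathrm{G}_0(A^K)\to\mathrm{G}_0(A(\mathfrak{p}))$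 sends $[V]$ to $(\mathrm{d}_A^{\mathfrak{p},\mathfrak{m}})^{-1}([\widetilde{V}/\mathfrak{m}\widetilde{V}])$, where $\widetilde{V}$ is any $A^{\mathscr{O}}$-lattice in $V$ ($\mathscr{O}$-free of finite rank, spanning $V$ over $K$). For $\mathfrak{p}=(0)$ the decomposition map is the identity. It is called trivial if it induces a bijection between isomorphism classes of simple modules. $\mathrm{DecGen}(A)$ is the set of all $\mathfrak{p}\in\operatorname{Spec}(R)$ such that $\mathrm{d}_A^{\mathfrak{p},\mathscr{O}}$ is trivial for every perfect $A$-gate $\mathscr{O}$ in $\mathfrak{p}$. Block idempotents of a ring are its centrally-primitive idempotents; each block idempotent of $A_{\mathfrak{p}}\subseteq A^K$ is a sum of block idempotents of $A^K$. $\mathrm{BlGen}(A)$ is the set of all $\mathfrak{p}\in\operatorname{Spec}(R)$ such that the block idempotents of $A_{\mathfrak{p}}$ coincide with those of $A^K$. *)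

(* Defs.v *)
From HB Require Import structures.
From mathcomp Require Import all_boot all_order all_algebra.
From mathcomp Require Import boolp classical_sets.
From mathcomp.multinomials Require Import freeg.

Set Implicit Arguments.
Unset Strict Implicit.
Unset Printing Implicit Defensive.

Import Order.TTheory GRing.Theory Num.Theory.
Local Open Scope ring_scope.
Local Open Scope quotient_scope.

(** * Bases, cellular algebras and scalar extension *)

(* A finite R-basis of A, bundled with its (unique) coordinate functions.     *)
Record alg_basis (R : comNzRingType) (A : algType R) (I : finType) := AlgBasis {
  bvec :> I -> A;
  bcoord : A -> I -> R;
  bcoordK : forall a : A, \sum_i bcoord a i *: bvec i = a;
  bvecK : forall c : I -> R, bcoord (\sum_i c i *: bvec i) = c }.

Section BasisTheory.
Variables (R : comNzRingType) (A : algType R) (I : finType) (e : alg_basis A I).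

Lemma bcoordD a b i : bcoord e (a + b) i = bcoord e a i + bcoord e b i.
Proof.
rewrite -{1}(bcoordK e a) -{1}(bcoordK e b) -big_split /=.
under eq_bigr do rewrite -scalerDl.
by rewrite (bvecK e (fun j => _ j + _ j)).
Qed.

Lemma bcoordZ c a i : bcoord e (c *: a) i = c * bcoord e a i.
Proof.
rewrite -{1}(bcoordK e a) scaler_sumr.
under eq_bigr do rewrite scalerA.
by rewrite (bvecK e (fun j => c * _ j)).
Qed.

Lemma bcoord0 i : bcoord e 0 i = 0.
Proof. by rewrite -(scale0r 0) bcoordZ mul0r. Qed.

Lemma bcoord_sum (J : finType) (F : J -> A) i :
  bcoord e (\sum_j F j) i = \sum_j bcoord e (F j) i.
Proof.
apply: (big_morph (fun a => bcoord e a i)) => [a b|]; first exact: bcoordD.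
exact: bcoord0.
Qed.

Lemma bcoordE i j : bcoord e (e i) j = (i == j)%:R.
Proof.
have -> : e i = \sum_k (i == k)%:R *: e k.
  rewrite (bigD1 i) //= eqxx scale1r big1 ?addr0 // => k.
  by rewrite eq_sym => /negPf ->; rewrite scale0r.
by rewrite (bvecK e (fun k => (i == k)%:R)).
Qed.

End BasisTheory.

(* Graham-Lehrer cell datum.  [cell_le_mul] is axiom (C3): the coefficients   *)
(* [r s' s] depend on [a] but not on [t], and the remainder lies in the span  *)
(* of the basis elements of strictly smaller shape.                           *)
Record cell_datum (R : comNzRingType) (A : algType R) := CellDatum {
  cell_disp : Order.disp_t;
  cell_poset : finPOrderType cell_disp;
  cell_tab : cell_poset -> finType;
  cell_basis :> alg_basis A {l : cell_poset & (cell_tab l * cell_tab l)%type};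
  cell_elt := fun (l : cell_poset) (s t : cell_tab l) =>
    cell_basis (existT _ l (s, t));
  cell_star : {linear A -> A};
  cell_starK : involutive cell_star;
  cell_starM : forall a b, cell_star (a * b) = cell_star b * cell_star a;
  cell_starE : forall l s t, cell_star (@cell_elt l s t) = @cell_elt l t s;
  cell_le_mul : forall (a : A) (l : cell_poset),
    exists r : cell_tab l -> cell_tab l -> R, forall s t : cell_tab l,
    exists c : {l : cell_poset & (cell_tab l * cell_tab l)%type} -> R,
      a * cell_elt s t =
        \sum_s' r s' s *: cell_elt s' t
        + \sum_(i | (tag i < l)%O) c i *: cell_basis i }.

(* Model of the S-algebra [S (x)_R A] for [phi : R -> S]: the free S-module   *)
(* on the chosen basis [e] of [A], with the structure constants of [A].  The  *)
(* map [scin : a |-> 1 (x) a] is the canonical one (see [scin_*] below).      *)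
Definition scext (R S : comNzRingType) (A : algType R) (I : finType)
  (e : alg_basis A I) (phi : {rmorphism R -> S}) := {ffun I -> S}.

Section ScalarExtension.
Variables (R S : comNzRingType) (A : algType R) (I : finType).
Variables (e : alg_basis A I) (phi : {rmorphism R -> S}).

Local Notation scext := (scext e phi).

HB.instance Definition _ := GRing.Zmodule.on scext.

Definition scin (a : A) : scext := [ffun k => phi (bcoord e a k)].

Definition scext_scale (c : S) (x : scext) : scext := [ffun k => c * x k].

Lemma scext_scaleA a b x :
  scext_scale a (scext_scale b x) = scext_scale (a * b) x.
Proof. by apply/ffunP => k; rewrite !ffunE mulrA. Qed.
Lemma scext_scale1 : left_id 1 scext_scale.
Proof. by move=> x; apply/ffunP => k; rewrite !ffunE mul1r. Qed.
Lemma scext_scaleDr : right_distributive scext_scale +%R.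
Proof. by move=> a x y; apply/ffunP => k; rewrite !ffunE mulrDr. Qed.
Lemma scext_scaleDl x : {morph scext_scale^~ x : a b / a + b}.
Proof. by move=> a b; apply/ffunP => k; rewrite !ffunE mulrDl. Qed.

HB.instance Definition _ := GRing.Zmodule_isLmodule.Build S scext
  scext_scaleA scext_scale1 scext_scaleDr scext_scaleDl.

Lemma scext_scaleE c (x : scext) k : (c *: x) k = c * x k.
Proof. by rewrite ffunE. Qed.

Lemma scextE (x : scext) : x = \sum_i x i *: scin (e i).
Proof.
apply/ffunP => k; rewrite sum_ffunE (bigD1 k) //= scext_scaleE ffunE bcoordE.
rewrite eqxx rmorph1 mulr1 big1 ?addr0 // => i /negPf ik.
by rewrite scext_scaleE ffunE bcoordE ik rmorph0 mulr0.
Qed.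

Definition scext_mul (x y : scext) : scext :=
  \sum_i \sum_j (x i * y j) *: scin (e i * e j).

Lemma scinD a b : scin (a + b) = scin a + scin b.
Proof. by apply/ffunP => k; rewrite !ffunE bcoordD rmorphD. Qed.
Lemma scinZ c a : scin (c *: a) = phi c *: scin a.
Proof. by apply/ffunP => k; rewrite scext_scaleE !ffunE bcoordZ rmorphM. Qed.
Lemma scin0 : scin 0 = 0.
Proof. by apply/ffunP => k; rewrite !ffunE bcoord0 rmorph0. Qed.
Lemma scin_sum (J : finType) (F : J -> A) :
  scin (\sum_j F j) = \sum_j scin (F j).
Proof. by apply: (big_morph scin) => [a b|]; [exact: scinD|exact: scin0]. Qed.

Lemma scext_mulDl : left_distributive scext_mul +%R.
Proof.
move=> x y z; rewrite /scext_mul -big_split; apply: eq_bigr => i _ /=.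
rewrite -big_split; apply: eq_bigr => j _ /=.
by rewrite ffunE mulrDl scalerDl.
Qed.
Lemma scext_mulDr : right_distributive scext_mul +%R.
Proof.
move=> x y z; rewrite /scext_mul -big_split; apply: eq_bigr => i _ /=.
rewrite -big_split; apply: eq_bigr => j _ /=.
by rewrite ffunE mulrDr scalerDl.
Qed.
Lemma scext_mulZl c x y : scext_mul (c *: x) y = c *: scext_mul x y.
Proof.
rewrite /scext_mul scaler_sumr; apply: eq_bigr => i _.
rewrite scaler_sumr; apply: eq_bigr => j _.
by rewrite scext_scaleE scalerA mulrA.
Qed.
Lemma scext_mulZr c x y : scext_mul x (c *: y) = c *: scext_mul x y.
Proof.
rewrite /scext_mul scaler_sumr; apply: eq_bigr => i _.
rewrite scaler_sumr; apply: eq_bigr => j _.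
by rewrite scext_scaleE scalerA mulrCA.
Qed.
Lemma scext_mul_suml (J : finType) (F : J -> scext) y :
  scext_mul (\sum_j F j) y = \sum_j scext_mul (F j) y.
Proof.
apply: (big_morph (scext_mul^~ y)) => [a b|]; first exact: scext_mulDl.
by rewrite -(scale0r 0) scext_mulZl !scale0r.
Qed.
Lemma scext_mul_sumr (J : finType) (F : J -> scext) x :
  scext_mul x (\sum_j F j) = \sum_j scext_mul x (F j).
Proof.
apply: (big_morph (scext_mul x)) => [a b|]; first exact: scext_mulDr.
by rewrite -(scale0r 0) scext_mulZr !scale0r.
Qed.

Lemma scin_mul a b : scext_mul (scin a) (scin b) = scin (a * b).
Proof.
rewrite -[in RHS](bcoordK e a) -[in RHS](bcoordK e b) mulr_suml scin_sum.
apply: eq_bigr => i _; rewrite mulr_sumr scin_sum; apply: eq_bigr => j _.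
by rewrite -scalerAl -scalerAr !scinZ !scalerA !ffunE.
Qed.

Lemma scext_mulA : associative scext_mul.
Proof.
move=> x y z.
have step3 a b : scext_mul (scin a) (scext_mul (scin b) z) =
                 scext_mul (scext_mul (scin a) (scin b)) z.
  rewrite scin_mul (scextE z) (scext_mul_sumr _ (scin b)).
  rewrite (scext_mul_sumr _ (scin a)) (scext_mul_sumr _ (scin (a * b))).
  apply: eq_bigr => k _.
  by rewrite 2!(scext_mulZr _ (scin _)) !scin_mul mulrA (scext_mulZr _ (scin _)) scin_mul.
have step2 a : scext_mul (scin a) (scext_mul y z) =
               scext_mul (scext_mul (scin a) y) z.
  rewrite (scextE y) (scext_mul_suml _ z) 2!(scext_mul_sumr _ (scin a)).
  rewrite (scext_mul_suml _ z); apply: eq_bigr => j _.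
  rewrite (scext_mulZl _ (scin (e j)) z) 2!(scext_mulZr _ (scin a)).
  by rewrite step3 -scext_mulZl.
rewrite (scextE x) (scext_mul_suml _ (scext_mul y z)) (scext_mul_suml _ y).
rewrite (scext_mul_suml _ z); apply: eq_bigr => i _.
by rewrite (scext_mulZl _ _ (scext_mul y z)) step2 (scext_mulZl _ _ y) -scext_mulZl.
Qed.

Lemma scext_mul1l : left_id (scin 1) scext_mul.
Proof.
move=> x; rewrite (scextE x) scext_mul_sumr; apply: eq_bigr => i _.
by rewrite scext_mulZr scin_mul mul1r.
Qed.
Lemma scext_mul1r : right_id (scin 1) scext_mul.
Proof.
move=> x; rewrite (scextE x) scext_mul_suml; apply: eq_bigr => i _.
by rewrite scext_mulZl scin_mul mulr1.
Qed.
Lemma scext_1neq0 : scin 1 != 0.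
Proof.
apply/eqP => /(congr1 (fun x => scext_mul x)) one0.
have sc0 i : scin (e i) = 0.
  by rewrite -(scext_mul1l (scin (e i))) one0 -(scale0r 0) scext_mulZl !scale0r.
have noI (i : I) : False.
  have /ffunP/(_ i) := sc0 i; rewrite !ffunE bcoordE eqxx rmorph1 => /eqP.
  by rewrite oner_eq0.
have /eqP := oner_neq0 A; case; rewrite -(bcoordK e 1).
by apply: big1 => i; case: (noI i).
Qed.

HB.instance Definition _ := GRing.Zmodule_isNzRing.Build scext
  scext_mulA scext_mul1l scext_mul1r scext_mulDl scext_mulDr scext_1neq0.

Fact scext_scaleAl c (x y : scext) : c *: (x * y) = c *: x * y.
Proof. exact: esym (scext_mulZl c x y). Qed.
HB.instance Definition _ := GRing.Lmodule_isLalgebra.Build S scext scext_scaleAl.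
Fact scext_scaleAr c (x y : scext) : c *: (x * y) = x * (c *: y).
Proof. exact: esym (scext_mulZr c x y). Qed.
HB.instance Definition _ := GRing.Lalgebra_isAlgebra.Build S scext scext_scaleAr.

Lemma scin_is_zmod_morphism : zmod_morphism scin.
Proof. by move=> a b; rewrite scinD -[- b]scaleN1r scinZ rmorphN1 scaleN1r. Qed.
Lemma scin_is_monoid_morphism : monoid_morphism scin.
Proof. by split=> // a b; rewrite -scin_mul. Qed.
HB.instance Definition _ :=
  GRing.isZmodMorphism.Build A scext scin scin_is_zmod_morphism.
HB.instance Definition _ :=
  GRing.isMonoidMorphism.Build A scext scin scin_is_monoid_morphism.

End ScalarExtension.

(** * Modules and Grothendieck groups *)

(* Left B-modules free of finite rank over S, as S^n (column vectors) with    *)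
(* the action given by matrices.  When S is a field, these are all finitely   *)
(* generated left B-modules, up to isomorphism, if B is of finite dimension.  *)
Record matmod (S : comNzRingType) (B : algType S) := MatMod {
  mdim : nat;
  mact :> {lrmorphism B -> 'M[S]_mdim} }.

Definition mod_iso (S : comNzRingType) (B : algType S) (V W : matmod B) : Prop :=
  exists (f : 'M[S]_(mdim W, mdim V)) (g : 'M[S]_(mdim V, mdim W)),
    [/\ forall b, f *m V b = W b *m f, g *m f = 1%:M & f *m g = 1%:M].

(* Subspaces of column vectors are given by the row space of the transposes.  *)
Definition mod_simple (k : fieldType) (B : algType k) (V : matmod B) : Prop :=
  (0 < mdim V)%N /\
  forall U : 'M[k]_(mdim V),
    (forall b, stablemx U (V b)^T) -> \rank U = 0%N \/ \rank U = mdim V.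

(* 0 -> V' -f-> V -g-> V'' -> 0 is exact, [f] and [g] acting on columns.      *)
Definition short_exact (k : fieldType) (B : algType k) (V' V V'' : matmod B)
    (f : 'M[k]_(mdim V, mdim V')) (g : 'M[k]_(mdim V'', mdim V)) : Prop :=
  [/\ forall b, f *m V' b = V b *m f, forall b, g *m V b = V'' b *m g,
      row_free f^T, row_free g & (f^T == kermx g^T)%MS].

HB.instance Definition _ (S : comNzRingType) (B : algType S) :=
  gen_eqMixin (matmod B).
HB.instance Definition _ (S : comNzRingType) (B : algType S) :=
  gen_choiceMixin (matmod B).

Section G0.
Variables (k : fieldType) (B : algType k).

Definition mod_free (V : matmod B) : {freeg (matmod B)} := <<V>>.

(* The subgroup generated by [V] - [V'] - [V''], for the short exact          *)
(* sequences 0 -> V' -> V -> V'' -> 0.                                        *)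
Definition G0_relations : {pred {freeg (matmod B)}} := fun x =>
  `[< forall H : {pred {freeg (matmod B)}}, zmod_closed H ->
      (forall (V' V V'' : matmod B) f g, @short_exact k B V' V V'' f g ->
         mod_free V - mod_free V' - mod_free V'' \in H) ->
      x \in H >].

Fact G0_relations_zmod_closed : zmod_closed G0_relations.
Proof.
split=> [|x y /asboolP Hx /asboolP Hy]; apply/asboolP => H cH sH.
  by case: cH.
by case: (cH) => _; apply; [exact: Hx|exact: Hy].
Qed.
HB.instance Definition _ :=
  GRing.isZmodClosed.Build _ G0_relations G0_relations_zmod_closed.

Definition G0 : zmodType := Quotient.quot G0_relations.

Definition G0_class (V : matmod B) : G0 :=
  \pi_(Quotient.quot G0_relations) (mod_free V).

Lemma G0_class_exact (V' V V'' : matmod B) f g :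
  @short_exact k B V' V V'' f g -> G0_class V = G0_class V' + G0_class V''.
Proof.
move=> ex; apply/eqP; rewrite -subr_eq0 opprD addrA -!raddfB /=.
rewrite -(raddf0 (\pi_(Quotient.quot G0_relations))) -Quotient.idealrBE subr0.
by apply/asboolP => H _; apply; exact: ex.
Qed.

Section Universal.
Variables (G : zmodType) (h : matmod B -> G).
Hypothesis hD : forall (V' V V'' : matmod B) f g,
  @short_exact k B V' V V'' f g -> h V = h V' + h V''.

Let hfree (x : {freeg (matmod B)}) : G := fglift (h : _ -> zmodule G) x.

Let hfreeB : {morph hfree : x y / x - y}.
Proof. by move=> x y; rewrite /hfree (lift_is_additive (h : _ -> zmodule G)). Qed.

Let hfree1 V : hfree (mod_free V) = h V.
Proof. by rewrite /hfree /mod_free liftU scale1r. Qed.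

Let hfree_rel x : x \in G0_relations -> hfree x = 0.
Proof.
move/asboolP => /(_ (fun y => hfree y == 0)) H; apply/eqP/H.
  have h0 : hfree 0 = 0 by have := hfreeB 0 0; rewrite !subrr.
  split=> [|u v]; rewrite /in_mem /= ?h0 // => /eqP u0 /eqP v0.
  by rewrite hfreeB u0 v0 subrr.
move=> V' V V'' f g ex; rewrite /in_mem /= !hfreeB !hfree1 (hD ex).
by rewrite -addrA -opprD subrr.
Qed.

Definition G0_lift_def (_ : forall V' V V'' f g,
    @short_exact k B V' V V'' f g -> h V = h V' + h V'') (x : G0) : G :=
  hfree (repr x).

Lemma G0_lift_zmod_morphism : zmod_morphism (G0_lift_def hD).
Proof.
move=> x y; rewrite /G0_lift_def -hfreeB; apply/eqP; rewrite -subr_eq0 -hfreeB.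
apply/eqP/hfree_rel; rewrite Quotient.idealrBE.
by rewrite raddfB /= !reprK.
Qed.
HB.instance Definition _ :=
  GRing.isZmodMorphism.Build _ _ (G0_lift_def hD) G0_lift_zmod_morphism.

Definition G0_lift : {additive G0 -> G} := G0_lift_def hD.

Lemma G0_lift_class V : G0_lift (G0_class V) = h V.
Proof.
rewrite /= /G0_lift_def -hfree1; apply/eqP; rewrite -subr_eq0 -hfreeB.
by apply/eqP/hfree_rel; rewrite Quotient.idealrBE reprK.
Qed.

End Universal.

Lemma G0_additive_ext (G : zmodType) (d d' : {additive G0 -> G}) :
  (forall V, d (G0_class V) = d' (G0_class V)) -> d =1 d'.
Proof.
move=> dd' x; rewrite -[x]reprK -[repr x]freeg_sumE.
rewrite !raddf_sum; apply: eq_bigr => V _.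
have -> : << coeff V (repr x) *g V >> = mod_free V *~ coeff V (repr x).
  by rewrite /mod_free freeg_mulz intz.
by rewrite !raddfMz; congr (_ *~ _); exact: dd'.
Qed.

End G0.

(* Extension of scalars of A^phi-modules to A^phi'-modules along [psi], where *)
(* [phi' = psi \o phi].                                                       *)
Section ModuleExtension.
Variables (R S S' : comNzRingType) (A : algType R) (I : finType).
Variables (e : alg_basis A I) (phi : {rmorphism R -> S}).
Variables (phi' : {rmorphism R -> S'}) (psi : {rmorphism S -> S'}).
Hypothesis psiE : forall r, psi (phi r) = phi' r.
Variable V : matmod (scext e phi).

Definition mod_ext_act (_ : forall r, psi (phi r) = phi' r)
    (x : scext e phi') : 'M[S']_(mdim V) :=
  \sum_i x i *: map_mx psi (V (scin e phi (e i))).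

Lemma mod_ext_act_scin a :
  mod_ext_act psiE (scin e phi' a) = map_mx psi (V (scin e phi a)).
Proof.
rewrite (scextE (scin e phi a)) !raddf_sum /=; apply: eq_bigr => i _.
by rewrite linearZ /= map_mxZ !ffunE psiE.
Qed.

Fact mod_ext_act_zmod_morphism : zmod_morphism (mod_ext_act psiE).
Proof.
move=> x y; rewrite /mod_ext_act -sumrB; apply: eq_bigr => i _.
by rewrite -scalerBl !ffunE.
Qed.
HB.instance Definition _ := GRing.isZmodMorphism.Build _ _
  (mod_ext_act psiE) mod_ext_act_zmod_morphism.

Fact mod_ext_act_scalable : scalable (mod_ext_act psiE).
Proof.
move=> c x; rewrite /mod_ext_act scaler_sumr; apply: eq_bigr => i _.
by rewrite scext_scaleE scalerA.
Qed.
HB.instance Definition _ := GRing.isScalable.Build _ _ _ _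
  (mod_ext_act psiE) mod_ext_act_scalable.

Fact mod_ext_act_monoid_morphism : monoid_morphism (mod_ext_act psiE).
Proof.
split=> [|x y]; first by rewrite (mod_ext_act_scin 1) rmorph1 map_mx1.
rewrite [x in LHS]scextE [y in LHS]scextE mulr_suml raddf_sum [RHS]mulr_suml.
apply: eq_bigr => i _; rewrite mulr_sumr raddf_sum mulr_sumr.
apply: eq_bigr => j _; rewrite -scalerAl -scalerAr.
rewrite /= !(mod_ext_act_scalable _ (_ *: _), mod_ext_act_scalable _ (_ * _)).
rewrite -[scin _ _ _ * scin _ _ _]rmorphM mod_ext_act_scin 2!rmorphM map_mxM.
by rewrite -[RHS]/(mulmx _ _) -scalemxAl -scalemxAr.
Qed.
HB.instance Definition _ := GRing.isMonoidMorphism.Build _ _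
  (mod_ext_act psiE) mod_ext_act_monoid_morphism.

Definition mod_ext : matmod (scext e phi') := MatMod (mod_ext_act psiE).

End ModuleExtension.

Section GroupExtension.
Variables (R : comNzRingType) (k k' : fieldType) (A : algType R) (I : finType).
Variables (e : alg_basis A I) (phi : {rmorphism R -> k}).
Variables (phi' : {rmorphism R -> k'}) (psi : {rmorphism k -> k'}).
Hypothesis psiE : forall r, psi (phi r) = phi' r.

Lemma mod_ext_exact (V' V V'' : matmod (scext e phi)) f g :
  short_exact (V' := V') (V := V) (V'' := V'') f g ->
  short_exact (V' := mod_ext psiE V') (V := mod_ext psiE V)
    (V'' := mod_ext psiE V'') (map_mx psi f) (map_mx psi g).
Proof.
case=> fV gV fi gs ex.
have equi (U W : matmod (scext e phi)) (h : 'M_(mdim W, mdim U)) :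
    (forall b, h *m U b = W b *m h) ->
    forall b, map_mx psi h *m mod_ext psiE U b
              = mod_ext psiE W b *m map_mx psi h.
  move=> hE b; rewrite /= /mod_ext_act mulmx_sumr mulmx_suml.
  apply: eq_bigr => i _; rewrite -scalemxAr -scalemxAl; congr (_ *: _).
  by rewrite -!map_mxM hE.
split; [exact: equi|exact: equi|..].
- by rewrite map_trmx row_free_map.
- by rewrite row_free_map.
- by rewrite !map_trmx -map_kermx !map_submx.
Qed.

Fact G0_ext_subproof (V' V V'' : matmod (scext e phi)) f g :
  short_exact (V' := V') (V := V) (V'' := V'') f g ->
  G0_class (mod_ext psiE V)
  = G0_class (mod_ext psiE V') + G0_class (mod_ext psiE V'').
Proof. by move/mod_ext_exact; exact: G0_class_exact. Qed.

Definition G0_ext : {additive G0 (scext e phi) -> G0 (scext e phi')} :=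
  G0_lift G0_ext_subproof.

Lemma G0_ext_class V : G0_ext (G0_class V) = G0_class (mod_ext psiE V).
Proof. exact: G0_lift_class. Qed.

End GroupExtension.

(** * Residue fields *)

Lemma frac_reprE (D : idomainType) (x : {fraction D}) :
  x * FracField.tofrac \d_(repr x) = FracField.tofrac \n_(repr x).
Proof.
rewrite -[x in x * _]reprK; set y := repr x; rewrite !piE; apply/eqmodP.
rewrite /= FracField.equivfE /FracField.mulf.
by rewrite !numden_Ratio ?mulr1 ?oner_eq0 ?denom_ratioP // mulrC.
Qed.

Section ResidueField.
Variables (R : comNzRingType) (p : prime_idealr R).

Definition quot_domain := {ideal_quot p}.
HB.instance Definition _ := GRing.ComNzRing.on quot_domain.

Let unit : pred quot_domain := fun x => `[< exists y, y * x = 1 >].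
Let inv (x : quot_domain) : quot_domain :=
  if pselect (exists y, y * x = 1) is left ex then projT1 (cid ex) else x.

Fact quot_domain_mulVx : {in unit, left_inverse 1 inv *%R}.
Proof.
move=> x /asboolP ex; rewrite /inv; case: pselect => [ex'|/(_ ex)//].
by case: (cid ex') => y /= yx.
Qed.
Fact quot_domain_unitPl x y : y * x = 1 -> unit x.
Proof. by move=> yx; apply/asboolP; exists y. Qed.
Fact quot_domain_invr_out : {in [predC unit], inv =1 id}.
Proof.
move=> x /negP nex; rewrite /inv; case: pselect => // ex; case: nex.
exact/asboolP.
Qed.
HB.instance Definition _ := GRing.ComNzRing_hasMulInverse.Build quot_domain
  quot_domain_mulVx quot_domain_unitPl quot_domain_invr_out.
HB.instance Definition _ := GRing.ComUnitRing_isIntegral.Build quot_domain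
  (@Quotient.rquot_IdomainAxiom R p).

(* k(p) = Frac(R/p); for a maximal ideal this is R/p itself.                  *)
Definition residue_field : fieldType := {fraction quot_domain}.

Definition residue_map (r : R) : residue_field :=
  FracField.tofrac (\pi_({ideal_quot p}) r : quot_domain).

Fact residue_map_zmod_morphism : zmod_morphism residue_map.
Proof.
move=> x y; rewrite /residue_map raddfB.
exact: (rmorphB (@FracField.tofrac quot_domain)).
Qed.
Fact residue_map_monoid_morphism : monoid_morphism residue_map.
Proof.
split=> [|x y]; rewrite /residue_map.
  rewrite rmorph1; exact: (rmorph1 (@FracField.tofrac quot_domain)).
by rewrite rmorphM; exact: (rmorphM (@FracField.tofrac quot_domain)).
Qed.
HB.instance Definition _ := GRing.isZmodMorphism.Build R residue_field
  residue_map residue_map_zmod_morphism.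
HB.instance Definition _ := GRing.isMonoidMorphism.Build R residue_field
  residue_map residue_map_monoid_morphism.

Lemma residue_map_eq0 r : (residue_map r == 0) = (r \in p).
Proof.
rewrite tofrac_eq0 -(raddf0 (\pi_({ideal_quot p}))).
by rewrite -Quotient.idealrBE subr0.
Qed.

Lemma residue_reprE (x : residue_field) (y : {ratio quot_domain} := repr x) :
  x = residue_map (repr (\n_y : quot_domain))
      / residue_map (repr (\d_y : quot_domain)).
Proof.
rewrite /residue_map !reprK -[LHS](mulfK (x := FracField.tofrac \d_y)).
  by rewrite frac_reprE.
by rewrite tofrac_eq0 denom_ratioP.
Qed.

Lemma residue_repr_denom (x : residue_field) :
  repr (\d_(repr x : {ratio quot_domain}) : quot_domain) \notin p.
Proof. by rewrite -residue_map_eq0 /residue_map reprK tofrac_eq0 denom_ratioP. Qed.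

Lemma residue_mapP (x : residue_field) :
  exists r s, s \notin p /\ x = residue_map r / residue_map s.
Proof. by eexists; eexists; split; [exact: residue_repr_denom|exact: residue_reprE]. Qed.

(* The map k(p) -> F induced by a map R -> F with kernel p.                   *)
Section Lift.
Variables (F : fieldType) (f : {rmorphism R -> F}).
Hypothesis fp : forall r, (f r == 0) = (r \in p).

Definition residue_lift_def (_ : forall r, (f r == 0) = (r \in p))
  (x : residue_field) : F :=
  let y : {ratio quot_domain} := repr x in f (repr \n_y) / f (repr \d_y).

Lemma residue_lift_frac r s : s \notin p ->
  residue_lift_def fp (residue_map r / residue_map s) = f r / f s.
Proof.
move=> sp; set x := _ / _; rewrite /residue_lift_def.
have dp := residue_repr_denom x; have := residue_reprE x.
set n := repr _; set d := repr (\d_ _) in dp *.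
rewrite {1}/x => /eqP; rewrite eqr_div ?residue_map_eq0 // -!rmorphM.
rewrite -subr_eq0 -rmorphB residue_map_eq0 -fp rmorphB subr_eq0 !rmorphM => E.
by apply/eqP; rewrite eqr_div ?fp // eq_sym.
Qed.

Fact residue_lift_zmod_morphism : zmod_morphism (residue_lift_def fp).
Proof.
move=> x y; have [a [b [bp ->]]] := residue_mapP x.
have [c [d [dp ->]]] := residue_mapP y.
have bdp : b * d \notin p by rewrite prime_idealrM negb_or bp.
rewrite -mulNr addf_div ?residue_map_eq0 // mulNr -!rmorphM -rmorphB.
rewrite !residue_lift_frac // -[in RHS]mulNr addf_div ?fp // mulNr.
by rewrite -!rmorphM -rmorphB.
Qed.

Fact residue_lift_monoid_morphism : monoid_morphism (residue_lift_def fp).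
Proof.
split=> [|x y].
  have -> : 1 = residue_map 1 / residue_map 1 by rewrite rmorph1 divr1.
  by rewrite residue_lift_frac ?rmorph1 ?divr1 // idealr1.
have [a [b [bp ->]]] := residue_mapP x.
have [c [d [dp ->]]] := residue_mapP y.
have bdp : b * d \notin p by rewrite prime_idealrM negb_or bp.
by rewrite mulf_div -!rmorphM !residue_lift_frac // mulf_div -!rmorphM.
Qed.

HB.instance Definition _ := GRing.isZmodMorphism.Build _ _
  (residue_lift_def fp) residue_lift_zmod_morphism.
HB.instance Definition _ := GRing.isMonoidMorphism.Build _ _
  (residue_lift_def fp) residue_lift_monoid_morphism.

Definition residue_lift : {rmorphism residue_field -> F} := residue_lift_def fp.

Lemma residue_liftE r : residue_lift (residue_map r) = f r.
Proof.
have := @residue_lift_frac r 1; rewrite idealr1 => /(_ isT).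
by rewrite !rmorph1 !divr1.
Qed.

End Lift.
End ResidueField.

(** * Discrete valuation rings of a field *)

Record dvaluation (K : fieldType) := DValuation {
  dval :> K -> int;
  dvalM : forall x y, x != 0 -> y != 0 -> dval (x * y) = dval x + dval y;
  dvalD : forall x y, x != 0 -> y != 0 -> x + y != 0 ->
    Num.min (dval x) (dval y) <= dval (x + y);
  dval_onto : exists2 x, x != 0 & dval x = 1 }.

Section ValuationRing.
Variables (K : fieldType) (v : dvaluation K).

Definition dvr_pred : {pred K} := fun x => (x == 0) || (0 <= v x).

Lemma dval1 : v 1 = 0.
Proof.
have := dvalM v (oner_neq0 K) (oner_neq0 K); rewrite mulr1 => /eqP.
by rewrite -subr_eq0 opprD addrA subrr sub0r oppr_eq0 => /eqP.
Qed.

Lemma dvalN x : v (- x) = v x.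
Proof.
have [->|x0] := eqVneq x 0; first by rewrite oppr0.
have N10 : -1 != 0 :> K by rewrite oppr_eq0 oner_eq0.
have vN1 : v (-1) = 0.
  have := dvalM v N10 N10; rewrite mulrNN mulr1 dval1 => /esym/eqP.
  by rewrite -mulr2n mulrn_eq0 => /eqP.
by rewrite -mulN1r dvalM // vN1 add0r.
Qed.

Fact dvr_subring_closed : subring_closed dvr_pred.
Proof.
split=> [|x y|x y]; rewrite !unfold_in.
- by rewrite dval1 lexx orbT.
- case: eqVneq => [->|x0] /= vx.
    by rewrite sub0r oppr_eq0 dvalN.
  case: eqVneq => [->|y0] /= vy; first by rewrite subr0 vx orbT.
  case: eqVneq => //= xy0; apply: le_trans (dvalD v x0 _ xy0); last first.
    by rewrite oppr_eq0.
  by rewrite dvalN le_min vx.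
case: eqVneq => [->|x0] /= vx; first by rewrite mul0r eqxx.
case: eqVneq => [->|y0] /= vy; first by rewrite mulr0 eqxx.
by rewrite dvalM // addr_ge0 ?orbT.
Qed.
HB.instance Definition _ := GRing.isSubringClosed.Build K dvr_pred
  dvr_subring_closed.

Record dvr := DVR { dvr_val : K; dvr_valP : dvr_val \in dvr_pred }.
HB.instance Definition _ := [isSub for dvr_val].
HB.instance Definition _ := [Choice of dvr by <:].
HB.instance Definition _ := [SubChoice_isSubComNzRing of dvr by <:].

Definition dvr_max : {pred dvr} :=
  fun x => (dvr_val x == 0) || (0 < v (dvr_val x)).

Fact dvr_max_idealr : idealr_closed dvr_max.
Proof.
split.
- by rewrite unfold_in eqxx.
- by rewrite unfold_in oner_eq0 dval1 ltxx.
move=> a x y; rewrite !unfold_in.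
have -> : dvr_val (a * x + y) = dvr_val a * dvr_val x + dvr_val y by [].
case: a => a aP /=; move: aP (dvr_val x) (dvr_val y).
rewrite unfold_in => va {}x {}y.
case: eqVneq va => [->|a0] /= va; first by rewrite mul0r add0r.
case: (eqVneq x 0) => [->|x0] /= vx; first by rewrite mulr0 add0r.
have ax0 : a * x != 0 by rewrite mulf_neq0.
case: (eqVneq y 0) => [->|y0] /= vy.
  by rewrite addr0 (negPf ax0) dvalM // ltr_wpDl.
case: eqVneq => //= axy0; apply: lt_le_trans (dvalD v ax0 y0 axy0).
by rewrite lt_min vy andbT dvalM // ltr_wpDl.
Qed.
HB.instance Definition _ := isIdealr.Build dvr dvr_max dvr_max_idealr.

Fact dvr_max_prime : prime_idealr_closed dvr_max.
Proof.
move=> x y; rewrite !unfold_in.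
have -> : dvr_val (x * y) = dvr_val x * dvr_val y by [].
case: x y => x xP [y yP] /=; move: xP yP; rewrite !unfold_in mulf_eq0.
case: eqVneq => //= x0 vx; case: eqVneq => [_ _ _|y0 /= vy]; rewrite ?orbT //.
rewrite dvalM // [0 < v x]lt_def [0 < v y]lt_def vx vy !andbT.
by case: eqVneq => // ->; case: eqVneq => // ->; rewrite addr0 ltxx.
Qed.
HB.instance Definition _ := isPrimeIdealrClosed.Build dvr dvr_max dvr_max_prime.

End ValuationRing.

Arguments dvr_pred {K} v.
Arguments dvr_max {K} v.

(** * Gates, decomposition maps, DecGen and BlGen *)

Local Open Scope classical_set_scope.

Definition noetherian (R : comNzRingType) : Prop :=
  forall J : set R, J 0 -> (forall x y, J x -> J y -> J (x + y)) ->
    (forall a x, J x -> J (a * x)) ->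
  exists n (g : 'I_n -> R),
    forall x, J x <-> exists c : 'I_n -> R, x = \sum_i c i * g i.

Section LeftIdeals.
Variable T : nzRingType.

Definition left_ideal (J : set T) : Prop :=
  [/\ J 0, forall x y, J x -> J y -> J (x + y) & forall a x, J x -> J (a * x)].

Definition minimal_left_ideal (J : set T) : Prop :=
  [/\ left_ideal J, J <> [set 0] &
      forall J' : set T, left_ideal J' -> (J' `<=` J) ->
        J' = [set 0] \/ J' = J].

(* The left regular module is the sum of its simple submodules.               *)
Definition semisimple_ring : Prop :=
  forall x : T, exists s : seq T, x = \sum_(y <- s) y /\
    forall y, y \in s -> exists J, minimal_left_ideal J /\ J y.

(* Centrally-primitive idempotents of the subring [B] of [T].                 *)
Definition central_idempotent (B : set T) : set T :=
  [set c | [/\ B c, c * c = c & forall x, B x -> c * x = x * c]].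

Definition block_idempotent (B : set T) : set T :=
  [set c | [/\ central_idempotent B c, c != 0 &
    forall c1 c2, central_idempotent B c1 -> central_idempotent B c2 ->
      c1 * c2 = 0 -> c = c1 + c2 -> c1 = 0 \/ c2 = 0]].

End LeftIdeals.

Section Decomposition.
Variables (R : idomainType) (A : algType R) (I : finType) (e : alg_basis A I).

Local Notation K := {fraction R}.
Local Notation toK := (@FracField.tofrac R).
Local Notation "r %:F" := (toK r) : ring_scope.

Definition alg_frac : algType K := scext e toK.
Definition alg_spec (p : prime_idealr R) : algType (residue_field p) :=
  scext e (residue_map p).

Section Prime.
Variable p : prime_idealr R.

Definition loc_ring : set K :=
  [set x | exists a s, s \notin p /\ x = a%:F / s%:F].
Definition loc_max : set K :=
  [set x | exists a s, [/\ a \in p, s \notin p & x = a%:F / s%:F]].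

(* A_p as a subring of A^K.                                                   *)
Definition alg_loc : set alg_frac :=
  [set x : scext e toK | forall i, loc_ring (x i)].

(* The discrete valuation rings with fraction field K are the valuation rings *)
(* [dvr v], with maximal ideal [dvr_max v], of the discrete valuations of K.  *)
Definition dominates (v : dvaluation K) : Prop :=
  (forall x : K, loc_ring x -> x \in dvr_pred v) /\
  (forall x : dvr v, loc_ring (dvr_val x) ->
     (x \in dvr_max v <-> loc_max (dvr_val x))).

Section Gate.
Variables (v : dvaluation K) (dom : dominates v).

Local Notation m := (dvr_max v : prime_idealr (dvr v)).

Fact to_dvr_subproof (r : R) : r%:F \in dvr_pred v.
Proof.
apply: dom.1; exists r, 1; split; first by rewrite idealr1.
by rewrite rmorph1 divr1.
Qed.

Definition to_dvr (r : R) : dvr v := DVR (to_dvr_subproof r).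

Fact to_dvr_zmod_morphism : zmod_morphism to_dvr.
Proof. by move=> x y; apply: val_inj; rewrite /= rmorphB. Qed.
Fact to_dvr_monoid_morphism : monoid_morphism to_dvr.
Proof.
by split=> [|x y]; apply: val_inj; rewrite /= ?rmorph1 ?rmorphM.
Qed.
HB.instance Definition _ :=
  GRing.isZmodMorphism.Build _ _ to_dvr to_dvr_zmod_morphism.
HB.instance Definition _ :=
  GRing.isMonoidMorphism.Build _ _ to_dvr to_dvr_monoid_morphism.

Definition to_dvr_residue : {rmorphism R -> residue_field m} :=
  residue_map m \o to_dvr.

Lemma to_dvr_residue_eq0 r : (to_dvr_residue r == 0) = (r \in p).
Proof.
rewrite /to_dvr_residue /= residue_map_eq0.
have loc_r : loc_ring r%:F.
  exists r, 1; split; first by rewrite idealr1.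
  by rewrite rmorph1 divr1.
have [im mi] := dom.2 (to_dvr r) loc_r.
apply/idP/idP => [/im [a [s [ap sp /eqP]]]|rp].
  have s0 : s%:F != 0 by rewrite tofrac_eq0; apply: contraNneq sp => ->; exact: idealr0.
  rewrite /= -[r%:F]divr1 eqr_div ?oner_eq0 // mulr1 -rmorphM tofrac_eq => /eqP rs.
  by move: ap; rewrite -rs prime_idealrM (negPf sp) orbF.
apply: mi; exists r, 1; split=> //; first by rewrite idealr1.
by rewrite rmorph1 divr1.
Qed.

(* The inclusion k(p) -> k(m) of residue fields.                              *)
Definition residue_incl : {rmorphism residue_field p -> residue_field m} :=
  residue_lift to_dvr_residue_eq0.

Definition alg_dvr : algType (dvr v) := scext e to_dvr.
Definition alg_dvr_spec : algType (residue_field m) := scext e to_dvr_residue.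

(* The map d_A^{p,m}.                                                         *)
Definition gate_map : {additive G0 (alg_spec p) -> G0 alg_dvr_spec} :=
  G0_ext e (residue_liftE to_dvr_residue_eq0).

Definition perfect_gate : Prop := bijective gate_map.

Definition dvr_incl : {rmorphism dvr v -> K} := (\val : dvr v -> K).

Lemma dvr_inclE r : dvr_incl (to_dvr r) = r%:F.
Proof. by []. Qed.

Definition generic_fibre (L : matmod alg_dvr) : matmod alg_frac :=
  mod_ext dvr_inclE L.
Definition special_fibre (L : matmod alg_dvr) : matmod alg_dvr_spec :=
  mod_ext (psi := residue_map m) (phi' := to_dvr_residue) (fun=> erefl) L.

(* An isomorphism K (x) L -> V identifies L with an A^O-stable, O-free        *)
(* O-submodule of V spanning V over K, and conversely.                        *)
Definition is_lattice (V : matmod alg_frac) (L : matmod alg_dvr) : Prop :=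
  mod_iso (generic_fibre L) V.

(* [d] sends [V] to the preimage of [L/mL] under d_A^{p,m}, for any lattice.  *)
Definition is_decomposition_map
    (d : {additive G0 alg_frac -> G0 (alg_spec p)}) : Prop :=
  forall V L, is_lattice V L ->
    gate_map (d (G0_class V)) = G0_class (special_fibre L).

End Gate.

Definition trivial_decomposition
    (d : {additive G0 alg_frac -> G0 (alg_spec p)}) : Prop :=
  [/\ forall V, mod_simple V ->
        exists2 W, mod_simple W & d (G0_class V) = G0_class W,
      forall V V', mod_simple V -> mod_simple V' ->
        d (G0_class V) = d (G0_class V') -> mod_iso V V'
    & forall W, mod_simple W ->
        exists2 V, mod_simple V & d (G0_class V) = G0_class W].

End Prime.

(* The zero prime always belongs to DecGen, its decomposition map being the   *)
(* identity.                                                                  *)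
Definition DecGen : set (prime_idealr R) :=
  [set p : prime_idealr R | (exists2 r, r \in p & r != 0) ->
     forall (v : dvaluation K) (dom : dominates p v), perfect_gate dom ->
     exists2 d, is_decomposition_map dom d & trivial_decomposition d].

Definition BlGen : set (prime_idealr R) :=
  [set p : prime_idealr R |
     block_idempotent (alg_loc p) = block_idempotent [set: alg_frac]].

End Decomposition.

(* Main.v *)
Require Import Defs.
From HB Require Import structures.
From mathcomp Require Import all_boot all_order all_algebra.
From mathcomp Require Import boolp classical_sets.
From mathcomp.multinomials Require Import freeg.
From mathcomp Require Import zify.

(* Over a field, a cellular algebra has the cell modules [W_l] whose form is  *)
(* nonzero as a basis of its Grothendieck group, so that extension of scalars *)
(* is an isomorphism on G_0 and every discrete valuation ring dominating      *)
(* [R_p] is a perfect gate.  Such a ring exists by blowing up [p] and         *)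
(* applying Krull's principal ideal theorem and the Krull-Akizuki argument.   *)
(* The semisimplicity of [A^K] means that all forms are nondegenerate over    *)
(* [K], and both [p \in DecGen] and [p \in BlGen] turn out to be equivalent   *)
(* to the nondegeneracy of all forms modulo [p]:                              *)
(* - the decomposition map sends [W_l] over [K] to [W_l] modulo [p], and      *)
(*   these are simple and pairwise non-isomorphic exactly in this case;       *)
(* - if the forms are nondegenerate modulo [p] then [A_p] is a product of     *)
(*   matrix algebras; conversely, if the block idempotents of [A^K] lie in    *)
(*   [A_p] then different cell modules have no common constituent modulo [p], *)
(*   which forces the radicals of the forms to vanish.                        *)

Set Implicit Arguments.
Unset Strict Implicit.
Unset Printing Implicit Defensive.

Import Order.TTheory GRing.Theory Num.Theory.
Local Open Scope ring_scope.

(** * Valuation rings of a field *)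

(** Both sides are compared with a third condition on [p]: every Gram matrix [cell_gram l] is
    invertible modulo [p]. Whenever all Gram matrices are invertible over a base ring, the cell
    representations identify the extended algebra with a product of matrix algebras
    ([cell_mod_surj], [cell_mod_inj]). Over [K] this is the case because a semisimple ring is von
    Neumann regular, while a radical vector of a form violates regularity ([semisimple_regular],
    [semisimple_gram_unit]).

    Blocks. If the Gram determinants lie outside [p], the product decomposition exists over [R_p],
    and the same elements are the blocks of [A_p] and of [A^K] ([BlGen_of_gram_unit]). Conversely, a
    block of [A^K] lying in [A_p], multiplied by a denominator outside [p], acts modulo [p] as a
    nonzero scalar on one cell module and as zero on the others. A nonzero radical of the form would
    receive a nonzero map from one of the others, which is absurd ([gram_unit_of_BlGen]).

    Decomposition maps. Cell modules over a discrete valuation ring are lattices, so a decomposition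
    map sends cell classes to cell classes. Over a field the cell classes with nonzero form are a
    basis of the Grothendieck group ([G0_cell_span], [cell_span_uniq]), hence scalar extension is
    bijective ([G0_ext_bij]). Triviality makes the cell classes modulo [p] distinct classes of
    simple modules, which forces invertibility ([gram_unit_of_simple_classes]). Conversely,
    invertibility gives idempotents over the valuation ring whose ranks on a lattice agree in both
    fibres, and these ranks are the multiplicities of the cell modules ([trivial_of_gram_unit]).

    A point of [DecGen] gives information only if a gate exists, which is [dominating_valuation]: a
    chart of the blow-up of [p] makes [p] divisible by one element [x]; localizing at a minimal
    prime over [x] gives a one-dimensional noetherian local domain ([hauptidealsatz]), and a
    valuation ring above it in which [x] is no unit is discrete ([uniformizer_factor]). *)

Section Subrings.
Local Open Scope classical_set_scope.
Variable K : fieldType.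
Implicit Types (B T V J : set K) (x y z : K).

Definition is_subring B := [/\ B 1, forall x y, B x -> B y -> B (x - y)
  & forall x y, B x -> B y -> B (x * y)].

Definition is_submod B J := [/\ J 0, forall x y, J x -> J y -> J (x + y)
  & forall b x, B b -> J x -> J (b * x)].

Lemma subring0 B : is_subring B -> B 0.
Proof. by case=> B1 BB _; rewrite -(subrr 1); apply: BB. Qed.

Lemma subringN B x : is_subring B -> B x -> B (- x).
Proof. by move=> hB; rewrite -sub0r; case: (hB) => _ BB _; apply: BB; exact: subring0. Qed.

Lemma subringD B x y : is_subring B -> B x -> B y -> B (x + y).
Proof.
by move=> hB Bx By; rewrite -[y]opprK; case: (hB) => _ BB _; apply: BB => //; exact: subringN.
Qed.

Lemma subringX B x n : is_subring B -> B x -> B (x ^+ n).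
Proof.
move=> [B1 _ BM] Bx; elim: n => [|n IH]; first by rewrite expr0.
by rewrite exprS; apply: BM.
Qed.

Lemma subring_submod B : is_subring B -> is_submod B B.
Proof.
move=> hB; split; [exact: subring0|by move=> *; exact: subringD|].
by case: hB.
Qed.

Lemma submodN B J x : is_subring B -> is_submod B J -> J x -> J (- x).
Proof.
by move=> hB [_ _ JM] Jx; rewrite -mulN1r; apply: JM => //; apply: subringN => //; case: hB.
Qed.

Lemma submodB B J x y : is_subring B -> is_submod B J -> J x -> J y -> J (x - y).
Proof. by move=> hB hJ Jx Jy; case: (hJ) => _ JD _; apply: JD => //; exact: (submodN hB hJ). Qed.

Lemma submod_sum B J (I : Type) {r : seq I} (P : pred I) (F : I -> K) :
  is_submod B J -> (forall i, P i -> J (F i)) -> J (\sum_(i <- r | P i) F i).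
Proof. by move=> [J0 JD _]; apply: (big_ind J). Qed.

Definition span_of B n (g : 'I_n -> K) : set K :=
  [set z | exists2 c : 'I_n -> K, (forall i, B (c i)) & z = \sum_i c i * g i].

Lemma span_of_submod B n (g : 'I_n -> K) : is_subring B -> is_submod B (span_of B g).
Proof.
move=> hB; split.
- exists (fun=> 0); first by move=> i; exact: subring0.
  by rewrite big1 // => i _; rewrite mul0r.
- move=> x y [c Bc ->] [d Bd ->]; exists (fun i => c i + d i).
    by move=> i; exact: subringD.
  by rewrite -big_split; apply: eq_bigr => i _; rewrite mulrDl.
- move=> b x Bb [c Bc ->]; exists (fun i => b * c i).
    by move=> i; case: hB => _ _; apply.
  by rewrite mulr_sumr; apply: eq_bigr => i _; rewrite mulrA.
Qed.

Lemma span_of_sub B n (g : 'I_n -> K) J :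
  is_submod B J -> (forall i, J (g i)) -> span_of B g `<=` J.
Proof.
move=> hJ Jg z [c Bc ->]; apply: (submod_sum hJ) => i _.
by case: hJ => _ _; apply.
Qed.

Lemma span_of_gen B n (g : 'I_n -> K) i : is_subring B -> span_of B g (g i).
Proof.
move=> hB; exists (fun j => (j == i)%:R).
  by move=> j; case: eqP => _ /=; [case: hB|exact: subring0].
rewrite (bigD1 i) //= eqxx mul1r big1 ?addr0 // => j /negPf ->.
by rewrite mul0r.
Qed.

Definition adjoin B y : set K :=
  [set z | exists2 f : {poly K}, (forall i, B f`_i) & z = f.[y]].

Lemma adjoin_subring B y : is_subring B -> is_subring (adjoin B y).
Proof.
move=> hB; split.
- exists 1; last by rewrite hornerC.
  by move=> i; rewrite coef1; case: eqP => _ /=; [case: hB|exact: subring0].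
- move=> _ _ [f Bf ->] [g Bg ->]; exists (f - g); last by rewrite hornerD hornerN.
  by move=> i; rewrite coefB; case: hB => _ + _; apply.
- move=> _ _ [f Bf ->] [g Bg ->]; exists (f * g); last by rewrite hornerM.
  move=> i; rewrite coefM; apply: (submod_sum (subring_submod hB)) => j _.
  by case: hB => _ _; apply.
Qed.

Lemma sub_adjoin B y : is_subring B -> B `<=` adjoin B y.
Proof.
move=> hB b Bb; exists b%:P; last by rewrite hornerC.
by move=> i; rewrite coefC; case: eqP => _ //=; exact: subring0.
Qed.

Lemma adjoin_mem B y : is_subring B -> adjoin B y y.
Proof.
move=> hB; exists 'X; last by rewrite hornerX.
by move=> i; rewrite coefX; case: eqP => _ /=; [case: hB|exact: subring0].
Qed.

Lemma adjoin_sub B V y : is_subring V -> B `<=` V -> V y -> adjoin B y `<=` V.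
Proof.
move=> hV BV Vy _ [f Bf ->]; rewrite horner_coef.
apply: (submod_sum (subring_submod hV)) => i _; case: (hV) => _ _; apply.
  exact: BV.
exact: subringX.
Qed.

(** Collecting powers of [y] writes an element of [g B[y]] as a polynomial in [y] whose coefficients
    lie in [g B]. *)
Lemma span_adjoin B y n (g : 'I_n -> K) z : is_subring B -> span_of (adjoin B y) g z ->
  exists2 f : {poly K}, (forall i, span_of B g f`_i) & f.[y] = z.
Proof.
move=> hB [c Bc ->].
have /choice [F HF] : forall i, exists f : {poly K}, (forall j, B f`_j) /\ c i = f.[y].
  by move=> i; case: (Bc i) => f; exists f.
exists (\sum_i (g i) *: F i).
  move=> j; rewrite coef_sum; exists (fun i => (F i)`_j); first by move=> i; case: (HF i).
  by apply: eq_bigr => i _; rewrite coefZ mulrC.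
rewrite horner_sum; apply: eq_bigr => i _.
by rewrite hornerZ mulrC; case: (HF i) => _ ->.
Qed.

(** * Chevalley's theorem: a subring maximal for keeping an ideal proper is a valuation ring *)

Section Chevalley.
Variables (V : set K) (n : nat) (g : 'I_n -> K).
Hypotheses (hV : is_subring V) (gV : forall i, V (g i)).
Local Notation I := (span_of V g).
Hypothesis gN1 : ~ I 1.
Hypothesis maxV : forall y, ~ V y -> span_of (adjoin V y) g 1.

Let hI : is_submod V I := span_of_submod g hV.
Let IV : I `<=` V.
Proof. exact: span_of_sub (subring_submod hV) gV. Qed.

(** Otherwise maximality gives [f] with coefficients in [I] and value 1 at [(1 - b)^-1]. Clearing
    denominators puts a power of [1 - b] in [I], although it is congruent to 1 modulo [I]. *)
Lemma maximal_unit b : I b -> V (1 - b)^-1.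
Proof.
move=> Ib; apply: contrapT => /maxV /(span_adjoin hV) [f If f1].
have u0 : 1 - b != 0.
  by rewrite subr_eq0; apply/eqP => b1; apply: gN1; rewrite b1.
have Vu k : V ((1 - b) ^+ k).
  by apply: subringX => //; case: (hV) => V1 VB _; apply: VB => //; exact: IV.
have Iu k : I (1 - (1 - b) ^+ k).
  elim: k => [|k IH]; first by rewrite expr0 subrr; case: hI.
  have -> : 1 - (1 - b) ^+ k.+1 = (1 - (1 - b) ^+ k) + (1 - b) ^+ k * b.
    by rewrite exprSr mulrBr mulr1 opprB [_ * b - _]addrC addrA.
  by case: hI => _ ID IM; apply: ID => //; apply: IM.
have Iuf : I ((1 - b) ^+ size f).
  have -> : (1 - b) ^+ size f = (1 - b) ^+ size f * f.[(1 - b)^-1] by rewrite f1 mulr1.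
  rewrite horner_coef mulr_sumr; apply: (submod_sum hI) => i _; rewrite mulrCA.
  have -> : (1 - b) ^+ size f = (1 - b) ^+ (size f - i) * (1 - b) ^+ i.
    by rewrite -exprD subnK // ltnW.
  rewrite -mulrA exprVn divff ?expf_neq0 // mulr1.
  by rewrite mulrC; case: hI => _ _; apply.
apply: gN1; rewrite -[1](subrK ((1 - b) ^+ size f)).
by case: hI => _ + _; apply.
Qed.

(** Infinite descent on the two sizes: the relation of smaller size, say that of [y^-1], expresses a
    power of [y] by lower powers and so shortens the other relation. The two roles are exchanged by
    replacing [y] with [y^-1]. *)
Lemma maximal_rel_size m : forall y (f h : {poly K}), y != 0 -> (size f + size h <= m)%N ->
  (forall i, I f`_i) -> (forall i, I h`_i) -> f.[y] = 1 -> h.[y^-1] = 1 -> False.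
Proof.
elim: m => [|m IH] y f h y0 sfh If Ih f1 h1.
  move: sfh; rewrite leqn0 addn_eq0 size_poly_eq0 => /andP [/eqP f0 _].
  by move/eqP: f1; rewrite f0 horner0 eq_sym oner_eq0.
wlog shf : y f h y0 sfh If Ih f1 h1 / (size h <= size f)%N.
  move=> W; case: (leqP (size h) (size f)) => [|/ltnW] hf; first exact: (W y f h).
  by apply: (W y^-1 h f) => //; rewrite ?invr_eq0 ?invrK // addnC.
have fn0 : f != 0 by apply/eqP => f0; move/eqP: f1; rewrite f0 horner0 eq_sym oner_eq0.
have Vu := maximal_unit (Ih 0%N); set u := _^-1 in Vu.
have u0 : 1 - h`_0 != 0.
  by rewrite subr_eq0; apply/eqP => b1; apply: gN1; rewrite b1.
move sf: (size f) => [|d]; first by move/eqP: sf; rewrite size_poly_eq0 (negPf fn0).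
pose r := \sum_(j < size h | (0 < j)%N) (u * h`_j) *: 'X^(d - j) : {poly K}.
have ry : r.[y] = y ^+ d.
  have -> : y ^+ d = u * (1 - h`_0) * y ^+ d by rewrite mulVf // mul1r.
  have -> : 1 - h`_0 = \sum_(j < size h | (0 < j)%N) h`_j * y^-1 ^+ j.
    apply/eqP; rewrite subr_eq -h1 horner_coef; apply/eqP.
    rewrite [X in _ = X + _]big_mkcond /=.
    case sh: (size h) => [|e].
      by rewrite !big_ord0 add0r nth_default // sh.
    by rewrite !big_ord_recl /= expr0 mulr1 add0r addrC.
  rewrite mulr_sumr mulr_suml horner_sum; apply: eq_bigr => j j0.
  rewrite hornerZ hornerXn -!mulrA; congr (_ * (_ * _)).
  have jd : (j <= d)%N by rewrite -ltnS -sf (leq_trans (ltn_ord j)).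
  by rewrite -{2}(subnK jd) exprD mulrCA -exprMn mulVf // expr1n mulr1.
pose f' := f - f`_d *: 'X^d + f`_d *: r.
apply: (IH y f' h) => //.
- apply: (leq_trans (n := (d + size h)%N)); last by move: sfh; rewrite sf addSn.
  rewrite leq_add2r; apply/leq_sizeP => j dj.
  rewrite !coefD coefN !coefZ coefXn coef_sum.
  have [jd|jd] := eqVneq j d.
    rewrite jd mulr1 subrr big1 ?mulr0 ?addr0 // => k k0.
    rewrite coefZ coefXn [_ == _]gtn_eqF ?mulr0 // ltn_subrL k0.
    by move: (ltn_ord k) => /leq_trans/(_ shf); rewrite sf ltnS; exact: leq_trans.
  rewrite mulr0 subr0 nth_default ?sf ?add0r; last by rewrite ltn_neqAle eq_sym jd.
  rewrite big1 ?mulr0 // => k k0; rewrite coefZ coefXn [_ == _]gtn_eqF ?mulr0 //.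
  by apply: leq_ltn_trans (leq_subr _ _) _; rewrite ltn_neqAle eq_sym jd.
- move=> i; case: (hI) => I0 ID IM; rewrite coefD coefB !coefZ coefXn coef_sum.
  apply: (ID); last first.
    rewrite mulrC; apply: IM => //; apply: (submod_sum (subring_submod hV)) => k _.
    rewrite coefZ coefXn; case: (hV) => V1 VB VM; apply: (VM).
      by apply: VM => //; exact: IV.
    by case: eqP => _ //=; exact: subring0.
  apply: (submodB hV hI) => //; rewrite mulrC; apply: IM => //.
  by case: eqP => _ /=; [case: hV|exact: subring0].
- by rewrite hornerD hornerD hornerN !hornerZ hornerXn ry subrK.
Qed.

Lemma maximal_valuation y : y != 0 -> V y \/ V y^-1.
Proof.
move=> y0; case: (pselect (V y)) => [|/maxV /(span_adjoin hV) [f If f1]]; first by left.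
case: (pselect (V y^-1)) => [|/maxV /(span_adjoin hV) [h Ih h1]]; first by right.
by case: (@maximal_rel_size (size f + size h) y f h).
Qed.

End Chevalley.

Definition is_valuation_ring V := is_subring V /\ forall y, y != 0 -> V y \/ V y^-1.

(** Zorn's lemma for the subrings above [B] in which [g] generates a proper ideal. They are written
    [B] union [X] so that the empty chain needs no separate bound. *)
Lemma valuation_ring_exists B n (g : 'I_n -> K) :
  is_subring B -> (forall i, B (g i)) -> ~ span_of B g 1 ->
  exists V, [/\ is_valuation_ring V, B `<=` V & ~ span_of V g 1].
Proof.
move=> hB Bg gN1.
pose P := [set X : set K | is_subring (B `|` X) /\ ~ span_of (B `|` X) g 1].
have [|X [[hX XN1] maxX]] := @Zorn_bigcup K P.
  move=> F FP Ftot.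
  have [[X0 FX0]|F0] := pselect (exists X, F X); last first.
    have -> : \bigcup_(X in F) X = set0.
      by apply/seteqP; split=> // x [X FX _]; apply: F0; exists X.
    by rewrite /P /= setU0.
  have dir m (c : 'I_m -> K) : (forall i, (B `|` \bigcup_(X in F) X) (c i)) ->
      exists2 X, F X & forall i, (B `|` X) (c i).
    elim: m c => [|m IH] c Uc; first by exists X0 => // -[].
    have [X FX XC] := IH (fun i => c (fintype.lift ord0 i)) (fun i => Uc _).
    have [Y FY YC] : exists2 Y, F Y & (B `|` Y) (c ord0).
      case: (Uc ord0) => [Bc|[Y FY Yc]]; first by exists X0 => //; left.
      by exists Y => //; right.
    have [Z FZ [XZ YZ]] : exists2 Z, F Z & X `<=` Z /\ Y `<=` Z.
      by case: (Ftot X Y FX FY) => H; [exists Y|exists X] => //; split.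
    exists Z => // i; case: (unliftP ord0 i) => [j|] ->.
      by case: (XC j) => ?; [left|right; apply: XZ].
    by case: YC => ?; [left|right; apply: YZ].
  have sub X : F X -> B `|` X `<=` B `|` \bigcup_(X in F) X.
    by move=> FX; apply: setUS => x Xx; exists X.
  split.
    have two (c1 c2 : K) : (B `|` \bigcup_(X in F) X) c1 -> (B `|` \bigcup_(X in F) X) c2 ->
        exists2 X, F X & (B `|` X) c1 /\ (B `|` X) c2.
      move=> U1 U2.
      have [|X FX XC] := dir 2 (fun i => if i == ord0 then c1 else c2).
        by move=> i; case: ifP.
      by exists X => //; split; [exact: (XC ord0)|exact: (XC (fintype.lift ord0 ord0))].
    split; first by left; case: hB.
      move=> x y Ux Uy; have [X FX [Xx Xy]] := two _ _ Ux Uy.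
      by apply: (sub X FX); have [[_ XB _] _] := FP X FX; apply: XB.
    move=> x y Ux Uy; have [X FX [Xx Xy]] := two _ _ Ux Uy.
    by apply: (sub X FX); have [[_ _ XM] _] := FP X FX; apply: XM.
  move=> [c Uc E]; have [X FX XC] := dir _ c Uc.
  by have [_] := FP X FX; apply; exists c.
set V := B `|` X in hX XN1.
have maxV y : ~ V y -> span_of (adjoin V y) g 1.
  move=> Vy; apply: contrapT => N1; apply: (maxX (adjoin V y)).
    split; first by move=> z Xz; apply: sub_adjoin => //; right.
    by move=> /(_ y (adjoin_mem _ hX)) Xy; apply: Vy; right.
  have E : B `|` adjoin V y = adjoin V y.
    by apply/setUidPr => z Bz; apply: sub_adjoin => //; left.
  by rewrite /P /= E; split=> //; exact: adjoin_subring.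
exists V; split=> //; last by left.
split=> // y; apply: (maximal_valuation hX _ XN1 maxV).
by move=> i; left.
Qed.

End Subrings.

(** * Noetherian subrings of a field *)

Section Noetherian.
Local Open Scope classical_set_scope.
Variable K : fieldType.
Implicit Types (B T V J : set K) (x y z : K).

(* Generation of [J] by [s] is expressed by quantifying over the submodules   *)
(* containing [s].                                                            *)
Definition noeth_subring B := forall J, is_submod B J -> J `<=` B ->
  exists2 s : seq K, (forall x, x \in s -> J x) &
    forall J', is_submod B J' -> (forall x, x \in s -> J' x) -> J `<=` J'.

(** * Hilbert's basis theorem for [B[y]] *)

Section HilbertBasis.
Variables (B : set K) (y : K) (J : set K).
Hypotheses (hB : is_subring B) (nB : noeth_subring B).
Hypothesis hJ : is_submod (adjoin B y) J.

Definition poly_in J' (f : {poly K}) := (forall i, B f`_i) /\ J' f.[y].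

(** For [J' = J] this is the ideal of leading coefficients in degree [d]. A general [J'] gives the
    submodule against which generators of that ideal are tested: a leading coefficient lying in it
    is matched by a polynomial with value in both [J] and [J']. *)
Definition lead_set J' d : set K :=
  [set c | exists f, [/\ poly_in J f, J' f.[y], (size f <= d.+1)%N & f`_d = c]].

Lemma poly_inD J' f g : is_submod (adjoin B y) J' ->
  poly_in J' f -> poly_in J' g -> poly_in J' (f + g).
Proof.
move=> [_ JD _] [Bf Jf] [Bg Jg]; split; last by rewrite hornerD; apply: JD.
by move=> i; rewrite coefD; apply: subringD.
Qed.

Lemma poly_inM J' (f g : {poly K}) : is_submod (adjoin B y) J' ->
  (forall i, B f`_i) -> poly_in J' g -> poly_in J' (f * g).
Proof.
move=> [_ _ JM] Bf [Bg Jg]; split; last by rewrite hornerM; apply: JM => //; exists f.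
move=> i; rewrite coefM; apply: (submod_sum (subring_submod hB)) => j _.
by case: hB => _ _; apply.
Qed.

Lemma lead_set_submod J' d : is_submod (adjoin B y) J' -> is_submod B (lead_set J' d).
Proof.
move=> hJ'; split.
- exists 0; split; rewrite ?size_poly0 ?coef0 ?horner0 //; last by case: hJ'.
  by split; [move=> i; rewrite coef0; exact: subring0|rewrite horner0; case: hJ].
- move=> _ _ [f [Jf J'f sf <-]] [g [Jg J'g sg <-]]; exists (f + g); split.
  + exact: poly_inD.
  + by rewrite hornerD; case: hJ' => _ + _; apply.
  + by rewrite (leq_trans (size_polyD _ _)) // geq_max sf.
  + by rewrite coefD.
- move=> b _ Bb [f [Jf J'f sf <-]]; exists (b%:P * f).
  have Bb' : forall i, B (b%:P)`_i.
    by move=> i; rewrite coefC; case: eqP => _ //=; exact: subring0.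
  split; first exact: poly_inM.
  + by rewrite hornerM hornerC; case: hJ' => _ _; apply => //; exact: sub_adjoin.
  + by rewrite mul_polyC (leq_trans (size_scale_leq _ _)).
  + by rewrite coefCM.
Qed.

Lemma lead_set_sub J' d : lead_set J' d `<=` B.
Proof. by move=> _ [f [[Bf _] _ _ <-]]. Qed.

(** Generators are added degree by degree: those of the leading coefficients in degree [d] lower the
    size of a polynomial by one. *)
Lemma small_degree_gen d : exists2 s : seq K, (forall x, x \in s -> J x) &
  forall J', is_submod (adjoin B y) J' -> (forall x, x \in s -> J' x) ->
  forall f, poly_in J f -> (size f <= d)%N -> J' f.[y].
Proof.
elim: d => [|d [s sJ sgen]].
  exists [::] => // J' hJ' _ f _; rewrite leqn0 size_poly_eq0 => /eqP ->.
  by rewrite horner0; case: hJ'.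
have [c cL cgen] := nB (lead_set_submod d hJ) (@lead_set_sub J d).
have /choice [F HF] : forall x, exists f, x \in c ->
    [/\ poly_in J f, J f.[y], (size f <= d.+1)%N & f`_d = x].
  move=> x; case: (boolP (x \in c)) => [xc|_]; last by exists 0.
  by have [f Hf] := cL x xc; exists f.
exists (s ++ [seq (F x).[y] | x <- c]).
  move=> x; rewrite mem_cat => /orP [/sJ //|/mapP [z /HF [? ? _ _] ->] //].
move=> J' hJ' sJ' f Jf sf.
have [||h [Jh J'h sh hd]] := cgen _ (lead_set_submod d hJ') _ f`_d.
- move=> x xc; have [? ? ? ?] := HF x xc; exists (F x); split=> //.
  by apply: sJ'; rewrite mem_cat; apply/orP; right; apply/mapP; exists x.
- by exists f; split=> //; case: Jf.
rewrite -[f](subrK h) hornerD; case: (hJ') => _ J'D J'M; apply: (J'D) => //.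
apply: sgen => //.
- by move=> x xs; apply: sJ'; rewrite mem_cat xs.
- rewrite -mulN1r -polyCN; apply: poly_inD => //; apply: poly_inM => // i.
  rewrite coefC; case: eqP => _ /=; last exact: subring0.
  by apply: subringN => //; case: hB.
- apply/leq_sizeP => j; rewrite leq_eqVlt => /predU1P [<-|dj].
    by rewrite coefB hd subrr.
  by rewrite coefB !nth_default ?subrr // (leq_trans _ dj).
Qed.

Lemma hilbert_gen : exists2 s : seq K, (forall x, x \in s -> J x) &
  forall J', is_submod (adjoin B y) J' -> (forall x, x \in s -> J' x) ->
  forall f, poly_in J f -> J' f.[y].
Proof.
pose L : set K := \bigcup_d lead_set J d.
have shift J' d e f : is_submod (adjoin B y) J' -> (d <= e)%N ->
    [/\ poly_in J f, J' f.[y], (size f <= d.+1)%N & True] ->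
    [/\ poly_in J ('X^(e - d) * f), J' ('X^(e - d) * f).[y],
      (size ('X^(e - d) * f)%R <= e.+1)%N & ('X^(e - d) * f)`_e = f`_d].
  move=> hJ' de [Jf J'f sf _].
  have BX i : B ('X^(e - d) : {poly K})`_i.
    by rewrite coefXn; case: eqP => _ /=; [case: hB|exact: subring0].
  split; first exact: poly_inM.
  - rewrite hornerM; case: hJ' => _ _; apply => //.
    by exists 'X^(e - d).
  - apply: leq_trans (size_polyMleq _ _) _; rewrite size_polyXn /=.
    by apply: leq_trans (leq_add (leqnn _) sf) _; rewrite addnS subnK.
  - by rewrite coefXnM ltnNge leq_subr /= subKn.
have hL : is_submod B L.
  split; first by exists 0%N => //; case: (lead_set_submod 0 hJ).
    move=> _ _ [d _ [f [? ? ? <-]]] [e _ [g [? ? ? <-]]].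
    exists (maxn d e) => //.
    have [] // := shift J d (maxn d e) f hJ (leq_maxl _ _).
    have [] // := shift J e (maxn d e) g hJ (leq_maxr _ _).
    move=> ? ? ? <- ? ? ? <-; case: (lead_set_submod (maxn d e) hJ) => _ + _.
    by apply; [exists ('X^(maxn d e - d) * f)|exists ('X^(maxn d e - e) * g)].
  move=> b x Bb [d _ Lx]; exists d => //.
  by case: (lead_set_submod d hJ) => _ _; apply.
have [c cL cgen] := nB hL (fun z '(ex_intro2 d _ Ld) => lead_set_sub Ld).
have /choice [F HF] : forall x, exists fd : {poly K} * nat, x \in c ->
    [/\ poly_in J fd.1, J fd.1.[y], (size fd.1 <= fd.2.+1)%N & fd.1`_fd.2 = x].
  move=> x; case: (boolP (x \in c)) => [xc|_]; last by exists (0, 0%N).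
  by have [d _ [f Hf]] := cL x xc; exists (f, d).
(* In degrees at least [D] every leading coefficient is reached by shifting the chosen polynomials
   by powers of ['X]; the smaller degrees are left to [small_degree_gen]. *)
pose D := \max_(x <- c) (F x).2.
have [s sJ sgen] := small_degree_gen D.
exists (s ++ [seq (F x).1.[y] | x <- c]).
  move=> x; rewrite mem_cat => /orP [/sJ //|/mapP [z /HF [? ? _ _] ->] //].
move=> J' hJ' sJ' f Jf.
have [m] := ubnP (size f); elim: m f Jf => // m IH f Jf; rewrite ltnS => sfm.
case: (leqP (size f) D) => [sf|Dsf].
  by apply: sgen => // x xs; apply: sJ'; rewrite mem_cat xs.
move sf: (size f) => [|d]; first by rewrite sf in Dsf.
rewrite sf ltnS in Dsf.
have [||h [Jh J'h sh hd]] := cgen _ (lead_set_submod d hJ') _ f`_d.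
- move=> x xc; have [? ? ? <-] := HF x xc.
  have Fd : ((F x).2 <= d)%N by apply: leq_trans Dsf; rewrite /D (leq_bigmax_seq (F := fun x => (F x).2)).
  exists ('X^(d - (F x).2) * (F x).1); apply: shift => //; split=> //.
  by apply: sJ'; rewrite mem_cat; apply/orP; right; apply/mapP; exists x.
- by exists d => //; exists f; split=> //; [case: Jf|rewrite sf].
rewrite -[f](subrK h) hornerD; case: (hJ') => _ J'D J'M; apply: (J'D) => //.
apply: IH.
- rewrite -mulN1r -polyCN; apply: poly_inD => //; apply: poly_inM => // i.
  rewrite coefC; case: eqP => _ /=; last exact: subring0.
  by apply: subringN => //; case: hB.
- apply: leq_trans sfm; rewrite sf ltnS.
  apply/leq_sizeP => j; rewrite leq_eqVlt => /predU1P [<-|dj].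
    by rewrite coefB hd subrr.
  by rewrite coefB !nth_default ?subrr ?sf // (leq_trans _ dj).
Qed.

End HilbertBasis.

Lemma noeth_adjoin B y : is_subring B -> noeth_subring B -> noeth_subring (adjoin B y).
Proof.
move=> hB nB J hJ JA; have [s sJ sgen] := hilbert_gen hB nB hJ.
exists s => // J' hJ' sJ' z Jz; have [f Bf zf] := JA z Jz.
by rewrite zf; apply: sgen => //; split; rewrite -?zf.
Qed.

Lemma noeth_adjoin_seq B V (s : seq K) : is_subring B -> noeth_subring B ->
  is_subring V -> B `<=` V -> (forall x, x \in s -> V x) ->
  exists B', [/\ is_subring B', noeth_subring B', B `<=` B', B' `<=` V &
    forall x, x \in s -> B' x].
Proof.
move=> hB nB hV BV; elim: s => [|y s IH] sV; first by exists B; split.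
have [|B' [hB' nB' BB' B'V sB']] := IH.
  by move=> x xs; apply: sV; rewrite in_cons xs orbT.
exists (adjoin B' y); split.
- exact: adjoin_subring.
- exact: noeth_adjoin.
- by apply: subset_trans (sub_adjoin _ hB').
- by apply: adjoin_sub => //; apply: sV; rewrite mem_head.
- move=> x; rewrite in_cons => /predU1P [->|/sB' ?]; first exact: adjoin_mem.
  exact: sub_adjoin.
Qed.

Definition fractions B (M : set K) : set K :=
  [set x | exists b m, [/\ B b, M m & x = b / m]].

(** * Rings of fractions inside the field *)

Section Fractions.
Variables (B M : set K).
Hypotheses (hB : is_subring B) (MB : M `<=` B) (M1 : M 1) (M0 : ~ M 0).
Hypothesis MM : forall a b, M a -> M b -> M (a * b).

Let Mn0 m : M m -> m != 0.
Proof. by move=> Mm; apply/eqP => m0; apply: M0; rewrite -m0. Qed.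

Lemma fractions_subring : is_subring (fractions B M).
Proof.
case: (hB) => B1 BB BM; split.
- by exists 1, 1; rewrite divr1.
- move=> _ _ [b [m [Bb Mm ->]]] [b' [m' [Bb' Mm' ->]]].
  exists (b * m' - b' * m), (m * m'); split; [|exact: MM|].
    by apply: BB; apply: BM => //; apply: MB.
  by rewrite -mulNr addf_div ?Mn0 // mulNr.
- move=> _ _ [b [m [Bb Mm ->]]] [b' [m' [Bb' Mm' ->]]].
  by exists (b * b'), (m * m'); split; [exact: BM|exact: MM|rewrite mulf_div].
Qed.

Lemma sub_fractions : B `<=` fractions B M.
Proof. by move=> b Bb; exists b, 1; rewrite divr1. Qed.

Lemma fractionsV m : M m -> fractions B M m^-1.
Proof. by move=> Mm; exists 1, m; rewrite div1r; case: hB. Qed.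

(** A submodule of the ring of fractions is generated by its intersection with [B]. *)
Lemma noeth_fractions : noeth_subring B -> noeth_subring (fractions B M).
Proof.
move=> nB J hJ JT; have [|z [_ Bz] //|s sJ sgen] := nB (J `&` B).
  split; first by split; [case: hJ|exact: subring0].
    by move=> x y [Jx Bx] [Jy By]; split; [case: hJ => _ + _; apply|exact: subringD].
  move=> b x Bb [Jx Bx]; split; last by case: hB => _ _; apply.
  by case: hJ => _ _; apply => //; exact: sub_fractions.
exists s => [x /sJ [] //|J' hJ' sJ' z Jz].
have [b [m [Bb Mm zE]]] := JT z Jz.
rewrite zE mulrC; case: (hJ') => _ _; apply; first exact: fractionsV.
apply: (sgen J') => //.
  case: hJ' => J'0 J'D J'M; split=> // c x Bc J'x; apply: J'M => //.
  exact: sub_fractions.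
split=> //; have -> : b = m * z by rewrite zE mulrCA divff ?mulr1 ?Mn0.
by case: hJ => _ _; apply => //; apply: sub_fractions; exact: MB.
Qed.

End Fractions.
End Noetherian.

(** * One-dimensional local domains *)

Section OneDimensional.
Local Open Scope classical_set_scope.
Variables (K : fieldType) (T q : set K) (x : K).
Hypotheses (hT : is_subring T) (nT : noeth_subring T).
Hypotheses (hq : is_submod T q) (qT : q `<=` T) (q1 : ~ q 1).
Hypothesis Tloc : forall t, T t -> q t \/ t != 0 /\ T t^-1.
Hypotheses (qx : q x) (x0 : x != 0).
Hypothesis qnil : forall t, q t -> exists k, T (t ^+ k / x).
Implicit Types (D E L J : set K) (y z : K).

Definition add_cyclic D z : set K := [set w | exists d t, [/\ D d, T t & w = d + t * z]].

(* [s] lists generators of the successive quotients, each isomorphic to [T/q] *)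
(* or zero, of a filtration of [E] starting with [D].                         *)
Fixpoint comp_series D (s : seq K) E : Prop :=
  if s is z :: s' then (forall a, q a -> D (a * z)) /\ comp_series (add_cyclic D z) s' E
  else D = E.

Lemma comp_series_cat D s E s' F :
  comp_series D s E -> comp_series E s' F -> comp_series D (s ++ s') F.
Proof.
elim: s D => [|z s IH] D /=; first by move=> ->.
by move=> [Dz /IH H] /H.
Qed.

Lemma add_cyclic_submod D z : is_submod T D -> is_submod T (add_cyclic D z).
Proof.
move=> [D0 DD DM]; split.
- by exists 0, 0; rewrite mul0r addr0; split=> //; exact: subring0.
- move=> _ _ [d [t [Dd Tt ->]]] [d' [t' [Dd' Tt' ->]]].
  exists (d + d'), (t + t'); split; [exact: DD|exact: subringD|].
  by rewrite mulrDl addrACA.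
- move=> b _ Tb [d [t [Dd Tt ->]]]; exists (b * d), (b * t).
  by split; [exact: DM|case: hT => _ _; apply|rewrite mulrDr mulrA].
Qed.

Lemma sub_add_cyclic D z : D `<=` add_cyclic D z.
Proof. by move=> d Dd; exists d, 0; rewrite mul0r addr0; split=> //; exact: subring0. Qed.

Lemma add_cyclic_mem D z : is_submod T D -> add_cyclic D z z.
Proof.
by move=> [D0 _ _]; exists 0, 1; rewrite mul1r add0r; split=> //; case: hT.
Qed.

Definition scale_set (u : K) D : set K := [set w | exists2 d, D d & w = u * d].

Lemma scale_set_comp u v D : scale_set u (scale_set v D) = scale_set (u * v) D.
Proof.
apply/seteqP; split=> w.
  by move=> [_ [d Dd ->] ->]; exists d => //; rewrite mulrA.
by move=> [d Dd ->]; exists (v * d); [exists d|rewrite mulrA].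
Qed.

Lemma scale_set_submod u D : is_submod T D -> is_submod T (scale_set u D).
Proof.
move=> [D0 DD DM]; split; first by exists 0; rewrite ?mulr0.
  by move=> _ _ [d Dd ->] [d' Dd' ->]; exists (d + d'); [exact: DD|rewrite mulrDr].
by move=> b _ Tb [d Dd ->]; exists (b * d); [exact: DM|rewrite mulrCA].
Qed.

Lemma comp_series_scale u D s E : comp_series D s E ->
  comp_series (scale_set u D) [seq u * z | z <- s] (scale_set u E).
Proof.
elim: s D => [|z s IH] D /=; first by move=> ->.
move=> [Dz /IH H]; split.
  by move=> a qa; exists (a * z); [exact: Dz|rewrite mulrCA].
suff -> : add_cyclic (scale_set u D) (u * z) = scale_set u (add_cyclic D z) by [].
apply/seteqP; split=> w.
  move=> [_ [t [[d Dd ->] Tt ->]]]; exists (d + t * z); first by exists d, t.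
  by rewrite mulrDr mulrCA.
move=> [_ [d [t [Dd Tt ->]]] ->]; exists (u * d), t; split=> //; first by exists d.
by rewrite mulrDr mulrCA.
Qed.

(** For a submodule [L] and a series [s] from [D] to [E], this is the length of the quotient of [L]
    meet [E] by [L] meet [D], counted as the number of steps at which the trace of [L] grows. *)
Fixpoint jumps D (s : seq K) L : nat :=
  if s is z :: s' then
    (`[< exists w, [/\ L w, add_cyclic D z w & ~ D w] >] + jumps (add_cyclic D z) s' L)%N
  else 0%N.

Lemma jumps_size D s L : (jumps D s L <= size s)%N.
Proof. by elim: s D => //= z s IH D; rewrite -add1n leq_add ?leq_b1. Qed.

Lemma jumps_mono D s L L' : L `<=` L' -> (jumps D s L <= jumps D s L')%N.
Proof.
move=> LL'; elim: s D => //= z s IH D; rewrite leq_add //.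
case: asboolP => //= -[w [/LL' Lw Dw Dw']]; case: asboolP => // [[]].
by exists w.
Qed.

(** Two nested submodules with the same trace on [D] and the same number of jumps must jump at the
    same steps, and then they agree step by step because each quotient is simple or zero. *)
Lemma jumps_strict D s E L L' : is_submod T D -> comp_series D s E ->
  is_submod T L -> is_submod T L' -> L `<=` L' -> L' `<=` E -> L' `&` D `<=` L ->
  (jumps D s L' <= jumps D s L)%N -> L' `<=` L.
Proof.
move=> + + hL hL' LL' + +; elim: s D => [|z s IH] D hD /=.
  by move=> -> L'E L'L _ w L'w; apply: L'L; split=> //; exact: L'E.
move=> [Dz cs] L'E L'L le_jumps.
have jm := jumps_mono (add_cyclic D z) s LL'.
have bm : (`[< exists w, [/\ L w, add_cyclic D z w & ~ D w] >] <=
           `[< exists w, [/\ L' w, add_cyclic D z w & ~ D w] >])%N.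
  have := @jumps_mono D [:: z] _ _ LL'.
  by rewrite /= !addn0.
apply: (IH _ (add_cyclic_submod z hD) cs L'E); last first.
  by rewrite -(leq_add2l `[< exists w, [/\ L w, add_cyclic D z w & ~ D w] >])
    (leq_trans _ le_jumps) // leq_add2r.
move=> y [L'y Dy]; case: (pselect (D y)) => [?|nDy]; first exact: L'L.
have : (`[< exists w, [/\ L' w, add_cyclic D z w & ~ D w] >] <=
        `[< exists w, [/\ L w, add_cyclic D z w & ~ D w] >])%N.
  by rewrite -(leq_add2r (jumps (add_cyclic D z) s L')) (leq_trans le_jumps) // leq_add2l.
rewrite [`[< exists w, [/\ L' w, _ & _] >]](asboolT _); last by exists y.
case: asboolP => // -[w [Lw [d [t [Dd Tt wE]]] nDw]] _.
have [d' [t' [Dd' Tt' yE]]] := Dy.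
(* If [t] were in [q], then [t * z] and hence [w] would be in [D]. So [t] is a unit, and subtracting
   [t' / t * w] brings [y] into [D]. *)
case: (Tloc Tt) => [qt|[t0 Tt1]].
  by case: nDw; rewrite wE; case: hD => _ + _; apply => //; exact: Dz.
have Tu : T (t' / t) by case: hT => _ _; apply.
rewrite -[y](subrK (t' / t * w)); case: (hL) => _ LD LM; apply: (LD); last exact: LM.
apply: L'L; split.
  apply: (submodB hT) => //; case: hL' => _ _; apply => //; exact: LL'.
have -> : y - t' / t * w = d' - t' / t * d.
  by rewrite yE wE mulrDr mulrA divfK // opprD addrACA subrr addr0.
by apply: (submodB hT) => //; case: hD => _ _; apply.
Qed.

(** The number of jumps drops at each step of a strictly decreasing chain, and it is at most
    [size s] at the start. *)
Lemma chain_bound D s E n (L : nat -> set K) : is_submod T D -> comp_series D s E ->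
  (forall i, (i <= n)%N -> [/\ is_submod T (L i), D `<=` L i & L i `<=` E]) ->
  (forall i, (i < n)%N -> L i.+1 `<=` L i /\ ~ (L i `<=` L i.+1)) -> (n <= size s)%N.
Proof.
move=> hD cs hL hlt.
suff H i : (i <= n)%N -> (i + jumps D s (L i) <= jumps D s (L 0%N))%N.
  by apply: leq_trans (jumps_size D s (L 0%N)); apply: leq_trans (H n _) => //; exact: leq_addr.
elim: i => [|i IH] lin; first by rewrite add0n.
apply: leq_trans (IH (ltnW lin)); rewrite addSn -addnS leq_add2l.
rewrite ltnNge; apply/negP => le_j; have [sub nsub] := hlt i lin; apply: nsub.
have [hLi DLi LiE] := hL i (ltnW lin); have [hLi' DLi' _] := hL _ lin.
by apply: (jumps_strict hD cs) => // w [_]; exact: DLi'.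
Qed.

(** The union of a chain is finitely generated, and finitely many generators already lie in one
    member, which is therefore the whole union. *)
Lemma noeth_max (P : set (set K)) (C0 : set K) : P C0 ->
  (forall C, P C -> is_submod T C /\ C `<=` T) ->
  exists2 C, P C & forall C', P C' -> C `<=` C' -> C' = C.
Proof.
move=> PC0 hP; pose Q := [set X : set K | P (C0 `|` X)].
have [|X [QX maxX]] := @Zorn_bigcup K Q.
  move=> F FQ Ftot; have [[X0 FX0]|F0] := pselect (exists X, F X); last first.
    have -> : \bigcup_(X in F) X = set0.
      by apply/seteqP; split=> // y [X FX _]; apply: F0; exists X.
    by rewrite /Q /= setU0.
  set U := C0 `|` \bigcup_(X in F) X.
  have dir (s : seq K) : (forall y, y \in s -> U y) ->
      exists2 X, F X & forall y, y \in s -> (C0 `|` X) y.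
    elim: s => [|y s IH] sU; first by exists X0.
    have [|X FX XC] := IH; first by move=> z zs; apply: sU; rewrite in_cons zs orbT.
    have [Y FY YC] : exists2 Y, F Y & (C0 `|` Y) y.
      case: (sU y (mem_head _ _)) => [Bc|[Y FY Yc]]; first by exists X0 => //; left.
      by exists Y => //; right.
    have [Z FZ [XZ YZ]] : exists2 Z, F Z & X `<=` Z /\ Y `<=` Z.
      by case: (Ftot X Y FX FY) => H; [exists Y|exists X] => //; split.
    exists Z => // z; rewrite in_cons => /predU1P [->|zs].
      by case: YC => ?; [left|right; apply: YZ].
    by case: (XC z zs) => ?; [left|right; apply: XZ].
  have sub X : F X -> C0 `|` X `<=` U by move=> FX; apply: setUS => y Xy; exists X.
  have hU : is_submod T U /\ U `<=` T.
    split; last first.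
      move=> y Uy; have [|X FX /(_ y)] := dir [:: y]; first by move=> z; rewrite inE => /eqP ->.
      by rewrite mem_head => /(_ isT) Xy; have [_] := hP _ (FQ X FX); apply.
    split; first by left; case: (hP _ PC0) => [[]].
      move=> y z Uy Uz; have [|X FX XC] := dir [:: y; z].
        by move=> w; rewrite !inE => /orP [] /eqP ->.
      apply: (sub X FX); have [[_ + _] _] := hP _ (FQ X FX).
      by apply; apply: XC; rewrite !inE eqxx ?orbT.
    move=> b y Tb Uy; have [|X FX XC] := dir [:: y].
      by move=> w; rewrite !inE => /eqP ->.
    apply: (sub X FX); have [[_ _ +] _] := hP _ (FQ X FX).
    by apply => //; apply: XC; rewrite !inE eqxx.
  have [s sU sgen] := nT hU.1 hU.2.
  have [X FX sX] := dir s sU.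
  have UX : U = C0 `|` X.
    apply/seteqP; split; last exact: sub.
    by apply: sgen => //; have [] := hP _ (FQ X FX).
  by rewrite /Q /= -/U UX; exact: FQ.
exists (C0 `|` X) => // C' PC' XC'; apply/seteqP; split=> //.
apply: contrapT => nC'; apply: (maxX C').
  split; first by move=> y Xy; apply: XC'; right.
  by move=> C'X; apply: nC' => y /C'X; right.
by rewrite /Q /=; have -> : C0 `|` C' = C' by apply/setUidPr => y C0y; apply: XC'; left.
Qed.

(** [T / x T] has finite length: take [C] maximal among the submodules reached from [x T]. If [C] is
    proper, some [z] outside [C] satisfies [q z] inside [C] and extends the series. *)
Lemma comp_series_exists : exists s, comp_series (scale_set x T) s T.
Proof.
have TM : forall a b, T a -> T b -> T (a * b) by case: hT.
have hxT : is_submod T (scale_set x T) by apply/scale_set_submod/subring_submod.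
pose P := [set C | exists s, [/\ comp_series (scale_set x T) s C, is_submod T C & C `<=` T]].
have [||C [s [cs hC CT]] maxC] := @noeth_max P (scale_set x T).
- by exists [::]; split=> // _ [t Tt ->]; apply: TM => //; exact: qT.
- by move=> C [s []].
suff CE : C = T by rewrite -{2}CE; exists s.
have xC : scale_set x T `<=` C.
  elim: (s) (scale_set x T) cs => [|z s' IH] D /=; first by move=> ->.
  by move=> [_ /IH]; apply: subset_trans; exact: sub_add_cyclic.
apply/seteqP; split=> //; apply: contrapT => nC.
have nC1 : ~ C 1.
  by move=> C1; apply: nC => t Tt; rewrite -[t]mulr1; case: hC => _ _; apply.
have [g gq ggen] := nT hq qT.
(* Start from 1 and multiply, for each generator of [q] in turn, by its highest power that stays
   outside [C]; a high enough power lands in [x T], hence in [C]. *)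
have [z [Tz nCz zC]] : exists z, [/\ T z, ~ C z & forall a, a \in g -> C (a * z)].
  elim: g gq {ggen} => [|a g IH] gq; first by exists 1; split=> //; case: hT.
  have [|z [Tz nCz zC]] := IH; first by move=> b bg; apply: gq; rewrite in_cons bg orbT.
  have qa : q a by apply: gq; rewrite mem_head.
  have [k Tk] := qnil qa.
  have ex : exists k, `[< C (a ^+ k * z) >].
    exists k; apply/asboolP; apply: xC; exists (a ^+ k / x * z); first exact: TM.
    by rewrite mulrA mulrCA divff // mulr1.
  case: (ex_minnP ex) => -[|j] /asboolP Cj minj; first by rewrite expr0 mul1r in Cj.
  exists (a ^+ j * z); split.
  - by apply: TM => //; apply: subringX => //; exact: qT.
  - by move=> Cj'; have := minj j; rewrite ltnn => /(_ (asboolT Cj')).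
  - move=> b; rewrite in_cons => /predU1P [->|bg]; first by rewrite mulrA -exprS.
    rewrite mulrCA; case: hC => _ _; apply; last exact: zC.
    by apply: subringX => //; exact: qT.
have qzC a : q a -> C (a * z).
  apply: (ggen [set a | C (a * z)]) => //; split=> /=.
  - by rewrite mul0r; case: hC.
  - by move=> b c Cb Cc; rewrite mulrDl; case: hC => _ + _; apply.
  - by move=> b c Tb Cc; rewrite -mulrA; case: hC => _ _; apply.
apply: nCz; rewrite -(maxC (add_cyclic C z)).
- exact: add_cyclic_mem.
- exists (rcons s z); split.
  + by rewrite -cats1; apply: comp_series_cat cs _ => /=; split.
  + exact: add_cyclic_submod.
  + move=> _ [d [t [Cd Tt ->]]]; apply: subringD => //; last exact: TM.
    exact: CT.
- exact: sub_add_cyclic.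
Qed.

(** Generators of [J] over [J'] are discarded one at a time: if [h = z + x w] and [w = d + t h],
    then [(1 - x t) h = z + x d] with [1 - x t] a unit. *)
Lemma nakayama J J' : is_submod T J -> J `<=` T -> is_submod T J' -> J' `<=` J ->
  (forall y, J y -> exists z w, [/\ J' z, J w & y = z + x * w]) -> J `<=` J'.
Proof.
move=> hJ JT hJ' J'J red; have [s sJ sgen] := nT hJ JT.
have TM : forall a b, T a -> T b -> T (a * b) by case: hT.
have {}sgen I : is_submod T I -> J' `<=` I -> (forall y, y \in s -> I y) -> J `<=` I.
  by move=> hI _; exact: sgen.
elim: s sJ sgen => [|h s IH] sJ sgen; first by apply: (sgen J') => //.
apply: IH => [y ys|I hI J'I sI]; first by apply: sJ; rewrite in_cons ys orbT.
have Jh : J h by apply: sJ; rewrite mem_head.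
have [z [w [J'z Jw hE]]] := red h Jh.
have hIh := add_cyclic_submod h hI.
have [||d [t [Id Tt wE]]] := sgen (add_cyclic I h) hIh _ _ w Jw.
- by apply: subset_trans J'I _; exact: sub_add_cyclic.
- move=> y; rewrite in_cons => /predU1P [->|/sI Iy]; first exact: add_cyclic_mem.
  exact: sub_add_cyclic.
have qxt : q (x * t) by rewrite mulrC; case: hq => _ _; apply.
have T1xt : T (1 - x * t).
  by case: (hT) => T1 TB _; apply: TB => //; exact: qT.
have Ih : I h.
  have [q1xt|[u0 Tu]] := Tloc T1xt.
    case: q1; rewrite -[1](subrK (x * t)); case: hq => _ + _; apply=> //.
  have -> : h = (1 - x * t)^-1 * (z + x * d).
    apply: (mulfI u0); rewrite mulrA divff // mul1r mulrBl mul1r {1}hE wE.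
    by rewrite mulrDr mulrA addrA addrK.
  case: (hI) => _ ID IM; apply: (IM) => //; apply: ID; first exact: J'I.
  by apply: IM => //; exact: qT.
apply: sgen => // y; rewrite in_cons => /predU1P [->//|]; exact: sI.
Qed.

(* The sets [J n] in the proof play the role of the symbolic powers in the    *)
(* usual proof of Krull's principal ideal theorem.                            *)
Lemma hauptidealsatz b : T b -> b != 0 -> exists k, T (x ^+ k / b).
Proof.
move=> Tb b0; have [s cs] := comp_series_exists.
have TM : forall a b, T a -> T b -> T (a * b) by case: hT.
have Tx : T x by exact: qT.
have hxT : is_submod T (scale_set x T) by apply/scale_set_submod/subring_submod.
pose J n : set K := [set y | T y /\ exists k, T (x ^+ k * y / b ^+ n)].
have hJ n : is_submod T (J n).
  split.
  - by split; [exact: subring0|exists 0%N; rewrite mulr0 mul0r; exact: subring0].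
  - move=> y z [Ty [k Tk]] [Tz [j Tj]]; split; first exact: subringD.
    exists (k + j)%N; rewrite mulrDr mulrDl; apply: subringD => //.
      by rewrite exprD [x ^+ k * _]mulrC -!mulrA; apply: TM; [exact: subringX|rewrite mulrA].
    by rewrite exprD -!mulrA; apply: TM; [exact: subringX|rewrite mulrA].
  - move=> c y Tc [Ty [k Tk]]; split; first exact: TM.
    by exists k; rewrite mulrCA -mulrA; exact: TM.
have JT n : J n `<=` T by move=> y [].
have JS n : J n.+1 `<=` J n.
  move=> y [Ty [k Tk]]; split=> //; exists k.
  suff -> : x ^+ k * y / b ^+ n = b * (x ^+ k * y / b ^+ n.+1) by exact: TM.
  by rewrite exprS invfM mulrCA mulVKf.
have xJ n w : T w -> J n (x * w) -> J n w.
  by move=> Tw [_ [k Tk]]; split=> //; exists k.+1; rewrite exprSr -[x ^+ k * x * w]mulrA.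
pose L n : set K := [set y | exists z t, [/\ J n z, T t & y = z + x * t]].
have hL n : is_submod T (L n).
  case: (hJ n) => J0 JD JM; split.
  - by exists 0, 0; rewrite mulr0 addr0; split=> //; exact: subring0.
  - move=> _ _ [d [t [Dd Tt ->]]] [d' [t' [Dd' Tt' ->]]].
    by exists (d + d'), (t + t'); rewrite mulrDr addrACA; split; [exact: JD|exact: subringD|].
  - move=> c _ Tc [d [t [Dd Tt ->]]]; exists (c * d), (c * t).
    by split; [exact: JM|exact: TM|rewrite mulrDr mulrCA].
(* The sets [L n], which are [J n + x T], form a decreasing chain above [x T], and [T / x T] has
   finite length. *)
have [n Ln] : exists n, L n `<=` L n.+1.
  apply: contrapT => /forallNP H.
  suff: (size s < size s)%N by rewrite ltnn.
  apply: (chain_bound (L := L) hxT cs) => i _.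
    split=> // [_ [t Tt ->]|_ [z [t [[Tz _] Tt ->]]]].
      by exists 0, t; rewrite add0r; split=> //; case: (hJ i).
    by apply: subringD => //; apply: TM.
  split=> // _ [z [t [Jz Tt ->]]]; exists z, t; split=> //; exact: JS.
(* As [J n] is saturated with respect to [x], inclusion modulo [x T] improves to [J n] inside
   [J n.+1 + x J n], where Nakayama applies. Then [b ^+ n] lies in [J n.+1], and dividing by
   [b ^+ n] gives the claim. *)
have : J n `<=` J n.+1.
  apply: (nakayama (hJ n) (JT n) (hJ n.+1) (JS n)) => y Jy.
  have [|z [w [Jz Tw yE]]] := Ln y.
    by exists y, 0; rewrite mulr0 addr0; split=> //; exact: subring0.
  exists z, w; split=> //; apply: xJ => //.
  have -> : x * w = y - z by rewrite yE addrC addKr.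
  by apply: (submodB hT (hJ n)) => //; exact: JS.
move=> /(_ (b ^+ n)) [|_ [k]].
  split; first exact: subringX.
  by exists 0%N; rewrite mul1r divff ?expf_neq0 //; case: hT.
by rewrite exprSr invfM mulrA mulfK ?expf_neq0 //; exists k.
Qed.

(* The number of jumps is compared on [T / x^e T] for large [e]: this is the  *)
(* length estimate in the Krull-Akizuki theorem.                              *)
Section KrullAkizuki.
Variable V : set K.
Hypotheses (hV : is_valuation_ring V) (TV : T `<=` V) (xV : ~ V x^-1).

Definition val_lt y z := V (z / y) /\ ~ V (y / z).

Let VM a b : V a -> V b -> V (a * b). Proof. by case: hV => -[_ _ M] _; exact: M. Qed.
Let V1 : V 1. Proof. by case: hV => -[]. Qed.
Let TM a b : T a -> T b -> T (a * b). Proof. by case: hT => _ _; apply. Qed.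
Let Tx : T x. Proof. exact: qT. Qed.

Lemma comp_series_pow s e : comp_series (scale_set x T) s T ->
  exists s', comp_series (scale_set (x ^+ e) T) s' T /\ size s' = (e * size s)%N.
Proof.
move=> cs; elim: e => [|e [s' [cs' sz]]].
  exists [::]; split=> //=; apply/seteqP; split=> w.
    by move=> [d Td ->]; rewrite expr0 mul1r.
  by move=> Tw; exists w; rewrite ?expr0 ?mul1r.
exists ([seq x ^+ e * z | z <- s] ++ s'); split; last by rewrite size_cat size_map sz mulSn.
apply: comp_series_cat cs'; have := comp_series_scale (x ^+ e) cs.
by rewrite scale_set_comp -exprSr.
Qed.

(** The ideals of [T] of elements of value at least that of [w i] form a strict chain above
    [x ^+ e T], so its length is bounded by that of [T / x ^+ e T]. *)
Lemma val_chain_bound s e n (w : nat -> K) : comp_series (scale_set x T) s T ->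
  (forall i, (i <= n)%N -> T (w i) /\ w i != 0) ->
  (forall i, (i < n)%N -> val_lt (w i) (w i.+1)) ->
  V (x ^+ e / w n) -> (n <= e * size s)%N.
Proof.
move=> cs hw lw wx; have [s' [cs' <-]] := comp_series_pow e cs.
have wn i : (i <= n)%N -> V (x ^+ e / w i).
  move=> lin; have [d] := ubnP (n - i)%N; elim: d i lin => // d IH i.
  rewrite leq_eqVlt => /predU1P [-> //|lin]; rewrite ltnS => nid.
  have -> : x ^+ e / w i = (x ^+ e / w i.+1) * (w i.+1 / w i).
    by rewrite mulrA divfK //; have [] := hw _ lin.
  apply: VM; last by case: (lw i lin).
  by apply: IH => //; rewrite (leq_trans _ nid) // ltn_sub2l.
pose L i : set K := [set y | T y /\ V (y / w i)].
apply: (chain_bound (L := L) _ cs') => [|i lin|i lin].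
- exact/scale_set_submod/subring_submod.
- split; last by move=> y [].
    split; first by split; rewrite ?mul0r; [exact: subring0|apply: subring0; case: hV].
      move=> y z [Ty Vy] [Tz Vz]; split; first exact: subringD.
      by rewrite mulrDl; apply: subringD => //; case: hV.
    move=> b y Tb [Ty Vy]; split; first exact: TM.
    by rewrite -mulrA; apply: VM => //; exact: TV.
  move=> _ [t Tt ->]; split; first by apply: TM => //; exact: subringX.
  by rewrite mulrAC; apply: VM; [exact: wn|exact: TV].
- have [wi0 wi'0] := ((hw i (ltnW lin)).2, (hw _ lin).2).
  have [Vw nVw] := lw i lin; split.
    move=> y [Ty Vy]; split=> //.
    have -> : y / w i = (y / w i.+1) * (w i.+1 / w i) by rewrite mulrA divfK.
    exact: VM.
  move=> /(_ (w i)) [|_ //]; split; first by have [] := hw i (ltnW lin).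
  by rewrite divff.
Qed.

Hypothesis KT : forall b : K, exists k, T (x ^+ k * b).

(** The [y i] need not lie in [T]. The chain is repeated periodically by multiplying with powers of
    [x], and moved into [T] by one factor [x ^+ c], whose cost becomes negligible as the number of
    periods grows. *)
Lemma value_chain_bound s n (y : nat -> K) : comp_series (scale_set x T) s T ->
  (forall i, (i <= n)%N -> y i != 0) -> y 0%N = 1 -> y n = x ->
  (forall i, (i < n)%N -> val_lt (y i) (y i.+1)) -> (n <= size s)%N.
Proof.
move=> cs yn0 y0 yn ly; case: n => [//|n] in yn0 yn ly *.
have [c hc] : exists c, forall i, (i <= n)%N -> T (x ^+ c * y i).
  elim: {-2}n (leqnn n) => [|m IH] lemn.
    by have [c Tc] := KT (y 0%N); exists c => i; rewrite leqn0 => /eqP ->.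
  have [c hc] := IH (ltnW lemn); have [d hd] := KT (y m.+1); exists (c + d)%N => i.
  rewrite leq_eqVlt => /predU1P [->|lim]; rewrite exprD.
    by rewrite -mulrA; apply: TM => //; exact: subringX.
  by rewrite [x ^+ c * _]mulrC -mulrA; apply: TM; [exact: subringX|exact: hc].
pose w i := x ^+ c * (x ^+ (i %/ n.+1) * y (i %% n.+1)%N).
(* [N] periods of a chain of length [n] give [n * N <= (c + N) * size s]; as [N] exceeds
   [c * size s], this excludes [n > size s]. *)
pose N := (c * size s).+1.
have : (n.+1 * N <= (c + N) * size s)%N.
  apply: (val_chain_bound (w := w)) => // [i _|i _|].
  - split; last first.
      by rewrite !mulf_neq0 ?expf_neq0 // yn0 // (leq_trans _ (leqnSn n)) // -ltnS ltn_pmod.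
    rewrite /w mulrCA; apply: TM; first exact: subringX.
    by apply: hc; rewrite -ltnS ltn_pmod.
  - have H u a b : u != 0 -> a != 0 -> b != 0 -> val_lt a b -> val_lt (u * a) (u * b).
      by rewrite /val_lt => u0 a0 b0; rewrite -!mulf_div divff // !mul1r.
    have i_n : (i %% n.+1 <= n)%N by rewrite -ltnS ltn_pmod.
    suff -> : w i.+1 = x ^+ c * (x ^+ (i %/ n.+1) * y (i %% n.+1).+1).
      have [ya yb] : y (i %% n.+1)%N != 0 /\ y (i %% n.+1).+1 != 0.
        by split; apply: yn0 => //; exact: leqW.
      by apply: (H); rewrite ?mulf_neq0 ?expf_neq0 //; apply: H; rewrite ?expf_neq0 //; apply: ly.
    rewrite /w {1 2}(divn_eq i n.+1) -addnS.
    move: (i %/ n.+1)%N (i %% n.+1)%N i_n => a b; rewrite leq_eqVlt => /predU1P [->|bn].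
      by rewrite addnC -mulSn mulnK // modnMl y0 mulr1 exprSr yn.
    by rewrite divnMDl // divn_small // addn0 modnMDl modn_small.
  - rewrite /w mulnC mulnK // modnMl y0 mulr1 -exprD divff //; exact: expf_neq0.
rewrite mulnDl => le1; rewrite leqNgt; apply/negP => lt_s.
suff : ((size s).+1 * N <= n.+1 * N)%N.
  move=> le2; have := leq_trans le2 le1.
  by rewrite mulSn mulnC leq_add2r /N ltnn.
by rewrite leq_mul2r lt_s orbT.
Qed.

(** Take a longest chain of values from 1 to [x] and let [pi] be the first element after 1; a value
    strictly between 1 and [pi] would lengthen the chain. *)
Lemma uniformizer_exists : exists pi, [/\ pi != 0, V pi, ~ V pi^-1 &
  forall z, z != 0 -> V z -> ~ V z^-1 -> V (z / pi)].
Proof.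
have [s cs] := comp_series_exists.
pose P n := `[< exists y : nat -> K, [/\ forall i, (i <= n)%N -> y i != 0, y 0%N = 1,
  y n = x & forall i, (i < n)%N -> val_lt (y i) (y i.+1)] >].
have lt1 z : V z -> ~ V z^-1 -> val_lt 1 z by rewrite /val_lt divr1 div1r.
have P1 : P 1%N.
  apply/asboolP; exists (fun i => if i is 0%N then 1 else x); split=> //.
    by move=> [|i] _ //; exact: oner_neq0.
  by move=> [|//] _; apply: lt1 => //; exact: TV.
have Pb n : P n -> (n <= size s)%N.
  by move=> /asboolP [y [? ? ? ?]]; exact: (value_chain_bound (y := y)).
have [n /asboolP [y [y0 y1 yx ly]] maxn] := ex_maxnP (ex_intro P 1%N P1) Pb.
have n0 : (0 < n)%N by exact: maxn.
exists (y 1%N); split.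
- exact: y0.
- by have [] := ly 0%N n0; rewrite y1 divr1.
- by have [_] := ly 0%N n0; rewrite y1 div1r.
move=> z z0 Vz nVz; apply: contrapT => nVzp.
suff : (n.+1 <= n)%N by rewrite ltnn.
apply: maxn; apply/asboolP.
exists (fun i => if i is j.+1 then (if j is 0%N then z else y j) else 1); split=> //.
- by move=> [|[|i]] // lin; [exact: oner_neq0|exact: y0].
- by case: n n0 yx {ly y0}.
move=> [|[|i]] // lin; [exact: lt1| |exact: ly].
split=> //.
have p0 : z / y 1%N != 0 by rewrite mulf_neq0 ?invr_eq0 ?y0.
case: hV => _ /(_ _ p0) [//|]; by rewrite invfM invrK mulrC.
Qed.

(** Dividing by [pi] as often as possible leaves a unit, provided the number of divisions is
    bounded. For [x] the bound comes from chains of values; for [b] it follows since [b] divides a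
    power of [x]. *)
Lemma uniformizer_factor : exists pi, [/\ pi != 0, V pi, ~ V pi^-1 &
  forall b, b != 0 -> V b -> exists j, V (b / pi ^+ j) /\ V (pi ^+ j / b)].
Proof.
have [s cs] := comp_series_exists.
have [pi [p0 Vp nVp pmax]] := uniformizer_exists; exists pi; split=> //.
have Vpn j k : V (pi ^+ j / pi ^+ k) -> (k <= j)%N.
  move=> Vjk; rewrite leqNgt; apply/negP => jk; apply: nVp.
  have -> : pi^-1 = pi ^+ (k - j).-1 * (pi ^+ j / pi ^+ k).
    apply: (mulIf (expf_neq0 k p0)); rewrite -mulrA divfK ?expf_neq0 // -exprD.
    have -> : k = ((k - j).-1 + j).+1 by rewrite -addSn prednK ?subn_gt0 // subnK // ltnW.
    by rewrite exprS mulrA mulVf // mul1r; congr (_ ^+ _); lia.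
  by apply: VM => //; apply: subringX => //; case: hV.
have maximal b : b != 0 -> V b -> (exists B, forall j, V (b / pi ^+ j) -> (j <= B)%N) ->
    exists j, V (b / pi ^+ j) /\ V (pi ^+ j / b).
  move=> b0 Vb [B hB].
  have P0 : exists j, `[< V (b / pi ^+ j) >] by exists 0%N; rewrite expr0 divr1; apply/asboolP.
  have Pb j : `[< V (b / pi ^+ j) >] -> (j <= B)%N by move=> /asboolP /hB.
  have [j /asboolP Vj maxj] := ex_maxnP P0 Pb; exists j; split=> //.
  apply: contrapT => nVj; have /pmax : b / pi ^+ j != 0.
    by rewrite mulf_neq0 ?invr_eq0 ?expf_neq0.
  have nVi : ~ V (b / pi ^+ j)^-1 by rewrite invfM invrK mulrC.
  move=> /(_ Vj nVi); rewrite -mulrA -invfM -exprSr => Vj1.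
  by have := maxj j.+1 (asboolT Vj1); rewrite ltnn.
have Vx : V x by exact: TV.
have [e [Ve Ve']] : exists j, V (x / pi ^+ j) /\ V (pi ^+ j / x).
  (* If [pi ^+ j.+1] divides [x], then 1, [pi], ..., [pi ^+ j], [x] is a chain of length [j.+1]. *)
  apply: maximal => //; exists (size s) => -[//|j] Vj.
  apply: (value_chain_bound (y := fun i => if (i <= j)%N then pi ^+ i else x) cs).
  - by move=> i _; case: ifP => // _; exact: expf_neq0.
  - by rewrite expr0.
  - by rewrite ltnn.
  move=> i; rewrite ltnS => lij; case: (eqVneq i j) => [->|nij].
    rewrite leqnn ltnn; split.
      have -> : x / pi ^+ j = pi * (x / pi ^+ j.+1) by rewrite exprS invfM mulrCA mulVKf.
      exact: VM.
    move=> Vjx; apply: nVp.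
    have -> : pi^-1 = (pi ^+ j / x) * (x / pi ^+ j.+1).
      rewrite mulrA divfK // exprS invfM mulrCA divff ?mulr1 //; exact: expf_neq0.
    exact: VM.
  have ij : (i < j)%N by rewrite ltn_neqAle nij.
  rewrite ij lij; split; first by rewrite exprS mulfK ?expf_neq0.
  rewrite exprS invfM mulrCA divff ?expf_neq0 // mulr1; exact: nVp.
move=> b b0 Vb; apply: maximal => //; have [k Tk] := KT b^-1.
exists (e * k)%N => j Vj; apply: Vpn.
have -> : pi ^+ (e * k) / pi ^+ j = (pi ^+ e / x) ^+ k * ((x ^+ k / b) * (b / pi ^+ j)).
  rewrite [_ / b * _]mulrA divfK // exprM exprMn exprVn mulrA divfK //; exact: expf_neq0.
apply: VM; first by apply: subringX => //; case: hV.
by apply: VM => //; exact: TV.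
Qed.

End KrullAkizuki.
End OneDimensional.

(** * Discrete valuations dominating a local ring *)

(** The value of [y] is the exponent of [pi] in [y]. It is unique because [pi^-1] is not in [V], and
    it is negated when [y] is replaced by its inverse; its value at 0 is arbitrary. *)
Lemma dvaluation_of_uniformizer (K : fieldType) (V : set K) (pi : K) :
  is_valuation_ring V -> pi != 0 -> V pi -> ~ V pi^-1 ->
  (forall b, b != 0 -> V b -> exists j, V (b / pi ^+ j) /\ V (pi ^+ j / b)) ->
  exists v : dvaluation K, forall y, y != 0 -> (0 <= v y <-> V y).
Proof.
move=> [hV valV] p0 Vp nVp fac.
have VM a b : V a -> V b -> V (a * b) by case: hV => _ _; apply.
have pn0 (m : int) : pi ^ m != 0 by rewrite expfz_neq0.
have /choice [F HF] : forall y, exists j : int, y != 0 -> V (y / pi ^ j) /\ V (pi ^ j / y).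
  move=> y; have [y0|y0] := eqVneq y 0; first by exists 0.
  case: (valV y y0) => Vy.
    by have [j Hj] := fac y y0 Vy; exists j%:Z.
  have [|j [Hj Hj']] := fac y^-1 _ Vy; first by rewrite invr_eq0.
  by exists (- j%:Z) => _; rewrite -invr_expz invrK -exprnP mulrC; rewrite mulrC invrK mulrC in Hj'; rewrite -invfM mulrC invfM mulrC.
have Vneg (m : int) : V (pi ^ m) -> 0 <= m.
  case: m => // m; rewrite NegzE -invr_expz -exprnP => Vm; case: nVp.
  have -> : pi^-1 = pi ^+ m * (pi ^+ m.+1)^-1.
    by rewrite exprS invfM mulrCA divff ?expf_neq0 // mulr1.
  by apply: VM => //; exact: subringX.
have uniq y (m : int) : y != 0 -> V (y / pi ^ m) -> V (pi ^ m / y) -> F y = m.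
  move=> y0 V1 V2; have [V3 V4] := HF y y0; apply/eqP; rewrite eq_le.
  apply/andP; split; rewrite -subr_ge0; apply: Vneg; rewrite expfzDr // -invr_expz.
    have -> : pi ^ m / pi ^ F y = (pi ^ m / y) * (y / pi ^ F y) by rewrite mulrA divfK.
    exact: VM.
  have -> : pi ^ F y / pi ^ m = (pi ^ F y / y) * (y / pi ^ m) by rewrite mulrA divfK.
  exact: VM.
have FM y z : y != 0 -> z != 0 -> F (y * z) = F y + F z.
  move=> y0 z0; have [V1 V2] := HF y y0; have [V3 V4] := HF z z0.
  apply: uniq; first exact: mulf_neq0.
    by rewrite expfzDr // -mulf_div; exact: VM.
  by rewrite expfzDr // -mulf_div; exact: VM.
have Fp (m : int) : F (pi ^ m) = m.
  by apply: uniq; rewrite // divff //; case: hV.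
have FV y : y != 0 -> 0 <= F y <-> V y.
  move=> y0; have [V1 V2] := HF y y0; split=> [F0|Vy].
    rewrite -[y](divfK (pn0 (F y))); apply: VM => //.
    by rewrite -(gez0_abs F0) -exprnP; exact: subringX.
  by apply: Vneg; rewrite -[pi ^ _](divfK y0); exact: VM.
have FD y z : y != 0 -> z != 0 -> y + z != 0 -> Num.min (F y) (F z) <= F (y + z).
  move=> y0 z0 yz0; set m := Num.min _ _.
  have Vm w : w != 0 -> (m <= F w) <-> V (w / pi ^ m).
    move=> w0; rewrite -FV ?mulf_neq0 ?invr_eq0 //.
    by rewrite FM ?invr_eq0 // invr_expz Fp subr_ge0.
  apply/Vm => //; rewrite mulrDl; apply: subringD => //; apply/Vm => //.
    by rewrite ge_min lexx.
  by rewrite ge_min lexx orbT.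
have F1 : exists2 y, y != 0 & F y = 1 by exists (pi ^ 1); rewrite ?Fp.
by exists (DValuation FM FD F1).
Qed.

Lemma valuation_min (K : fieldType) (V : set K) n (g : 'I_n -> K) :
  is_valuation_ring V -> (exists i, g i != 0) ->
  exists2 i, g i != 0 & forall j, V (g j / g i).
Proof.
move=> [hV valV]; have VM a b : V a -> V b -> V (a * b) by case: hV => _ _; apply.
elim: n g => [|n IH] g [i0 gi0]; first by case: i0 gi0.
have V0 i : g i = 0 -> V (g i) by move=> ->; exact: subring0.
have [/existsP [i1 gi1]|noi] := boolP [exists i, g (fintype.lift ord0 i) != 0]; last first.
  exists ord0.
    case: (unliftP ord0 i0) gi0 => [j ->|-> //] gj.
    by move/existsP: noi; case; exists j.
  move=> j; case: (unliftP ord0 j) => [k ->|->].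
    have /eqP -> : g (fintype.lift ord0 k) == 0.
      by apply: contraNT noi => gk; apply/existsP; exists k.
    by rewrite mul0r; exact: subring0.
  have [->|g0] := eqVneq (g ord0) 0; first by rewrite mul0r; exact: subring0.
  by rewrite divff //; case: hV.
have [i gi gmin] := IH (fun i => g (fintype.lift ord0 i)) (ex_intro _ i1 gi1).
have [g00|g0] := eqVneq (g ord0) 0.
  exists (fintype.lift ord0 i) => // j; case: (unliftP ord0 j) => [k ->//|->].
  by rewrite g00 mul0r; exact: subring0.
have q0 : g ord0 / g (fintype.lift ord0 i) != 0 by rewrite mulf_neq0 ?invr_eq0.
case: (valV _ q0) => Vq.
  by exists (fintype.lift ord0 i) => // j; case: (unliftP ord0 j) => [k ->|->].
rewrite invfM invrK mulrC in Vq.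
exists ord0 => // j; case: (unliftP ord0 j) => [k ->|->]; last by rewrite divff //; case: hV.
have -> : g (fintype.lift ord0 k) / g ord0
    = (g (fintype.lift ord0 k) / g (fintype.lift ord0 i)) * (g (fintype.lift ord0 i) / g ord0).
  by rewrite mulrA divfK.
exact: VM.
Qed.

Section LocalRing.
Local Open Scope classical_set_scope.
Variables (R : idomainType) (p : prime_idealr R).
Local Notation K := {fraction R}.
Local Notation toK := (@FracField.tofrac R).

Lemma tofrac_notin_neq0 s : s \notin p -> toK s != 0.
Proof. by rewrite tofrac_eq0; apply: contraNneq => ->; exact: idealr0. Qed.

Lemma loc_ring_subring : is_subring (loc_ring p).
Proof.
split.
- by exists 1, 1; rewrite idealr1 rmorph1 divr1.
- move=> _ _ [a [s [sp ->]]] [b [t [tp ->]]]; exists (a * t - b * s), (s * t).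
  split; first by rewrite prime_idealrM negb_or sp.
  by rewrite -mulNr addf_div ?tofrac_notin_neq0 // mulNr rmorphB !rmorphM.
- move=> _ _ [a [s [sp ->]]] [b [t [tp ->]]]; exists (a * b), (s * t).
  split; first by rewrite prime_idealrM negb_or sp.
  by rewrite mulf_div !rmorphM.
Qed.

End LocalRing.

Section Dominating.
Local Open Scope classical_set_scope.
Variables (R : idomainType) (p : prime_idealr R).
Hypothesis noethR : noetherian R.
Hypothesis p_neq0 : exists2 r, r \in p & r != 0.
Local Notation K := {fraction R}.
Local Notation toK := (@FracField.tofrac R).

Let image : set K := [set y | exists r, y = toK r].

Let image_subring : is_subring image.
Proof.
split; first by exists 1; rewrite rmorph1.
  by move=> _ _ [r ->] [s ->]; exists (r - s); rewrite rmorphB.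
by move=> _ _ [r ->] [s ->]; exists (r * s); rewrite rmorphM.
Qed.

Let noeth_image : noeth_subring image.
Proof.
move=> J hJ Jim.
have [|||n [g gP]] := noethR (J := [set r | J (toK r)]).
- by rewrite /= rmorph0; case: hJ.
- by move=> r s; rewrite /= rmorphD; case: hJ => _ + _; apply.
- by move=> r s; rewrite /= rmorphM; case: hJ => _ _ + Js; apply => //; exists r.
exists [seq toK (g i) | i : 'I_n].
  move=> _ /mapP [i _ ->]; apply/(gP (g i)); exists (fun j => (j == i)%:R).
  rewrite (bigD1 i) //= eqxx mul1r big1 ?addr0 // => j /negPf ->.
  by rewrite mul0r.
move=> J' hJ' sJ' z Jz; have [r zr] := Jim z Jz; move: Jz; rewrite zr => /gP [c ->].
rewrite rmorph_sum; apply: (submod_sum hJ') => i _; rewrite rmorphM.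
case: hJ' => _ _; apply; first by exists (c i).
by apply: sJ'; apply/mapP; exists i; rewrite ?mem_enum.
Qed.

Let loc_max_submod : is_submod (loc_ring p) (loc_max p).
Proof.
split.
- by exists 0, 1; rewrite idealr0 idealr1 rmorph0 mul0r.
- move=> _ _ [a [s [ap sp ->]]] [b [t [bp tp ->]]]; exists (a * t + b * s), (s * t).
  split; last by rewrite addf_div ?(tofrac_notin_neq0 (p := p)) // rmorphD !rmorphM.
    by rewrite rpredD // mulrC idealMr.
  by rewrite prime_idealrM negb_or sp.
- move=> _ _ [a [s [sp ->]]] [b [t [bp tp ->]]]; exists (a * b), (s * t).
  split; first by rewrite idealMr.
    by rewrite prime_idealrM negb_or sp.
  by rewrite mulf_div !rmorphM.
Qed.

Let loc_max1 : ~ loc_max p 1.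
Proof.
move=> [a [s [ap sp /eqP]]]; rewrite eq_sym -subr_eq0.
rewrite -[X in _ - X](divff (tofrac_notin_neq0 sp)) -mulrBl mulf_eq0 invr_eq0.
rewrite (negPf (tofrac_notin_neq0 sp)) orbF subr_eq0 tofrac_eq => /eqP sa.
by move: sp; rewrite -sa ap.
Qed.

Let prime_gens : exists n (g : 'I_n -> R), (forall i, g i \in p) /\
  forall r, r \in p -> exists c : 'I_n -> R, r = \sum_i c i * g i.
Proof.
have [|||n [g gP]] := noethR (J := [set r | r \in p]).
- exact: idealr0.
- by move=> x y /= xp yp; rewrite rpredD.
- by move=> a x /= xp; rewrite idealMr.
exists n, g; split=> [i|r rp]; last by apply/gP.
apply/(gP (g i)); exists (fun j => (j == i)%:R).
rewrite (bigD1 i) //= eqxx mul1r big1 ?addr0 // => j /negPf ->.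
by rewrite mul0r.
Qed.

(* A chart of the blow-up of [p]: the ideal [p B] is generated by [x].        *)
Let blowup_chart : exists V B x, [/\ is_valuation_ring V, is_subring B, noeth_subring B,
  (loc_ring p `<=` V) /\ (B `<=` V) & [/\ x != 0, B x, ~ V x^-1, image `<=` B &
  forall r, r \in p -> B (toK r / x)]].
Proof.
have [n [g [gp gen]]] := prime_gens.
pose h i := toK (g i).
have [||V [hV SV VN1]] := @valuation_ring_exists _ (loc_ring p) n h (loc_ring_subring p).
- by move=> i; exists (g i), 1; rewrite idealr1 rmorph1 divr1.
- move=> /(span_of_sub loc_max_submod) H; apply: loc_max1; apply: H => i.
  by exists (g i), 1; rewrite idealr1 rmorph1 divr1.
have imS : image `<=` loc_ring p.
  by move=> _ [r ->]; exists r, 1; rewrite idealr1 rmorph1 divr1.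
(* The chart is given by a generator of least value, so that all quotients [h j / h i] remain in
   [V]. *)
have [|i hi0 hmin] := valuation_min (g := h) hV.
  have [r rp r0] := p_neq0; have [c rE] := gen r rp.
  apply: contrapT => /forallNP h0; move/eqP: r0; apply; rewrite rE big1 // => i _.
  have /negP := h0 i; rewrite negbK tofrac_eq0 => /eqP ->; exact: mulr0.
have [||B [hB nB imB BV sB]] := @noeth_adjoin_seq _ _ V [seq h j / h i | j : 'I_n]
  image_subring noeth_image hV.1.
- exact: subset_trans imS SV.
- by move=> _ /mapP [j _ ->]; exact: hmin.
exists V, B, (h i); split=> //; split=> //.
- by apply: imB; exists (g i).
- move=> Vh; apply: VN1; have [S0 SD SM] := span_of_submod h hV.1.
  by rewrite -(mulVf hi0); apply: SM => //; apply: span_of_gen; exact: hV.1.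
- move=> r /gen [c ->]; rewrite rmorph_sum mulr_suml.
  apply: (submod_sum (subring_submod hB)) => j _; rewrite rmorphM -mulrA.
  case: hB => _ _; apply; first by apply: imB; exists (c j).
  by apply: sB; apply/mapP; exists j; rewrite ?mem_enum.
Qed.

(* [M] is the complement in [B] of a prime which is minimal over [x B].       *)
Let minimal_prime (V B : set K) x : is_valuation_ring V -> is_subring B -> B `<=` V ->
  x != 0 -> B x -> ~ V x^-1 ->
  exists M, [/\ M `<=` B, (forall b, B b -> b != 0 -> V b^-1 -> M b) /\
    (forall a b, M a -> M b -> M (a * b)), forall b, B b -> ~ M (x * b) &
    forall b, B b -> ~ M b -> exists m k c, [/\ M m, B c & m * b ^+ k = x * c]].
Proof.
move=> hV hB BV x0 Bx nVx.
have BM a b : B a -> B b -> B (a * b) by case: hB => _ _; apply.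
have VM a b : V a -> V b -> V (a * b) by case: hV => -[_ _ VM] _; exact: VM.
(* [M0] is the complement in [B] of the centre of [V]; enlarging it as long as it avoids [x B]
   shrinks that prime to a minimal one over [x B]. *)
pose M0 : set K := [set b | [/\ B b, b != 0 & V b^-1]].
pose P := [set X : set K | [/\ M0 `|` X `<=` B,
  forall a b, (M0 `|` X) a -> (M0 `|` X) b -> (M0 `|` X) (a * b) &
  forall b, B b -> ~ (M0 `|` X) (x * b)]].
have [|X [[XB XM Xx] maxX]] := @Zorn_bigcup K P.
  move=> F FP Ftot; have [[X0 FX0]|F0] := pselect (exists X, F X); last first.
    have -> : \bigcup_(X in F) X = set0.
      by apply/seteqP; split=> // y [X FX _]; apply: F0; exists X.
    rewrite /P /mkset setU0; split=> [b []//|a b [Ba a0 Va] [Bb b0 Vb]|b Bb [_ xb0 Vxb]].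
      by split; [exact: BM|exact: mulf_neq0|rewrite invfM; exact: VM].
    apply: nVx; have -> : x^-1 = b * (x * b)^-1.
      move: xb0; rewrite mulf_eq0 negb_or => /andP [_ b0].
      by rewrite invfM mulrCA divff // mulr1.
    by apply: VM => //; exact: BV.
  split=> [b [M0b|[X FX Xb]]|a b Ua Ub|b Bb [M0xb|[X FX Xxb]]].
  - by have [+ _ _] := FP X0 FX0; apply; left.
  - by have [+ _ _] := FP X FX; apply; right.
  - have [Z FZ [Za Zb]] : exists2 Z, F Z & (M0 `|` Z) a /\ (M0 `|` Z) b.
      case: Ua Ub => [M0a|[X FX Xa]] [M0b|[Y FY Yb]].
      + by exists X0 => //; split; left.
      + by exists Y => //; split; [left|right].
      + by exists X => //; split; [right|left].
      + case: (Ftot X Y FX FY) => H; [exists Y => //|exists X => //]; split; right => //; exact: H.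
    have [_ ZM _] := FP Z FZ; have [?|?] := ZM a b Za Zb; first by left.
    by right; exists Z.
  - by have [_ _ /(_ b Bb)] := FP X0 FX0; apply; left.
  - by have [_ _ /(_ b Bb)] := FP X FX; apply; right.
set M := M0 `|` X in XB XM Xx.
have M0M : M0 `<=` M by move=> b; left.
have M1 : M 1 by left; split; rewrite ?invr1 ?oner_neq0 //; [case: hB|case: hV => -[]].
exists M; split=> //; first by split=> // b Bb b0 Vb; left.
move=> b Bb nMb.
(* [M'] is [M] with the powers of [b] adjoined; by maximality of [M] it must meet [x B]. *)
pose M' : set K := [set z | exists m k, M m /\ z = m * b ^+ k].
have MM' : M `<=` M' by move=> m Mm; exists m, 0%N; rewrite expr0 mulr1.
have M'E : M0 `|` M' = M' by apply/setUidPr; exact: subset_trans M0M MM'.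
apply: contrapT => nex; apply: (maxX M').
  split; first by move=> z Xz; apply: MM'; right.
  move=> M'X; apply: nMb; right; apply: M'X.
  by exists 1, 1%N; rewrite mul1r expr1.
rewrite /P /mkset M'E; split.
- by move=> _ [m [k [Mm ->]]]; apply: BM; [exact: XB|exact: subringX].
- move=> _ _ [m [k [Mm ->]]] [m' [k' [Mm' ->]]].
  by exists (m * m'), (k + k')%N; rewrite exprD mulrACA; split=> //; exact: XM.
- by move=> c Bc [m [k [Mm xc]]]; apply: nex; exists m, k, c.
Qed.

(** [T], the localization of the chart at a minimal prime over [x], is one-dimensional, so a
    valuation ring above it in which [x] is no unit is discrete. Elements outside [p] become units
    since they are units in [V0], and elements of [p] become non-units since [x] divides them in
    [B]. *)
Lemma dominating_valuation : exists v : dvaluation K, dominates p v.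
Proof.
have [V0 [B [x [hV0 hB nB [RV0 BV0] [x0 Bx nVx imB pB]]]]] := blowup_chart.
have [M [MB [M0 MM] xM Mmax]] := minimal_prime hV0 hB BV0 x0 Bx nVx.
have BM a b : B a -> B b -> B (a * b) by case: hB => _ _; apply.
have M1 : M 1.
  by apply: M0; rewrite ?oner_neq0 ?invr1 //; [case: hB|case: hV0 => -[]].
have Mn0 : ~ M 0 by rewrite -(mulr0 x); apply: xM; exact: subring0.
pose T := fractions B M.
have hT : is_subring T by exact: fractions_subring.
have TM a b : T a -> T b -> T (a * b) by case: hT => _ _; apply.
have nT : noeth_subring T by exact: noeth_fractions.
have BT : B `<=` T by exact: sub_fractions.
(* The radical of [x T], which by minimality of the prime is the maximal ideal of [T]. *)
pose q : set K := [set t | T t /\ exists k, T (t ^+ k / x)].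
have Tx1 : ~ T x^-1.
  move=> [b [m [Bb Mm /eqP]]]; rewrite -div1r eqr_div //; last first.
    by apply/eqP => m0; apply: Mn0; rewrite -m0.
  by rewrite mul1r => /eqP mE; apply: (xM b) => //; rewrite mulrC -mE.
have q1 : ~ q 1 by move=> [_ [k]]; rewrite expr1n div1r.
have hq : is_submod T q.
  split.
  - by split; [exact: subring0|exists 1%N; rewrite mul0r; exact: subring0].
  - move=> s t [Ts [i Ti]] [Tt [j Tj]]; split; first exact: subringD.
    exists (i + j)%N; rewrite exprDn mulr_suml.
    apply: (submod_sum (subring_submod hT)) => k _; rewrite mulrnAl -mulr_natr.
    apply: (TM); last first.
      by elim: ('C(_, _)) => [|n IH]; [exact: subring0|rewrite -natr1; apply: subringD => //; case: hT].
    case: (leqP j k) => [jk|kj].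
      rewrite -mulrA; apply: (TM); first exact: subringX.
      by rewrite -(subnK jk) exprD -mulrA; apply: (TM) => //; exact: subringX.
    rewrite mulrAC; apply: (TM); last exact: subringX.
    rewrite -addnBA ?(ltnW kj) // addnC exprD -mulrA.
    by apply: (TM) => //; exact: subringX.
  - move=> b t Tb [Tt [k Tk]]; split; first exact: TM.
    by exists k; rewrite exprMn -mulrA; apply: (TM) => //; exact: subringX.
have qT : q `<=` T by move=> t [].
have Tloc t : T t -> q t \/ t != 0 /\ T t^-1.
  move=> [b [m [Bb Mm tE]]]; case: (pselect (M b)) => [Mb|nMb].
    have b0 : b != 0 by apply/eqP => b0; apply: Mn0; rewrite -b0.
    have m0 : m != 0 by apply/eqP => m0; apply: Mn0; rewrite -m0.
    right; rewrite tE mulf_neq0 ?invr_eq0 //; split=> //.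
    by exists m, b; rewrite invfM invrK mulrC; split=> //; exact: MB.
  left; split; first by exists b, m.
  have [m' [k [c [Mm' Bc mE]]]] := Mmax b Bb nMb.
  have MX i : M (m ^+ i) by elim: i => [|i IH]; rewrite ?expr0 // exprS; exact: MM.
  have m'0 : m' != 0 by apply/eqP => m0; apply: Mn0; rewrite -m0.
  exists k, c, (m' * m ^+ k); split=> //; first exact: MM.
  rewrite tE exprMn exprVn.
  have -> : b ^+ k = x * c / m' by rewrite -mE mulrAC divff // mul1r.
  apply: (mulIf x0); rewrite divfK // invfM [x * c]mulrC -!mulrA.
  by congr (_ * _); rewrite mulrC -mulrA.
have qx : q x by split; [exact: BT|exists 1%N; rewrite divff //; case: hT].
have qnil t : q t -> exists k, T (t ^+ k / x) by case.
(* Chevalley's theorem is applied anew, to [T] and the ideal [x T]; [V0] served to choose the chart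
   and the prime. *)
have [||V [hV TV VN1]] := @valuation_ring_exists _ T 1 (fun=> x) hT.
- by move=> _; exact: BT.
- move=> [c Tc]; rewrite big_ord1 => cx; apply: Tx1.
  by rewrite -[x^-1]mul1r cx mulfK.
have nVx1 : ~ V x^-1.
  move=> Vx; apply: VN1; exists (fun=> x^-1) => //.
  by rewrite big_ord1 mulVf.
have imT : image `<=` T by apply: subset_trans imB BT.
(* [T[x^-1]] is the whole field: by [hauptidealsatz] the denominator of [b] divides a power of
   [x]. *)
have KT (b : K) : exists k, T (x ^+ k * b).
  have bE := frac_reprE b; set d := \d_ _ in bE.
  have d0 : toK d != 0 by rewrite tofrac_eq0 denom_ratioP.
  have [|k Tk] := @hauptidealsatz _ T q x hT nT hq qT q1 Tloc qx x0 qnil (toK d) _ d0.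
    by apply: imT; exists d.
  exists k; have -> : x ^+ k * b = (x ^+ k / toK d) * (b * toK d).
    by rewrite [b * _]mulrC mulrA divfK.
  by rewrite bE; apply: (TM) => //; apply: imT; eexists.
have [pi [pi0 Vpi nVpi fac]] :=
  uniformizer_factor hT nT hq qT Tloc qx x0 qnil hV TV nVx1 KT.
have [v hv] := dvaluation_of_uniformizer hV pi0 Vpi nVpi fac.
have hv' y : y \in dvr_pred v <-> V y.
  rewrite unfold_in; have [->|y0] := eqVneq y 0; last exact: hv.
  by split=> // _; apply: subring0; case: hV.
have RT y : loc_ring p y -> T y.
  move=> [a [s [sp ->]]]; exists (toK a), (toK s); split=> //.
    by apply: imB; exists a.
  apply: M0; first by apply: imB; exists s.
    exact: (tofrac_notin_neq0 (p := p)).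
  by apply: RV0; exists 1, s; rewrite rmorph1 div1r.
exists v; split=> [y Ry|y Ry]; first by apply/hv'; apply: TV; exact: RT.
case: Ry => a [s [sp yE]]; rewrite unfold_in yE.
have as_loc b : b \notin p -> V (toK b)^-1.
  by move=> bp; apply: TV; apply: RT; exists 1, b; rewrite rmorph1 div1r.
split.
  have [ap|ap] := boolP (a \in p); first by move=> _; exists a, s.
  have y0 : toK a / toK s != 0 by rewrite mulf_neq0 ?invr_eq0 ?(tofrac_notin_neq0 (p := p)).
  rewrite (negPf y0) /= => v_gt0.
  have : 0 <= v (toK a / toK s)^-1.
    apply/hv; first by rewrite invr_eq0.
    apply: TV; apply: RT; exists s, a; rewrite invfM invrK mulrC.
    by split.
  have : v (toK a / toK s) + v (toK a / toK s)^-1 = 0.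
    by rewrite -dvalM ?invr_eq0 // divff // dval1.
  by move=> /eqP; rewrite addr_eq0 => /eqP vE; rewrite -oppr_le0 -vE leNgt v_gt0.
move=> [b [t [bp tp ->]]]; case: eqVneq => //= y0.
rewrite lt_def; apply/andP; split; last first.
  by apply/hv => //; apply: TV; apply: RT; exists b, t.
apply/eqP => v0; apply: nVx1.
have : V (toK b / toK t)^-1.
  apply/hv; first by rewrite invr_eq0.
  have : v (toK b / toK t) + v (toK b / toK t)^-1 = 0.
    by rewrite -dvalM ?invr_eq0 // divff // dval1.
  by rewrite v0 add0r => ->.
have b0 : toK b != 0 by move: y0; rewrite mulf_eq0 negb_or => /andP [].
move=> Vyi; have VM a' b' : V a' -> V b' -> V (a' * b') by case: hV => -[_ _ VM] _; exact: VM.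
have -> : x^-1 = (toK b / x) * ((toK b / toK t)^-1 / toK t).
  by rewrite invfM invrK mulfK ?(tofrac_notin_neq0 (p := p)) // mulrAC divff // mul1r.
apply: (VM); first by apply: TV; apply: BT; exact: pB.
by apply: (VM) => //; exact: as_loc.
Qed.

End Dominating.

(** * Cell representations *)

Section CellRepresentations.
Variables (R : comNzRingType) (A : algType R) (C : cell_datum A).
Local Notation Lam := (cell_poset C).
Local Notation tab := (@cell_tab R A C).
Local Notation I := {l : cell_poset C & (cell_tab l * cell_tab l)%type}.
Local Notation ix l s t := (existT (fun m : cell_poset C => (cell_tab m * cell_tab m)%type) l (s, t)).
Local Notation elt := (@cell_elt R A C _).
Implicit Types (a b x y : A) (l m : Lam).

Lemma cell_eltE l (s t : tab l) : elt s t = C (ix l s t).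
Proof. by []. Qed.

Lemma ix_eq l (s t u v : tab l) : (ix l s t == ix l u v) = (s == u) && (t == v).
Proof. by rewrite -tag_eqE /tag_eq /= eqxx tagged_asE xpair_eqE. Qed.

Definition supported (D : pred Lam) x := forall i : I, ~~ D (tag i) -> bcoord C x i = 0.

Lemma supported_sum D (J : finType) (P : pred J) (F : J -> A) :
  (forall j, P j -> supported D (F j)) -> supported D (\sum_(j | P j) F j).
Proof.
move=> DF; apply: (big_ind (supported D)) => //.
  by move=> i _; rewrite bcoord0.
by move=> x y Dx Dy i Di; rewrite bcoordD Dx // Dy // addr0.
Qed.

Lemma supportedZ D c x : supported D x -> supported D (c *: x).
Proof. by move=> Dx i Di; rewrite bcoordZ Dx ?mulr0. Qed.

Lemma supportedD D x y : supported D x -> supported D y -> supported D (x + y).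
Proof. by move=> Dx Dy i Di; rewrite bcoordD Dx // Dy // addr0. Qed.

Lemma supported_basis (D : pred Lam) (i : I) : D (tag i) -> supported D (C i).
Proof.
move=> Di j Dj; rewrite bcoordE; case: eqP => // ij.
by rewrite -ij Di in Dj.
Qed.

Lemma supportedE D x : supported D x -> x = \sum_(i | D (tag i)) bcoord C x i *: C i.
Proof.
move=> Dx; rewrite -[LHS](bcoordK C) [RHS]big_mkcond; apply: eq_bigr => i _.
by case: ifPn => // /Dx ->; rewrite scale0r.
Qed.

Lemma bcoord_star x l (s t : tab l) :
  bcoord C (cell_star C x) (ix l s t) = bcoord C x (ix l t s).
Proof.
pose sw (i : I) : I := ix (tag i) (tagged i).2 (tagged i).1.
have swK : involutive sw by case=> m [u v].
have -> : cell_star C x = \sum_i bcoord C x (sw i) *: C i.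
  rewrite -{1}(bcoordK C x) linear_sum (reindex_inj (inv_inj swK)) /=.
  apply: eq_bigr => -[m [u v]] _; rewrite linearZ /=; congr (_ *: _).
  exact: cell_starE.
by rewrite (bvecK C (fun i => bcoord C x (sw i))).
Qed.

Lemma supported_star D x : supported D x -> supported D (cell_star C x).
Proof. by move=> Dx [m [u v]] Di; rewrite bcoord_star Dx. Qed.

Definition down_closed (D : pred Lam) := forall l m, (m <= l)%O -> D l -> D m.

Lemma down_closed_lt l : down_closed (fun m => (m < l)%O).
Proof. by move=> m m' /le_lt_trans H /H. Qed.

Lemma down_closed_le l : down_closed (fun m => (m <= l)%O).
Proof. by move=> m m' /le_trans H /H. Qed.

(** By axiom (C3) left multiplication never leads outside the shapes below, so down-closed sets of
    shapes span left ideals. The involution preserves shapes and makes these ideals two-sided. *)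
Lemma supported_mull D a x : down_closed D -> supported D x -> supported D (a * x).
Proof.
move=> dD Dx; rewrite (supportedE Dx) mulr_sumr; apply: supported_sum => -[l [s t]] /= Dl.
rewrite -scalerAr; apply: supportedZ.
have [r /(_ s t) [c]] := cell_le_mul a l.
rewrite /cell_elt /= => ->; apply: supportedD; apply: supported_sum => i.
  by move=> _; apply/supportedZ/supported_basis.
by move=> /ltW il; apply/supportedZ/supported_basis; exact: dD il Dl.
Qed.

Lemma supported_mulr D a x : down_closed D -> supported D x -> supported D (x * a).
Proof.
move=> dD Dx; rewrite -[x * a](@cell_starK R A C _) cell_starM.
by apply: supported_star; apply: supported_mull => //; exact: supported_star.
Qed.

(** The coefficients [r] of axiom (C3), recovered as coordinates; taking [t = s] is harmless because
    they do not depend on [t]. *)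
Definition cell_coef l a (s' s : tab l) : R := bcoord C (a * elt s s) (ix l s' s).

Lemma cell_mulE a l (s t : tab l) : exists2 y, supported (fun m => (m < l)%O) y &
  a * elt s t = \sum_s' cell_coef a s' s *: elt s' t + y.
Proof.
have [r Hr] := cell_le_mul a l.
suff rE s' u : cell_coef a s' u = r s' u.
  have [c ->] := Hr s t; eexists; last first.
    by congr (_ + _); apply: eq_bigr => s' _; rewrite rE.
  by apply: supported_sum => i il; apply/supportedZ/supported_basis.
rewrite /cell_coef; have [c ->] := Hr u u.
rewrite bcoordD bcoord_sum (bigD1 s') //= bcoordZ bcoordE eqxx mulr1 big1.
  rewrite addr0 [X in _ + X](supported_sum (D := fun m => (m < l)%O)) ?addr0 //=.
    by move=> i il; apply/supportedZ/supported_basis.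
  by rewrite ltxx.
move=> w /negPf ws; rewrite bcoordZ cell_eltE bcoordE ix_eq ws mulr0 //.
Qed.

Lemma cell_coefE a l (s' s t : tab l) : bcoord C (a * elt s t) (ix l s' t) = cell_coef a s' s.
Proof.
have [y ly ->] := cell_mulE a s t.
rewrite bcoordD bcoord_sum (bigD1 s') //= bcoordZ bcoordE eqxx mulr1 big1 => [|w /negPf ws].
  by rewrite (ly (ix l s' t)) /= ?ltxx // !addr0.
by rewrite bcoordZ cell_eltE bcoordE ix_eq ws mulr0.
Qed.

Lemma cell_coefD a b l (s' s : tab l) :
  cell_coef (a + b) s' s = cell_coef a s' s + cell_coef b s' s.
Proof. by rewrite /cell_coef mulrDl bcoordD. Qed.

Lemma cell_coefZ c a l (s' s : tab l) : cell_coef (c *: a) s' s = c * cell_coef a s' s.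
Proof. by rewrite /cell_coef -scalerAl bcoordZ. Qed.

Lemma cell_coef1 l (s' s : tab l) : cell_coef 1 s' s = (s' == s)%:R.
Proof. by rewrite /cell_coef mul1r cell_eltE bcoordE ix_eq eqxx andbT eq_sym. Qed.

Lemma cell_coefM a b l (s' s : tab l) :
  cell_coef (a * b) s' s = \sum_u cell_coef a s' u * cell_coef b u s.
Proof.
rewrite [LHS]/cell_coef -mulrA; have [y ly ->] := cell_mulE b s s.
rewrite mulrDr mulr_sumr bcoordD bcoord_sum.
have /= -> := supported_mull a (@down_closed_lt l) ly; last by rewrite /= ltxx.
rewrite addr0; apply: eq_bigr => u _.
by rewrite -scalerAr bcoordZ cell_coefE; apply: mulrC.
Qed.

Lemma cell_coef_supported D x l (s' s : tab l) :
  down_closed D -> supported D x -> ~~ D l -> cell_coef x s' s = 0.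
Proof. by move=> dD Dx Dl; rewrite /cell_coef (supported_mulr _ dD Dx). Qed.

(* The Graham-Lehrer form: [elt s t * elt u v = form t u *: elt s v] modulo   *)
(* smaller shapes.                                                            *)
Definition cell_form l (t u : tab l) : R := cell_coef (elt t t) t u.

(** Applying the involution turns [elt s t * elt u v] into [elt v u * elt t s], where (C3) shows
    that only the column [s] occurs. *)
Lemma cell_coef_elt_aux l (s t s' u v : tab l) :
  cell_coef (elt s t) s' u = (s' == s)%:R * cell_coef (elt v u) v t.
Proof.
rewrite -(cell_coefE (elt s t) s' u v) -[elt s t * elt u v](@cell_starK R A C _).
rewrite bcoord_star cell_starM !cell_starE.
have [y ly ->] := cell_mulE (elt v u) t s.
rewrite bcoordD (ly (ix l v s')) /= ?ltxx // addr0 bcoord_sum.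
rewrite (bigD1 v) //= bcoordZ cell_eltE bcoordE ix_eq eqxx /= eq_sym mulrC big1 ?addr0 //.
by move=> w /negPf wv; rewrite bcoordZ cell_eltE bcoordE ix_eq wv mulr0.
Qed.

Lemma cell_coef_elt l (s t s' u : tab l) :
  cell_coef (elt s t) s' u = (s' == s)%:R * cell_form t u.
Proof.
rewrite (@cell_coef_elt_aux l s t s' u t) /cell_form.
by rewrite (@cell_coef_elt_aux l t t t u t) eqxx mul1r.
Qed.

Lemma cell_form_sym l (t u : tab l) : cell_form t u = cell_form u t.
Proof.
by rewrite {1}/cell_form (@cell_coef_elt_aux l t t t u u) eqxx mul1r.
Qed.

Definition cell_rep l a : 'M[R]_#|tab l| :=
  \matrix_(i, j) cell_coef a (enum_val i) (enum_val j).

Lemma cell_repD l : {morph cell_rep l : a b / a + b}.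
Proof. by move=> a b; apply/matrixP => i j; rewrite !mxE cell_coefD. Qed.

Lemma cell_repZ l c a : cell_rep l (c *: a) = c *: cell_rep l a.
Proof. by apply/matrixP => i j; rewrite !mxE cell_coefZ. Qed.

Lemma cell_rep1 l : cell_rep l 1 = 1%:M.
Proof.
apply/matrixP => i j; rewrite !mxE cell_coef1.
by rewrite (inj_eq enum_val_inj).
Qed.

Lemma cell_repM l a b : cell_rep l (a * b) = cell_rep l a *m cell_rep l b.
Proof.
apply/matrixP => i j; rewrite !mxE cell_coefM (reindex_onto enum_val enum_rank) /=.
  by apply: eq_big => [k|k _]; rewrite ?enum_valK ?eqxx // !mxE.
by move=> k _; rewrite enum_rankK.
Qed.

(** [A] is identified with its own scalar extension along the identity. Cell modules are thus
    defined once over [R], and those over other rings are extensions of them. *)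
Definition base_elt (x : scext C (idfun : {rmorphism R -> R})) : A := \sum_i x i *: C i.

Lemma base_eltK : cancel base_elt (scin C (idfun : {rmorphism R -> R})).
Proof. by move=> x; apply/ffunP => i; rewrite ffunE /= (bvecK C x). Qed.

Lemma scin_baseK a : base_elt (scin C (idfun : {rmorphism R -> R}) a) = a.
Proof. by rewrite -[RHS](bcoordK C); apply: eq_bigr => i _; rewrite ffunE. Qed.

Section CellModule.
Variable l : Lam.

Definition cell_act (x : scext C (idfun : {rmorphism R -> R})) := cell_rep l (base_elt x).

Fact cell_act_zmod_morphism : zmod_morphism cell_act.
Proof.
move=> x y; rewrite /cell_act.
have -> : base_elt (x - y) = base_elt x + (-1) *: base_elt y.
  rewrite /base_elt scaler_sumr -big_split; apply: eq_bigr => i _ /=.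
  by rewrite !ffunE scalerBl scaleN1r.
by rewrite cell_repD cell_repZ scaleN1r.
Qed.
Fact cell_act_scalable : scalable cell_act.
Proof.
move=> c x; rewrite /cell_act -cell_repZ; congr cell_rep.
rewrite /base_elt scaler_sumr; apply: eq_bigr => i _.
by rewrite scext_scaleE scalerA.
Qed.
Fact cell_act_monoid_morphism : monoid_morphism cell_act.
Proof.
split; first by rewrite /cell_act scin_baseK cell_rep1.
move=> x y; rewrite -[RHS]/(cell_rep l (base_elt x) *m cell_rep l (base_elt y)).
by rewrite -cell_repM -[_ * base_elt _]scin_baseK rmorphM /= !base_eltK.
Qed.
HB.instance Definition _ := GRing.isZmodMorphism.Build _ _ cell_act cell_act_zmod_morphism.
HB.instance Definition _ := GRing.isScalable.Build _ _ _ _ cell_act cell_act_scalable.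
HB.instance Definition _ := GRing.isMonoidMorphism.Build _ _ cell_act cell_act_monoid_morphism.

Definition cell_base_mod : matmod (scext C (idfun : {rmorphism R -> R})) := MatMod cell_act.

End CellModule.

Definition cell_mod (S : comNzRingType) (phi : {rmorphism R -> S}) l : matmod (scext C phi) :=
  mod_ext (phi := idfun) (fun r => erefl (phi r)) (cell_base_mod l).

Lemma cell_mod_scin (S : comNzRingType) (phi : {rmorphism R -> S}) l a :
  cell_mod phi l (scin C phi a) = map_mx phi (cell_rep l a).
Proof. by rewrite /= mod_ext_act_scin /= /cell_act scin_baseK. Qed.

End CellRepresentations.

Lemma mod_scin_ext (R S : comNzRingType) (A : algType R) (I : finType)
  (e : alg_basis A I) (phi : {rmorphism R -> S}) (V : matmod (scext e phi)) x :
  V x = \sum_i x i *: V (scin e phi (e i)).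
Proof.
rewrite {1}[x]scextE raddf_sum; apply: eq_bigr => i _; exact: linearZ.
Qed.

Lemma matmod_comm_scin (R S : comNzRingType) (A : algType R) (I : finType)
  (e : alg_basis A I) (phi : {rmorphism R -> S}) (V W : matmod (scext e phi))
  (f : 'M[S]_(mdim W, mdim V)) :
  (forall i, f *m V (scin e phi (e i)) = W (scin e phi (e i)) *m f) ->
  forall x, f *m V x = W x *m f.
Proof.
move=> H x; rewrite mod_scin_ext [W x]mod_scin_ext mulmx_sumr mulmx_suml.
by apply: eq_bigr => i _; rewrite -scalemxAr -scalemxAl H.
Qed.

Lemma finposet_min (d : Order.disp_t) (L : finPOrderType d) (P : pred L) (l0 : L) : P l0 ->
  exists2 l, P l & forall m, P m -> (m <= l)%O -> m = l.
Proof.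
move=> Pl0; pose f (l : L) := #|[pred m | (m <= l)%O]|.
case: (arg_minnP f Pl0) => l Pl minl; exists l => // m Pm ml.
apply/eqP; apply: contraT => nml; have lt_ml : (m < l)%O by rewrite lt_neqAle nml.
have := minl m Pm; rewrite leqNgt /f proper_card //.
apply/properP; split; first by apply/fintype.subsetP => x; rewrite !inE => /le_trans; apply.
by exists l; rewrite inE // lt_geF.
Qed.

Lemma finposet_max (d : Order.disp_t) (L : finPOrderType d) (P : pred L) (l0 : L) : P l0 ->
  exists2 l, P l & forall m, P m -> (l <= m)%O -> m = l.
Proof.
move=> Pl0; pose f (l : L) := #|[pred m | (m <= l)%O]|.
case: (arg_maxnP f Pl0) => l Pl maxl; exists l => // m Pm lm.
apply/eqP; apply: contraT; rewrite eq_sym => nml.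
have lt_lm : (l < m)%O by rewrite lt_neqAle nml.
have := maxl m Pm; rewrite /= leqNgt /f proper_card //.
apply/properP; split; first by apply/fintype.subsetP => x; rewrite !inE => /le_trans; apply.
by exists m; rewrite inE // lt_geF.
Qed.

Section ActionLinear.
Variables (S : comNzRingType) (B : algType S) (V : matmod B).

Lemma mact_sum (J : Type) (r : seq J) (P : pred J) (F : J -> B) :
  V (\sum_(i <- r | P i) F i) = \sum_(i <- r | P i) V (F i).
Proof. exact: raddf_sum. Qed.
Lemma mactD x y : V (x + y) = V x + V y. Proof. exact: raddfD. Qed.
Lemma mactB x y : V (x - y) = V x - V y. Proof. exact: raddfB. Qed.
Lemma mact0 : V 0 = 0. Proof. exact: raddf0. Qed.
Lemma mactZ c x : V (c *: x) = c *: V x. Proof. exact: linearZ. Qed.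
Lemma mact1 : V 1 = 1%:M. Proof. exact: rmorph1. Qed.
Lemma mactM x y : V (x * y) = V x *m V y. Proof. exact: rmorphM. Qed.

End ActionLinear.

(** * Gram matrices, and the product decomposition when they are invertible *)

Section Gram.
Variables (R : comNzRingType) (A : algType R) (C : cell_datum A).
Local Notation Lam := (cell_poset C).
Local Notation tab := (@cell_tab R A C).
Local Notation I := {l : cell_poset C & (cell_tab l * cell_tab l)%type}.
Local Notation ix l s t := (existT (fun m : cell_poset C => (cell_tab m * cell_tab m)%type) l (s, t)).
Local Notation elt := (@cell_elt R A C _).
Implicit Types (l m : Lam).

Definition cell_gram l : 'M[R]_#|tab l| :=
  \matrix_(i, j) cell_form (enum_val i) (enum_val j).

Variables (S : comNzRingType) (phi : {rmorphism R -> S}).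
Local Notation B := (scext C phi).
Local Notation sc := (scin C phi).

Lemma cell_mod_elt l (s t : tab l) i j :
  cell_mod phi l (sc (elt s t)) i j
  = (enum_val i == s)%:R * phi (cell_form t (enum_val j)).
Proof. by rewrite cell_mod_scin !mxE cell_coef_elt rmorphM rmorph_nat. Qed.

Lemma cell_mod_elt0 l m (s t : tab l) : ~~ (m <= l)%O -> cell_mod phi m (sc (elt s t)) = 0.
Proof.
move=> ml; rewrite cell_mod_scin; apply/matrixP => i j; rewrite !mxE.
rewrite (cell_coef_supported _ _ (@down_closed_le _ _ C l) _ ml) ?rmorph0 //.
by apply: supported_basis => /=.
Qed.

Definition shape_mx l (x : B) : 'M[S]_#|tab l| :=
  \matrix_(i, j) x (ix l (enum_val i) (enum_val j)).

Definition of_shape_mx l (N : 'M[S]_#|tab l|) : B :=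
  \sum_i \sum_j N i j *: sc (elt (enum_val i) (enum_val j)).

(** [elt s t] acts on the cell module of its shape as the rank one operator with image [s] and
    functional [cell_form t]. *)
Lemma cell_mod_of_shape l (N : 'M[S]_#|tab l|) :
  cell_mod phi l (of_shape_mx N) = N *m map_mx phi (cell_gram l).
Proof.
apply/matrixP => i j; rewrite /of_shape_mx mact_sum summxE mxE.
transitivity (\sum_(k < #|tab l|) \sum_(k' < #|tab l|)
    N k k' * ((k == i)%:R * phi (cell_form (enum_val k') (enum_val j)))).
  apply: eq_bigr => k _; rewrite mact_sum summxE; apply: eq_bigr => k' _.
  by rewrite mactZ mxE cell_mod_elt (inj_eq enum_val_inj) eq_sym.
rewrite (bigD1 i) //= [X in _ + X]big1 ?addr0 => [|k /negPf ->].
  by apply: eq_bigr => k _; rewrite eqxx mul1r !mxE.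
by rewrite big1 // => k' _; rewrite mul0r mulr0.
Qed.

Lemma cell_mod_of_shape0 l m (N : 'M[S]_#|tab l|) : ~~ (m <= l)%O ->
  cell_mod phi m (of_shape_mx N) = 0.
Proof.
move=> ml; rewrite /of_shape_mx mact_sum big1 // => i _; rewrite mact_sum big1 // => j _.
by rewrite mactZ cell_mod_elt0 // scaler0.
Qed.

Lemma of_shape_mx0 l : of_shape_mx (0 : 'M[S]_#|tab l|) = 0.
Proof. by rewrite /of_shape_mx big1 // => i _; rewrite big1 // => j _; rewrite mxE scale0r. Qed.

Lemma of_shape_mxE l (N : 'M[S]_#|tab l|) (s t : tab l) :
  of_shape_mx N (ix l s t) = N (enum_rank s) (enum_rank t).
Proof.
rewrite /of_shape_mx sum_ffunE (bigD1 (enum_rank s)) //= sum_ffunE.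
rewrite (bigD1 (enum_rank t)) //= scext_scaleE ffunE cell_eltE bcoordE !enum_rankK eqxx.
rewrite rmorph1 mulr1 !big1 ?addr0 // => k; rewrite -(inj_eq enum_val_inj) enum_rankK => /negPf ks.
  rewrite sum_ffunE big1 // => k' _.
  by rewrite scext_scaleE ffunE cell_eltE bcoordE ix_eq ks rmorph0 mulr0.
by rewrite scext_scaleE ffunE cell_eltE bcoordE ix_eq ks andbF rmorph0 mulr0.
Qed.

Lemma of_shape_mxE0 l m (N : 'M[S]_#|tab l|) (s t : tab m) : l != m ->
  of_shape_mx N (ix m s t) = 0.
Proof.
move=> lm; rewrite /of_shape_mx sum_ffunE big1 // => i _; rewrite sum_ffunE big1 // => j _.
rewrite scext_scaleE ffunE cell_eltE bcoordE; case: eqP => [[ml]|_].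
  by rewrite ml eqxx in lm.
by rewrite rmorph0 mulr0.
Qed.

Lemma scext_shapeE (x : B) : x = \sum_l of_shape_mx (shape_mx l x).
Proof.
apply/ffunP => -[m [s t]]; rewrite sum_ffunE (bigD1 m) //= of_shape_mxE mxE !enum_rankK.
by rewrite big1 ?addr0 // => l lm; rewrite of_shape_mxE0.
Qed.

Hypothesis gramV : forall l, exists H, H *m map_mx phi (cell_gram l) = 1%:M.

(* By triangularity of the cell representations for the order of shapes.      *)
Lemma cell_mod_surj l (M : 'M[S]_#|tab l|) : exists x : B,
  cell_mod phi l x = M /\ forall m, m != l -> cell_mod phi m x = 0.
Proof.
have [n] := ubnP #|[pred m | (m < l)%O]|; elim: n l M => // n IH l M; rewrite ltnS => ln.
have [H HG] := gramV l.
have [x0 x0l x0m] : exists2 x0 : B, cell_mod phi l x0 = M &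
    forall m, ~~ (m <= l)%O -> cell_mod phi m x0 = 0.
  exists (of_shape_mx (M *m H)); last by move=> m; exact: cell_mod_of_shape0.
  by rewrite cell_mod_of_shape -mulmxA HG mulmx1.
(* [x0] is correct on shape [l] but may act on smaller shapes; [y m] reproduces its action on shape
   [m] alone and is subtracted. *)
have /choice [y Hy] : forall m, exists y : B, (m < l)%O ->
    cell_mod phi m y = cell_mod phi m x0 /\ forall m', m' != m -> cell_mod phi m' y = 0.
  move=> m; have [ml|] := boolP (m < l)%O; last by exists 0.
  have [|y Hy] := IH m (cell_mod phi m x0); last by exists y.
  apply: leq_trans ln; apply/proper_card/properP; split.
    by apply/fintype.subsetP => z; rewrite !inE => /lt_trans; apply.
  by exists m; rewrite inE ?ml // ltxx.
exists (x0 - \sum_(m | (m < l)%O) y m); split=> [|m ml].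
  rewrite mactB x0l mact_sum big1 ?subr0 // => m ml.
  by have [_ ->] := Hy m ml; rewrite // gt_eqF.
rewrite mactB; have [lt_ml|nlt] := boolP (m < l)%O; rewrite mact_sum.
  rewrite (bigD1 m) //= big1 => [|k /andP [kl km]].
    by have [-> _] := Hy m lt_ml; rewrite addr0 subrr.
  by have [_ ->] := Hy k kl; rewrite // eq_sym.
rewrite big1 => [|k kl].
  by rewrite subr0 x0m // le_eqVlt (negPf ml).
have [_ ->] := Hy k kl; first by [].
by apply: contraNneq nlt => ->.
Qed.

(** For [l] maximal among the shapes occurring in [x], no other component of [x] acts on the cell
    module of [l], so [x] acts there as [shape_mx l x] times the Gram matrix. *)
Lemma cell_mod_inj (x y : B) : (forall l, cell_mod phi l x = cell_mod phi l y) -> x = y.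
Proof.
move=> xy; apply/eqP; rewrite -subr_eq0; apply/eqP.
have {xy} : forall l, cell_mod phi l (x - y) = 0 by move=> l; rewrite mactB xy subrr.
move: (x - y) => {x y} x x0.
have [/existsP [l0 nz0]|/existsPn all0] := boolP [exists l, shape_mx l x != 0]; last first.
  rewrite [x]scext_shapeE big1 // => l _; have := all0 l; rewrite negbK => /eqP ->.
  by rewrite of_shape_mx0.
have [l nzl maxl] := finposet_max (P := fun l => shape_mx l x != 0) nz0.
have : cell_mod phi l x = shape_mx l x *m map_mx phi (cell_gram l).
  rewrite {1}[x]scext_shapeE mact_sum (bigD1 l) //= cell_mod_of_shape big1 ?addr0 // => m ml.
  have [lm|lm] := boolP (l <= m)%O; last exact: cell_mod_of_shape0.
  have [m0|/maxl/(_ lm) mE] := eqVneq (shape_mx m x) 0; last by rewrite mE eqxx in ml.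
  by rewrite m0 of_shape_mx0; exact: (mact0 (cell_mod phi l)).
have [H HG] := gramV l; rewrite x0 => /esym G0.
by rewrite -[shape_mx l x]mulmx1 -(mulmx1C HG) mulmxA G0 mul0mx eqxx in nzl.
Qed.

End Gram.

(** * Semisimplicity *)

Section Semisimple.
Local Open Scope classical_set_scope.
Variable T : nzRingType.
Implicit Types (J M N : set T).

Lemma left_idealB J x y : left_ideal J -> J x -> J y -> J (x - y).
Proof.
by move=> [_ JD JM] Jx Jy; apply: JD => //; rewrite -mulN1r; exact: JM.
Qed.

Lemma left_ideal_sum M N : left_ideal M -> left_ideal N ->
  left_ideal [set x | exists m n, [/\ M m, N n & x = m + n]].
Proof.
move=> [M0 MD MM] [N0 ND NM]; split.
- by exists 0, 0; rewrite addr0.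
- move=> _ _ [m [n [Mm Nn ->]]] [m' [n' [Mm' Nn' ->]]].
  by exists (m + m'), (n + n'); rewrite addrACA; split; [exact: MD|exact: ND|].
- move=> a _ [m [n [Mm Nn ->]]]; exists (a * m), (a * n).
  by rewrite mulrDr; split; [exact: MM|exact: NM|].
Qed.

Lemma maximal_disjoint_ideal J : exists2 N, left_ideal N /\ N `&` J `<=` [set 0] &
  forall N', left_ideal N' -> N' `&` J `<=` [set 0] -> N `<=` N' -> N' = N.
Proof.
pose P := [set X : set T | left_ideal ([set 0] `|` X) /\
  ([set 0] `|` X) `&` J `<=` [set 0]].
have [|X [PX maxX]] := @Zorn_bigcup T P.
  move=> F FP Ftot; have [[X0 FX0]|F0] := pselect (exists X, F X); last first.
    have -> : \bigcup_(X in F) X = set0.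
      by apply/seteqP; split=> // y [X FX _]; apply: F0; exists X.
    rewrite /P /mkset setU0; split; last by move=> x [].
    by split=> // [x y -> ->|a x ->] /=; rewrite ?addr0 ?mulr0.
  have sub X : F X -> [set 0] `|` X `<=` [set 0] `|` \bigcup_(X in F) X.
    by move=> FX; apply: setUS => y Xy; exists X.
  have dir x y : ([set 0] `|` \bigcup_(X in F) X) x -> ([set 0] `|` \bigcup_(X in F) X) y ->
      exists2 X, F X & ([set 0] `|` X) x /\ ([set 0] `|` X) y.
    move=> [x0|[X FX Xx]] [y0|[Y FY Yy]].
    - by exists X0 => //; split; left.
    - by exists Y => //; split; [left|right].
    - by exists X => //; split; [right|left].
    - by case: (Ftot X Y FX FY) => H; [exists Y => //|exists X => //]; split; right => //; exact: H.
  split; last first.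
    move=> x [Ux Jx]; have [X FX [Xx _]] := dir x x Ux Ux.
    by have [_] := FP X FX; apply.
  split; first by left.
    move=> x y Ux Uy; have [X FX [Xx Xy]] := dir x y Ux Uy.
    by apply: (sub X FX); have [[_ XD _] _] := FP X FX; exact: XD.
  move=> a x Ux; have [X FX [Xx _]] := dir x x Ux Ux.
  by apply: (sub X FX); have [[_ _ XM] _] := FP X FX; exact: XM.
exists ([set 0] `|` X) => // N' hN' N'J XN'; apply/seteqP; split=> //.
apply: contrapT => nN'; apply: (maxX N').
  split; first by move=> y Xy; apply: XN'; right.
  by move=> N'X; apply: nN' => y /N'X; right.
have E : [set 0] `|` N' = N' by apply/setUidPr => _ ->; case: hN'.
by rewrite /P /mkset E.
Qed.

(** [T a] has a complement [N]. Writing [1 = b a + n] with [n] in [N] gives [a = a b a + a n], and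
    [a n] lies in both [N] and [T a]. *)
Lemma semisimple_regular (a : T) : semisimple_ring T -> exists b, a = a * b * a.
Proof.
move=> ssT; pose J := [set x : T | exists b, x = b * a].
have hJ : left_ideal J.
  split; first by exists 0; rewrite mul0r.
    by move=> _ _ [b ->] [c ->]; exists (b + c); rewrite mulrDl.
  by move=> c _ [b ->]; exists (c * b); rewrite mulrA.
have [N [hN NJ] maxN] := maximal_disjoint_ideal J.
pose S := [set x | exists m n, [/\ J m, N n & x = m + n]].
have hS : left_ideal S by exact: left_ideal_sum.
have NS : N `<=` S by move=> n Nn; exists 0, n; rewrite add0r; split=> //; case: hJ.
have JS : J `<=` S by move=> n Nn; exists n, 0; rewrite addr0; split=> //; case: hN.
have minS M : minimal_left_ideal M -> M `<=` S.
  move=> [hM M0 minM].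
  have hMS : left_ideal (M `&` S).
    case: hM hS => [M00 MD MM] [S0 SD SM]; split=> //.
      by move=> x y [Mx Sx] [My Sy]; split; [exact: MD|exact: SD].
    by move=> c x [Mx Sx]; split; [exact: MM|exact: SM].
  (* A minimal left ideal meeting [S] trivially could be added to [N] without meeting [J], against
     the maximality of [N]. *)
  have [MS0|ME] := minM _ hMS (@subIsetl _ _ _); last by rewrite -ME; exact: subIsetr.
  have hNM := left_ideal_sum hN hM.
  have NE : [set x | exists m n, [/\ N m, M n & x = m + n]] = N.
    apply: maxN => //.
      move=> x [[n [m [Nn Mm xE]]] Jx].
      have m0 : (M `&` S) m.
        split=> //; have -> : m = x - n by rewrite xE addrC addKr.
        by apply: left_idealB => //; [exact: JS|exact: NS].
      rewrite MS0 in m0; apply: NJ; split=> //.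
      by rewrite xE m0 addr0.
    by move=> n Nn; exists n, 0; rewrite addr0; split=> //; case: hM.
  case: M0; rewrite -MS0; apply/seteqP; split; last exact: subIsetl.
  move=> m Mm; split=> //; apply: NS; rewrite -NE; exists 0, m.
  by rewrite add0r; split=> //; case: hN.
have [s [s1 sM]] := ssT 1.
have [m [n [[b mE] Nn E1]]] : S 1.
  rewrite s1; have : forall y, y \in s -> S y.
    by move=> y /sM [M [hM My]]; exact: minS My.
  elim: (s) => [|y r IH] rS; first by rewrite big_nil; case: hS.
  rewrite big_cons; case: (hS) => _ SD _; apply: SD; first by apply: rS; rewrite mem_head.
  by apply: IH => z zr; apply: rS; rewrite in_cons zr orbT.
exists b; have aE : a = a * m + a * n by rewrite -mulrDr -E1 mulr1.
have an0 : [set 0] (a * n).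
  apply: NJ; split; first by case: hN => _ _; apply.
  have -> : a * n = a - a * m by rewrite {2}aE addrC addKr.
  by apply: left_idealB => //; [exists 1; rewrite mul1r|rewrite mE; exists (a * b); rewrite mulrA].
by rewrite {1}aE an0 addr0 mE mulrA.
Qed.

End Semisimple.

Section SemisimpleGram.
Variables (R : comNzRingType) (A : algType R) (C : cell_datum A).
Variables (k : fieldType) (phi : {rmorphism R -> k}).
Local Notation tab := (@cell_tab R A C).
Local Notation ix l s t := (existT (fun m : cell_poset C => (cell_tab m * cell_tab m)%type) l (s, t)).
Local Notation elt := (@cell_elt R A C _).
Local Notation sc := (scin C phi).

(* If [v] is in the radical of the form then [a = \sum_s v_s elt u s]         *)
(* satisfies [a b a = 0] modulo smaller shapes, for all [b].                  *)
Lemma semisimple_gram_unit (l : cell_poset C) :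
  (forall a : scext C phi, exists b, a = a * b * a) -> map_mx phi (cell_gram l) \in unitmx.
Proof.
move=> reg; rewrite -row_free_unit -kermx_eq0; apply/eqP/row_matrixP => i; rewrite row0.
set v := row i _.
have vG : v *m map_mx phi (cell_gram l) = 0.
  by rewrite /v -row_mul mulmx_ker row0.
apply/rowP => j; rewrite [RHS]mxE.
pose u : tab l := enum_val j.
pose a : scext C phi := \sum_s v 0 s *: sc (elt u (enum_val s)).
have aE s' : a (ix l u (enum_val s')) = v 0 s'.
  rewrite /a sum_ffunE (bigD1 s') //= scext_scaleE ffunE cell_eltE bcoordE eqxx rmorph1 mulr1.
  rewrite big1 ?addr0 // => s /negPf ss'.
  by rewrite scext_scaleE ffunE cell_eltE bcoordE ix_eq (inj_eq enum_val_inj) ss' andbF rmorph0 mulr0.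
rewrite -(aE j); have [b ->] := reg a.
(* Summing these coordinates against [v] over [s] produces the pairing of [v] with each [w], which
   vanishes. *)
have key (c : A) s s' : bcoord C (elt u (enum_val s) * c * elt u (enum_val s')) (ix l u (enum_val j))
    = (j == s')%:R * \sum_w cell_form (enum_val s) w * cell_coef c w u.
  rewrite -mulrA; have [y ly ->] := cell_mulE c u (enum_val s').
  rewrite mulrDr [X in X + _]mulr_sumr bcoordD bcoord_sum.
  rewrite (supported_mull (elt u (enum_val s)) (@down_closed_lt _ _ C l) ly) /= ?ltxx // addr0.
  rewrite mulr_sumr; apply: eq_bigr => w _; rewrite -scalerAr bcoordZ.
  have [y' ly' ->] := cell_mulE (elt u (enum_val s)) w (enum_val s').
  rewrite bcoordD bcoord_sum ly' ?ltxx // addr0 (bigD1 u) //= big1 => [|z /negPf zu].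
    rewrite addr0 bcoordZ cell_coef_elt eqxx mul1r cell_eltE bcoordE ix_eq eqxx /=.
    by rewrite (inj_eq enum_val_inj) [s' == j]eq_sym mulrC -mulrA mulrCA.
  by rewrite bcoordZ cell_eltE bcoordE ix_eq zu mulr0.
have scM x y z (c d f : k) :
    (c *: sc x) * (d *: sc y) * (f *: sc z) = (c * d * f) *: sc (x * y * z).
  by rewrite !rmorphM /= -!(scalerAl, scalerAr) !scalerA mulrC.
rewrite [b]scextE /a mulr_sumr sum_ffunE big1 // => s' _.
rewrite [X in X * _]mulr_sumr mulr_suml sum_ffunE big1 // => i' _.
rewrite [X in X * _]mulr_suml mulr_suml sum_ffunE.
transitivity (\sum_s (j == s')%:R * b i' * v 0 s' * \sum_w
    (v 0 s * map_mx phi (cell_gram l) s w) * phi (cell_coef (C i') (enum_val w) u)).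
  apply: eq_bigr => s _; rewrite scM scext_scaleE ffunE key rmorphM rmorph_nat.
  rewrite rmorph_sum (reindex_onto enum_val enum_rank) /=; last by move=> w _; rewrite enum_rankK.
  rewrite (eq_bigl xpredT) => [|w]; last by rewrite enum_valK eqxx.
  rewrite mulrA mulr_sumr mulr_sumr; apply: eq_bigr => w _; rewrite rmorphM !mxE !mulrA.
  congr (_ * _ * _); rewrite mulrC !mulrA [RHS]mulrAC; congr (_ * _); exact: mulrAC.
rewrite -mulr_sumr exchange_big big1 ?mulr0 // => w _ /=.
rewrite -mulr_suml; move/matrixP: vG => /(_ 0 w); rewrite !mxE => ->.
by rewrite mul0r.
Qed.

End SemisimpleGram.

(** * Submodules, quotients and their classes *)

Definition mod_hom (S : comNzRingType) (B : algType S) (W V : matmod B)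
    (f : 'M[S]_(mdim V, mdim W)) : Prop :=
  forall b, f *m W b = V b *m f.

Section Submodules.
Variables (k : fieldType) (B : algType k).
Implicit Types (V W : matmod B).

Lemma row_free_mulmxI m n p (f : 'M[k]_(m, n)) (M N : 'M[k]_(n, p)) :
  row_free f^T -> f *m M = f *m N -> M = N.
Proof.
move=> /row_freeP [g fg] E.
have gf : g^T *m f = 1%:M by rewrite -[f]trmxK -trmx_mul fg trmx1.
by rewrite -[M]mul1mx -[N]mul1mx -gf -!mulmxA E.
Qed.

(** As [f] is injective it cancels on the left, so [D] inherits linearity and multiplicativity from
    [V]. *)
Lemma matmod_restrict V r (f : 'M[k]_(mdim V, r)) (D : B -> 'M[k]_r) :
  row_free f^T -> (forall b, f *m D b = V b *m f) ->
  exists V' : matmod B, exists f' : 'M[k]_(mdim V, mdim V'),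
    [/\ mdim V' = r, mod_hom f', row_free f'^T & (f'^T :=: f^T)%MS].
Proof.
move=> ff fD; have I := row_free_mulmxI ff.
have Da : zmod_morphism D.
  by move=> x y; apply: I; rewrite mulmxBr !fD mactB mulmxBl.
have Ds : scalable D.
  by move=> c x; apply: I; rewrite -scalemxAr !fD mactZ scalemxAl.
have Dm : monoid_morphism D.
  split; first by apply: I; rewrite fD mact1 mul1mx mulmx1.
  move=> x y; rewrite -[RHS]/(D x *m D y); apply: I.
  by rewrite mulmxA !fD -mulmxA fD mulmxA mactM.
pose D1 := GRing.isZmodMorphism.Build _ _ D Da.
pose D2 := GRing.isScalable.Build _ _ _ _ D Ds.
pose D3 := GRing.isMonoidMorphism.Build _ _ D Dm.
pose DL : {lrmorphism B -> 'M[k]_r} := HB.pack D D1 D2 D3.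
by exists (MatMod DL), f; split.
Qed.

Lemma matmod_corestrict V r (g : 'M[k]_(r, mdim V)) (D : B -> 'M[k]_r) :
  row_free g -> (forall b, g *m V b = D b *m g) ->
  exists V' : matmod B, exists g' : 'M[k]_(mdim V', mdim V),
    [/\ mdim V' = r, mod_hom g', row_free g' & (kermx g'^T :=: kermx g^T)%MS].
Proof.
move=> gf gD; have I (M N : 'M[k]_r) : M *m g = N *m g -> M = N by exact: row_free_inj.
have Da : zmod_morphism D.
  by move=> x y; apply: I; rewrite mulmxBl -!gD mactB mulmxBr.
have Ds : scalable D.
  by move=> c x; apply: I; rewrite -scalemxAl -!gD mactZ scalemxAr.
have Dm : monoid_morphism D.
  split; first by apply: I; rewrite -gD mact1 mul1mx mulmx1.
  move=> x y; rewrite -[RHS]/(D x *m D y); apply: I.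
  by rewrite -mulmxA -!gD mulmxA -gD -mulmxA mactM.
pose D1 := GRing.isZmodMorphism.Build _ _ D Da.
pose D2 := GRing.isScalable.Build _ _ _ _ D Ds.
pose D3 := GRing.isMonoidMorphism.Build _ _ D Dm.
pose DL : {lrmorphism B -> 'M[k]_r} := HB.pack D D1 D2 D3.
by exists (MatMod DL), g; split.
Qed.

Definition submod_mx V (U : 'M[k]_(mdim V)) := forall b, stablemx U (V b)^T.

Lemma submodule_exists V (U : 'M[k]_(mdim V)) : submod_mx U ->
  exists V' : matmod B, exists f : 'M[k]_(mdim V, mdim V'),
    [/\ mdim V' = \rank U, mod_hom f, row_free f^T & (f^T :=: U)%MS].
Proof.
move=> stU; pose f := (row_base U)^T.
have [|b|V' [f' [dV' hf' ff' f'U]]] := @matmod_restrict V _ f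
  (fun b => (row_base U *m (V b)^T *m pinvmx (row_base U))^T).
- by rewrite trmxK row_base_free.
- rewrite -trmx_mul mulmxKpV; first by rewrite [LHS]trmx_mul trmxK.
  by rewrite eq_row_base (submx_trans _ (stU b)) // submxMr // eq_row_base.
exists V', f'; split=> //; apply: eqmx_trans f'U _; rewrite trmxK; exact: eq_row_base.
Qed.

Lemma quotient_exists V (U : 'M[k]_(mdim V)) : submod_mx U ->
  exists V' : matmod B, exists g : 'M[k]_(mdim V', mdim V),
    [/\ mdim V' = (mdim V - \rank U)%N, mod_hom g, row_free g & (kermx g^T :=: U)%MS].
Proof.
move=> stU; pose g := (col_base (cokermx U))^T.
have gU : (kermx g^T :=: U)%MS.
  apply/eqmxP/andP; split.
    have gE : cokermx U = g^T *m row_base (cokermx U) by rewrite trmxK mulmx_base.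
    by rewrite [(_ <= U)%MS]submxE [X in _ *m X == 0]gE mulmxA mulmx_ker mul0mx.
  apply/sub_kermxP; rewrite trmxK; apply: (row_free_inj (row_base_free (cokermx U))).
  by rewrite mul0mx -mulmxA mulmx_base mulmx_coker.
have gf : row_free g by rewrite /row_free mxrank_tr; exact: col_base_full.
have [h gh] := row_freeP gf.
have [b|V' [g' [dV' hg' gf' g'U]]] := @matmod_corestrict V _ g (fun b => g *m V b *m h) gf.
- have : (g *m V b) *m (1%:M - h *m g) = 0.
    apply: (can_inj (@trmxK _ _ _)); rewrite trmx0 !trmx_mul mulmxA; apply/sub_kermxP.
    rewrite gU (submx_trans _ (stU b)) // submxMr // -gU; apply/sub_kermxP.
    by rewrite -trmx_mul mulmxBr mulmx1 mulmxA gh mul1mx subrr trmx0.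
  by rewrite mulmxBr mulmx1 mulmxA => /eqP; rewrite subr_eq0 => /eqP.
exists V', g'; split=> //; first by rewrite dV' mxrank_coker.
exact: eqmx_trans g'U gU.
Qed.

Lemma G0_class_sub V (U : 'M[k]_(mdim V)) : submod_mx U ->
  exists V1 V2 : matmod B, exists f : 'M[k]_(mdim V, mdim V1),
  exists g : 'M[k]_(mdim V2, mdim V),
    [/\ short_exact f g, mdim V1 = \rank U, mdim V2 = (mdim V - \rank U)%N,
      (f^T :=: U)%MS & G0_class V = G0_class V1 + G0_class V2].
Proof.
move=> stU; have [V1 [f [d1 hf ff fU]]] := submodule_exists stU.
have [V2 [g [d2 hg gf gU]]] := quotient_exists stU.
have ex : short_exact f g.
  split=> //; apply/eqmxP; apply: eqmx_trans fU _; exact: eqmx_sym.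
by exists V1, V2, f, g; split=> //; exact: G0_class_exact ex.
Qed.

Lemma ker_submod W V (f : 'M[k]_(mdim V, mdim W)) : mod_hom f -> submod_mx (kermx f^T).
Proof.
move=> hf b; apply/sub_kermxP.
by rewrite -mulmxA -trmx_mul hf trmx_mul mulmxA mulmx_ker mul0mx.
Qed.

Lemma im_submod W V (f : 'M[k]_(mdim V, mdim W)) : mod_hom f -> submod_mx <<f^T>>%MS.
Proof.
move=> hf b; rewrite (eqmxMr _ (genmxE _)) genmxE.
by rewrite -trmx_mul -hf trmx_mul submxMl.
Qed.

Lemma G0_class_surj W V (f : 'M[k]_(mdim V, mdim W)) : mod_hom f -> row_free f ->
  exists U : matmod B, exists i : 'M[k]_(mdim W, mdim U),
    [/\ mod_hom i, row_free i^T, (i^T :=: kermx f^T)%MS & G0_class W = G0_class U + G0_class V].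
Proof.
move=> hf ff; have [U [i [dU hi fi iK]]] := submodule_exists (ker_submod hf).
exists U, i; split=> //; apply: (G0_class_exact (f := i) (g := f)).
by split=> //; exact/eqmxP.
Qed.

Lemma G0_class0 V : mdim V = 0%N -> G0_class V = 0.
Proof.
move=> V0; have noI (i : 'I_(mdim V)) : False by case: i => i; rewrite V0.
have ex : @short_exact k B V V V 0 0.
  have free0 (M : 'M[k]_(mdim V)) : row_free M.
    by rewrite -kermx_eq0; apply/eqP/matrixP => i; case: (noI i).
  split=> //; first by move=> b; rewrite mul0mx mulmx0.
    by move=> b; rewrite mul0mx mulmx0.
  by rewrite trmx0 kermx0 sub0mx submx0; apply/eqP/matrixP => i; case: (noI i).
by have /eqP := G0_class_exact ex; rewrite -subr_eq0 opprD addrA subrr sub0r oppr_eq0 => /eqP.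
Qed.

Lemma G0_class_bij W V (f : 'M[k]_(mdim V, mdim W)) : mod_hom f -> row_free f ->
  row_free f^T -> G0_class W = G0_class V.
Proof.
move=> hf ff fT; have [U [i [hi fi iK ->]]] := G0_class_surj hf ff.
rewrite (G0_class0 (V := U)) ?add0r //.
have : \rank (kermx f^T) = 0%N by rewrite mxrank_ker (eqP fT) subnn.
by rewrite -iK; move/eqP: fi => ->.
Qed.

Lemma G0_class_iso W V : mod_iso W V -> G0_class W = G0_class V.
Proof.
move=> [f [g [hf gf fg]]]; apply: (G0_class_bij (f := f) hf).
  by apply/row_freeP; exists g.
by apply/row_freeP; exists g^T; rewrite -trmx_mul gf trmx1.
Qed.

Lemma G0_ind (P : G0 B -> Prop) : P 0 -> (forall x y, P x -> P y -> P (x - y)) ->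
  (forall V, P (G0_class V)) -> forall x, P x.
Proof.
move=> P0 PB PV x.
have PN y : P y -> P (- y) by move=> Py; rewrite -sub0r; exact: PB.
have PD y z : P y -> P z -> P (y + z) by move=> Py Pz; rewrite -[z]opprK; exact/PB/PN.
have PM y (n : int) : P y -> P (y *~ n).
  move=> Py; have Pn m : P (y *+ m).
    by elim: m => [|m IH]; rewrite ?mulr0n // mulrS; exact: PD.
  by case: n => n; rewrite ?NegzE ?mulrNz; [exact: Pn|exact/PN/Pn].
rewrite -[x]reprK -[repr x]freeg_sumE raddf_sum; apply: (big_ind P) => // V _.
have -> : << coeff V (repr x) *g V >> = mod_free V *~ coeff V (repr x).
  by rewrite /mod_free freeg_mulz intz.
by rewrite raddfMz; apply: PM; exact: PV.
Qed.

End Submodules.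

Lemma char_poly_similar (k : fieldType) n (M N P : 'M[k]_n) :
  P \in unitmx -> M *m P = P *m N -> char_poly M = char_poly N.
Proof.
move=> uP MP; rewrite /char_poly /char_poly_mx.
have dP : \det (map_mx polyC P) != 0.
  by rewrite det_map_mx polyC_eq0 -unitfE -unitmxE.
apply: (mulIf dP); rewrite -det_mulmx mulrC -det_mulmx; congr (\det _).
by rewrite mulmxBl mulmxBr -!map_mxM MP scalar_mxC.
Qed.

(** In a basis formed by the image of [f] and a lift of the quotient, [M] is block triangular with
    diagonal blocks [M1] and [M2]. *)
Lemma char_poly_ext (k : fieldType) n n1 n2 (f : 'M[k]_(n, n1)) (g : 'M[k]_(n2, n))
    (M : 'M[k]_n) (M1 : 'M[k]_n1) (M2 : 'M[k]_n2) : n = (n1 + n2)%N ->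
  row_free f^T -> row_free g -> g *m f = 0 -> f *m M1 = M *m f -> g *m M = M2 *m g ->
  char_poly M = char_poly M1 * char_poly M2.
Proof.
move=> nE; subst n => ff gf gf0 fM gM.
have [s gs] := row_freeP gf; have [r' fr'] := row_freeP ff.
have rf : r'^T *m f = 1%:M by rewrite -[f]trmxK -trmx_mul fr' trmx1.
set r := r'^T in rf.
pose P := row_mx f s; pose Q := col_mx (r *m (1%:M - s *m g)) g.
have QP : Q *m P = 1%:M.
  rewrite mul_col_row -!mulmxA !mulmxBl !mul1mx -!mulmxA gf0 gs mulmx0 subr0 mulmx1 subrr.
  by rewrite rf mulmx0 -scalar_mx_block.
have PQ := mulmx1C QP.
have uP : P \in unitmx by case: (mulmx1_unit PQ).
have -> : char_poly M = char_poly (Q *m M *m P).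
  by apply: (char_poly_similar uP); rewrite !mulmxA PQ mul1mx.
have -> : Q *m M *m P = block_mx M1 (r *m (1%:M - s *m g) *m M *m s) 0 M2.
  rewrite mul_col_mx mul_col_row; congr block_mx.
  - rewrite -[_ *m M *m f]mulmxA -fM mulmxA -[r *m _ *m f]mulmxA mulmxBl mul1mx.
    by rewrite -[s *m g *m f]mulmxA gf0 mulmx0 subr0 rf mul1mx.
  - by rewrite gM -mulmxA gf0 mulmx0.
  - by rewrite gM -mulmxA gs mulmx1.
rewrite /char_poly /char_poly_mx map_block_mx scalar_mx_block opp_block_mx add_block_mx.
by rewrite map_mx0 oppr0 addr0 det_ublock.
Qed.

(** * Integer invariants of the Grothendieck group *)

Section Multiplicity.
Variables (k : fieldType) (B : algType k).

Lemma short_exact_dim (V' V V'' : matmod B) f g : @short_exact k B V' V V'' f g ->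
  mdim V = (mdim V' + mdim V'')%N.
Proof.
move=> [_ _ ff gf /eqmxP fg]; have := mxrank_ker g^T.
rewrite -fg (eqP ff) mxrank_tr (eqP gf) => ->.
by rewrite subnK // -(eqP gf) rank_leq_col.
Qed.

Lemma char_poly_exact (V' V V'' : matmod B) f g b : @short_exact k B V' V V'' f g ->
  char_poly (V b) = char_poly (V' b) * char_poly (V'' b).
Proof.
move=> ex; have [hf hg ff gf fg] := ex.
apply: (char_poly_ext (f := f) (g := g)) => //; first exact: short_exact_dim ex.
apply: (can_inj (@trmxK _ _ _)); rewrite trmx0 trmx_mul; apply/sub_kermxP.
by case/andP: fg.
Qed.

(** The algebraic multiplicity of the eigenvalue 1 of [b]. It is additive on exact sequences, equals
    the rank when [b] acts as an idempotent, and, unlike a trace, is an integer in every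
    characteristic. *)
Definition mod_mult (b : B) (V : matmod B) : int := (mup 1 (char_poly (V b)))%:Z.

Fact mod_mult_exact b (V' V V'' : matmod B) f g : @short_exact k B V' V V'' f g ->
  mod_mult b V = mod_mult b V' + mod_mult b V''.
Proof.
move=> ex; rewrite /mod_mult (char_poly_exact b ex) mupM ?monic_neq0 ?char_poly_monic //.
Qed.

Definition G0_mult b : {additive G0 B -> int} := G0_lift (mod_mult_exact b).

Lemma G0_mult_class b V : G0_mult b (G0_class V) = mod_mult b V.
Proof. exact: G0_lift_class. Qed.

Fact mod_dim_exact (V' V V'' : matmod B) f g : @short_exact k B V' V V'' f g ->
  (mdim V)%:Z = (mdim V')%:Z + (mdim V'')%:Z.
Proof. by move=> /short_exact_dim ->. Qed.

Lemma G0_class_dim (V W : matmod B) : G0_class V = G0_class W -> mdim V = mdim W.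
Proof.
move/(congr1 (G0_lift mod_dim_exact)); rewrite !G0_lift_class => /eqP.
by move=> E; exact/eqP.
Qed.

Lemma mod_mult0 b (V : matmod B) : V b = 0 -> mod_mult b V = 0.
Proof.
move=> Vb; rewrite /mod_mult Vb (_ : char_poly _ = 'X^(mdim V)).
  by rewrite -['X]subr0 -polyC0 mup_XsubCX eq_sym oner_eq0.
by rewrite /char_poly /char_poly_mx map_mx0 subr0 det_scalar.
Qed.

Lemma mod_mult_gt0 b (V : matmod B) (v : 'rV[k]_(mdim V)) : v *m V b = v -> v != 0 -> mod_mult b V != 0.
Proof.
move=> vb v0; have : eigenvalue (V b) 1 by apply/eigenvalueP; exists v; rewrite ?scale1r.
rewrite eigenvalue_root_char -dvdp_XsubCl XsubC_dvd ?monic_neq0 ?char_poly_monic //.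
by rewrite /mod_mult lt0n.
Qed.

End Multiplicity.

(** * Cellular algebras over a field *)

Section CellularField.
Variables (R : comNzRingType) (A : algType R) (C : cell_datum A).
Variables (k : fieldType) (phi : {rmorphism R -> k}).
Local Notation Lam := (cell_poset C).
Local Notation tab := (@cell_tab R A C).
Local Notation I := {l : cell_poset C & (cell_tab l * cell_tab l)%type}.
Local Notation elt := (@cell_elt R A C _).
Local Notation B := (scext C phi).
Local Notation sc := (scin C phi).
Local Notation gram l := (map_mx phi (cell_gram l)).
Local Notation W := (cell_mod phi).
Implicit Types (l m : Lam) (V : matmod B).

Definition killed_by V m := forall s t : tab m, V (sc (elt s t)) = 0.

Lemma killed_supported V (D : pred Lam) y :
  (forall m, D m -> killed_by V m) -> supported D y -> V (sc y) = 0.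
Proof.
move=> DV Dy; rewrite (supportedE Dy).
have -> : sc (\sum_(i | D (tag i)) bcoord C y i *: C i)
    = \sum_(i | D (tag i)) phi (bcoord C y i) *: sc (C i).
  by rewrite raddf_sum; apply: eq_bigr => i _; rewrite -scinZ.
rewrite mact_sum big1 // => -[m [s t]] Dm.
by rewrite mactZ (DV m Dm s t) scaler0.
Qed.

(** The map sends [s] to [elt s t] applied to [v]; it is a homomorphism since the remainder in (C3)
    acts as zero on [V]. *)
Lemma cell_mod_hom V l (t : tab l) (v : 'cV[k]_(mdim V)) :
  (forall m, (m < l)%O -> killed_by V m) ->
  mod_hom (W := W l) (V := V)
    (\matrix_(i < mdim V, j < #|tab l|) (V (sc (elt (enum_val j) t)) *m v) i 0).
Proof.
move=> kill; apply: matmod_comm_scin => i; rewrite cell_mod_scin.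
set a := C i; apply/matrixP => p j; rewrite !mxE.
have [y ly E] := cell_mulE a (enum_val j) t.
have : V (sc (a * elt (enum_val j) t)) *m v =
    \sum_w phi (cell_coef a w (enum_val j)) *: (V (sc (elt w t)) *m v).
  rewrite E raddfD mactD [V (sc y)](killed_supported kill ly) addr0.
  rewrite raddf_sum mact_sum mulmx_suml; apply: eq_bigr => w _.
  by rewrite /= scinZ mactZ -scalemxAl.
rewrite rmorphM mactM -mulmxA => /matrixP/(_ p 0); rewrite mxE => E'.
transitivity (\sum_w (V (sc a)) p w * (V (sc (elt (enum_val j) t)) *m v) w 0); last first.
  by apply: eq_bigr => w _; rewrite !mxE.
rewrite E' summxE [RHS](reindex_onto enum_val enum_rank) /=; last first.
  by move=> w _; rewrite enum_rankK.
rewrite [RHS](eq_bigl xpredT) => [|w]; last by rewrite enum_valK eqxx.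
by apply: eq_bigr => w _; rewrite !mxE mulrC.
Qed.

Lemma cell_mod_elt_mul l (s t : tab l) (u : 'rV[k]_#|tab l|) :
  u *m (W l (sc (elt s t)))^T
  = (u *m gram l) 0 (enum_rank t) *: delta_mx 0 (enum_rank s).
Proof.
apply/rowP => j; rewrite !mxE.
transitivity ((j == enum_rank s)%:R * \sum_w u 0 w * phi (cell_form t (enum_val w))).
  rewrite mulr_sumr; apply: eq_bigr => w _; rewrite mxE cell_mod_elt mulrCA.
  by rewrite -{1}(enum_rankK s) (inj_eq enum_val_inj).
rewrite mulrC eqxx; congr (_ * _); apply: eq_bigr => w _.
by rewrite !mxE enum_rankK cell_form_sym.
Qed.

(** If some vector of [U] pairs nontrivially with [t], the elements [elt s t] move it to nonzero
    multiples of all basis vectors [s]. *)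
Lemma cell_mod_submod l (U : 'M[k]_#|tab l|) : submod_mx (V := W l) U ->
  U *m gram l = 0 \/ row_full U.
Proof.
move=> stU; have [|nz] := eqVneq (U *m gram l) 0; [by left|right].
have /matrix0Pn [i [j nzij]] := nz.
rewrite -sub1mx; apply/row_subP => s; rewrite rowE mulmx1.
have := stU (sc (elt (enum_val s) (enum_val j))).
move=> /(submx_trans (submxMr _ (row_sub i U))); rewrite cell_mod_elt_mul !enum_valK.
by rewrite -row_mul [row _ _ 0 _]mxE eqmx_scale.
Qed.

Lemma cell_mod_killed l m : ~~ (m <= l)%O -> killed_by (W m) l.
Proof. by move=> ml s t; exact: cell_mod_elt0. Qed.

Lemma killed_sub V V' (f : 'M[k]_(mdim V, mdim V')) m :
  mod_hom f -> row_free f^T -> killed_by V m -> killed_by V' m.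
Proof.
move=> hf ff kV s t; apply: (row_free_mulmxI ff).
by rewrite hf kV mul0mx mulmx0.
Qed.

Lemma killed_quot V V' (g : 'M[k]_(mdim V', mdim V)) m :
  mod_hom g -> row_free g -> killed_by V m -> killed_by V' m.
Proof.
move=> hg gf kV s t; apply: (row_free_inj gf).
by rewrite /= -hg kV mul0mx mulmx0.
Qed.

Lemma killed_rad l V (f : 'M[k]_(#|tab l|, mdim V)) :
  mod_hom (W := V) (V := W l) f -> row_free f^T -> f^T *m gram l = 0 -> killed_by V l.
Proof.
move=> hf ff fG s t; apply: (row_free_mulmxI ff); rewrite mulmx0 hf.
apply: (can_inj (@trmxK _ _ _)); rewrite trmx_mul trmx0; apply/row_matrixP => i.
by rewrite row_mul cell_mod_elt_mul -row_mul fG !row0 mxE scale0r.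
Qed.

(** Choose [l] minimal among the shapes acting nontrivially on [V], then [t] and [v] for which the
    map of [cell_mod_hom] is nonzero. *)
Lemma nonzero_hom V : (0 < mdim V)%N -> exists l, exists f : 'M[k]_(mdim V, #|tab l|),
  [/\ mod_hom (W := W l) (V := V) f, f != 0, forall m, (m < l)%O -> killed_by V m
    & ~ killed_by V l].
Proof.
move=> V0; have [l0 nk0] : exists l, ~ killed_by V l.
  apply: contrapT => /forallNP H.
  have V1 : V 1 = 0.
    rewrite -(rmorph1 sc); apply: (killed_supported (D := xpredT)) => // m _.
    by apply: contrapT; exact: H.
  have := mact1 V; rewrite V1 => /matrixP/(_ (Ordinal V0) (Ordinal V0)).
  by rewrite !mxE eqxx => /eqP; rewrite eq_sym oner_eq0.
have [l nkl minl] := finposet_min (P := fun l => `[< ~ killed_by V l >]) (asboolT nk0).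
move/asboolP: nkl => nkl.
have kill m : (m < l)%O -> killed_by V m.
  move=> ml; apply: contrapT => /asboolT/minl/(_ (ltW ml)) mE.
  by rewrite mE ltxx in ml.
have [s [t nz]] : exists s t : tab l, V (sc (elt s t)) != 0.
  apply: contrapT => H; apply: nkl => s t; apply/eqP; apply: contrapT => nst.
  by apply: H; exists s, t; apply/negP.
have [v nzv] : exists v : 'cV[k]_(mdim V), V (sc (elt s t)) *m v != 0.
  apply: contrapT => /forallNP H; move/eqP: nz; apply; apply/matrixP => i j.
  have /negP := H (delta_mx j 0); rewrite negbK => /eqP/matrixP/(_ i 0).
  by rewrite -colE !mxE.
exists l, (\matrix_(i < mdim V, j < #|tab l|) (V (sc (elt (enum_val j) t)) *m v) i 0); split=> //.
  exact: cell_mod_hom.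
apply: contraNneq nzv => f0; apply/eqP/colP => i.
by have /matrixP/(_ i (enum_rank s)) := f0; rewrite !mxE enum_rankK => ->.
Qed.

Definition cell_nz l := gram l != 0.

(** The map from [nonzero_hom] is onto by simplicity, and its proper kernel lies in the radical. The
    form is nonzero, for otherwise the whole cell module, and with it [V], would be killed by its
    own shape. *)
Lemma simple_cover V : mod_simple V -> exists l, exists f : 'M[k]_(mdim V, #|tab l|),
  [/\ mod_hom (W := W l) (V := V) f, row_free f, kermx f^T *m gram l = 0, cell_nz l
    & ~ killed_by V l].
Proof.
move=> [V0 sV]; have [l [f [hf f0 kill nk]]] := nonzero_hom V0.
have ff : row_free f.
  have [] := sV _ (im_submod (W := W l) (V := V) hf); rewrite mxrank_gen mxrank_tr.
    by move=> /eqP; rewrite mxrank_eq0 (negPf f0).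
  by move=> fr; rewrite /row_free fr.
exists l, f; split=> //.
  have [//|] := cell_mod_submod (ker_submod (W := W l) (V := V) hf).
  rewrite -sub1mx => /sub_kermxP; rewrite mul1mx => fT0.
  by move: f0; rewrite -[f]trmxK fT0 trmx0 eqxx.
apply: contra_notN nk => /eqP g0; apply: (killed_quot (V := W l) hf ff).
apply: (killed_rad (V := W l) (f := 1%:M)).
- by move=> b; rewrite mul1mx mulmx1.
- by rewrite trmx1 /row_free mxrank1.
- by rewrite g0 mulmx0.
Qed.

Definition cell_span (x : G0 B) := exists n : Lam -> int,
  (forall l, ~~ cell_nz l -> n l = 0) /\ x = \sum_l G0_class (W l) *~ n l.

Lemma cell_span0 : cell_span 0.
Proof. by exists (fun=> 0); split=> //; rewrite big1 // => l _; rewrite mulr0z. Qed.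

Lemma cell_spanB x y : cell_span x -> cell_span y -> cell_span (x - y).
Proof.
move=> [n [n0 ->]] [m [m0 ->]]; exists (fun l => n l - m l); split.
  by move=> l nz; rewrite n0 // m0 // subr0.
by rewrite -sumrB; apply: eq_bigr => l _; rewrite mulrzBr.
Qed.

Lemma cell_spanD x y : cell_span x -> cell_span y -> cell_span (x + y).
Proof.
move=> xs ys; rewrite -[y]opprK; apply: cell_spanB => //.
by rewrite -sub0r; apply: cell_spanB => //; exact: cell_span0.
Qed.

Lemma cell_span_cell l : cell_nz l -> cell_span (G0_class (W l)).
Proof.
move=> nz; exists (fun m => (m == l)%:Z); split.
  by move=> m; apply: contraNeq; case: (m =P l) => [->|].
rewrite (bigD1 l) //= eqxx mulr1z big1 ?addr0 // => m /negPf ->.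
by rewrite mulr0z.
Qed.

(** A simple [V] has class [[W l] - [U]] with [U] in the radical of [W l]. Only shapes strictly
    above [l] act on [U], so the induction is on an up-closed set [X] containing all shapes that act
    on [V], and then on the dimension. *)
Lemma G0_cell_span x : cell_span x.
Proof.
apply: (G0_ind (P := cell_span)) => [|? ?|V]; [exact: cell_span0|exact: cell_spanB|].
have : exists2 X : {set Lam}, (forall m l, m \in X -> (m <= l)%O -> l \in X) &
    forall m, m \notin X -> killed_by V m.
  by exists [set: Lam] => [m l _ _|m]; rewrite inE.
case=> X; have [n] := ubnP #|X|; elim: n X V => // n IHX X V; rewrite ltnS => Xn upX.
have [d] := ubnP (mdim V); elim: d V => // d IHd V; rewrite ltnS => Vd kV.
have [V0|] := posnP (mdim V); first by rewrite G0_class0 //; exact: cell_span0.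
move=> V_gt0; have [sV|nsV] := pselect (mod_simple V); last first.
  have [U stU [U0 UV]] : exists2 U : 'M[k]_(mdim V), submod_mx U &
      \rank U != 0%N /\ \rank U != mdim V.
    apply: contrapT => H; apply: nsV; split=> // U stU.
    have [|U0] := eqVneq (\rank U) 0%N; [by left|right].
    by apply/eqP; apply: contraT => UV; case: H; exists U.
  have [V1 [V2 [f [g [[hf hg ff gf _] d1 d2 _ ->]]]]] := G0_class_sub stU.
  have lt1 : (\rank U < mdim V)%N by rewrite ltn_neqAle UV rank_leq_row.
  apply: cell_spanD; apply: IHd.
  - by rewrite d1 (leq_trans lt1).
  - by move=> m mX; apply: (killed_sub hf ff); exact: kV.
  - by rewrite d2 (leq_trans _ Vd) // ltn_subrL lt0n U0.
  - by move=> m mX; apply: (killed_quot hg gf); exact: kV.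
have [l [f [hf ff kG nz nk]]] := simple_cover sV.
have [U [i [hi fi iK E]]] := G0_class_surj (W := W l) (V := V) hf ff.
have -> : G0_class V = G0_class (W l) - G0_class U by rewrite E addrC addKr.
apply: cell_spanB; first exact: cell_span_cell.
have lX : l \in X by apply: contra_notT nk => /kV.
apply: (IHX [set m in X | (l < m)%O]).
- apply: leq_trans Xn; apply: proper_card; apply/properP; split.
    by apply/fintype.subsetP => m; rewrite inE => /andP [].
  by exists l; rewrite // inE ltxx andbF.
- move=> m m'; rewrite !inE => /andP [mX lm] mm'.
  by rewrite (upX m) //= (lt_le_trans lm).
move=> m; rewrite inE negb_and => mN.
have iG : i^T *m gram l = 0.
  by apply/eqP; rewrite -submx0 (eqmxMr _ iK) kG submx0.
have [->|ml] := eqVneq m l; first exact: (killed_rad (f := i) hi fi iG).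
apply: (killed_sub (V := W l) hi fi); apply: cell_mod_killed.
apply: contraTN mN => lm; rewrite negb_or !negbK (upX l) //=.
by rewrite lt_neqAle lm eq_sym ml.
Qed.

Lemma cell_mod_simple l : (0 < #|tab l|)%N -> gram l \in unitmx -> mod_simple (W l).
Proof.
move=> l0 uG; split=> // U stU; have [UG|] := cell_mod_submod (l := l) stU.
  left; apply/eqP; rewrite mxrank_eq0; apply/eqP.
  by rewrite -[U](mulmxK uG) UG mul0mx.
by move=> /eqP; right.
Qed.

Lemma simple_iso_cell V : (forall l, gram l \in unitmx) -> mod_simple V ->
  exists2 l, (0 < #|tab l|)%N & mod_iso (W l) V.
Proof.
move=> uG sV; have [l [f [hf ff kG _ _]]] := simple_cover sV.
have K0 : kermx f^T = 0 by rewrite -[kermx f^T](mulmxK (uG l)) kG mul0mx.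
have fT : row_free f^T by rewrite -kermx_eq0 K0.
have vl : mdim V = #|tab l| by rewrite -(eqP ff) -mxrank_tr (eqP fT).
exists l; first by rewrite -vl; case: sV.
have [g fg] := row_freeP ff; have [h fh] := row_freeP fT.
have hf1 : h^T *m f = 1%:M by rewrite -[f]trmxK -trmx_mul fh trmx1.
exists f, g; split=> //.
by rewrite -[g *m f]mul1mx -hf1 -mulmxA [f *m (g *m f)]mulmxA fg mul1mx.
Qed.

(** These functionals are triangular on cell classes: the scaled [elt s t] acts as zero on [W m]
    unless [m <= l], and has eigenvalue 1 on [W l]. *)
Lemma cell_mod_mult l (s t : tab l) (c := phi (cell_form t s)) : c != 0 ->
  (forall m, ~~ (m <= l)%O -> mod_mult (c^-1 *: sc (elt s t)) (W m) = 0) /\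
  mod_mult (c^-1 *: sc (elt s t)) (W l) != 0.
Proof.
move=> c0; split=> [m ml|]; first by apply: mod_mult0; rewrite mactZ cell_mod_elt0 // scaler0.
apply: (@mod_mult_gt0 _ _ _ (W l) (row (enum_rank t) (gram l))); last first.
  apply: contraNneq c0 => /rowP/(_ (enum_rank s)); rewrite !mxE !enum_rankK => E.
  by rewrite /c E.
apply/rowP => j; rewrite mactZ -scalemxAr mxE mxE (bigD1 (enum_rank s)) //= big1 ?addr0.
  by rewrite cell_mod_elt !mxE !enum_rankK eqxx mul1r mulrA mulVf ?mul1r.
by move=> i ns; rewrite cell_mod_elt -(enum_rankK s) (inj_eq enum_val_inj) (negPf ns) mul0r mulr0.
Qed.

End CellularField.

Lemma mod_iso_sym (S : comNzRingType) (B : algType S) (V W : matmod B) :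
  mod_iso V W -> mod_iso W V.
Proof.
move=> [f [g [hf gf fg]]]; exists g, f; split=> // b.
by rewrite -[W b]mulmx1 -fg [W b *m _]mulmxA -hf !mulmxA gf mul1mx.
Qed.

Lemma mod_iso_trans (S : comNzRingType) (B : algType S) (U V W : matmod B) :
  mod_iso U V -> mod_iso V W -> mod_iso U W.
Proof.
move=> [f [g [hf gf fg]]] [f' [g' [hf' gf' fg']]]; exists (f' *m f), (g *m g'); split.
- by move=> b; rewrite -mulmxA hf mulmxA hf' mulmxA.
- by rewrite mulmxA -[g *m g' *m f']mulmxA gf' mulmx1.
- by rewrite mulmxA -[f' *m f *m g]mulmxA fg mulmx1.
Qed.

(** * Compatibility of cell modules with base change *)

Section BaseChange.
Variables (R S S' : comNzRingType) (A : algType R) (C : cell_datum A).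
Variables (phi : {rmorphism R -> S}) (phi' : {rmorphism R -> S'}).
Variables (psi : {rmorphism S -> S'}) (psiE : forall r, psi (phi r) = phi' r).

Definition scext_map (x : scext C phi) : scext C phi' := [ffun i => psi (x i)].

Lemma mod_ext_map (V : matmod (scext C phi)) x :
  mod_ext psiE V (scext_map x) = map_mx psi (V x).
Proof.
rewrite [RHS](congr1 (map_mx psi) (mod_scin_ext V x)) raddf_sum.
by apply: eq_bigr => i _; rewrite /= map_mxZ ffunE.
Qed.

Lemma cell_mod_ext (l : cell_poset C) : mod_iso (mod_ext psiE (cell_mod phi l)) (cell_mod phi' l).
Proof.
exists (1%:M : 'M_#|cell_tab l|), (1%:M : 'M_#|cell_tab l|); rewrite !mulmx1; split=> //.
apply: matmod_comm_scin => i; rewrite mul1mx mulmx1.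
rewrite [LHS]mod_ext_act_scin !cell_mod_scin -map_mx_comp.
by apply: eq_map_mx => r /=; rewrite psiE.
Qed.

Lemma cell_mod_map (l : cell_poset C) x : cell_mod phi' l (scext_map x) = map_mx psi (cell_mod phi l x).
Proof.
rewrite (mod_scin_ext (cell_mod phi' l)) [RHS](congr1 (map_mx psi) (mod_scin_ext (cell_mod phi l) x)).
rewrite raddf_sum; apply: eq_bigr => i _; rewrite /= map_mxZ ffunE; congr (_ *: _).
rewrite -[mod_ext_act _ _ _]/(cell_mod phi' l (scin C phi' (C i))) cell_mod_scin.
rewrite -[mod_ext_act _ _ _]/(cell_mod phi l (scin C phi (C i))) cell_mod_scin -map_mx_comp.
by apply: eq_map_mx => r /=; rewrite psiE.
Qed.

End BaseChange.

Section FieldLemmas.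
Variables (R : comNzRingType) (A : algType R) (C : cell_datum A).
Variables (k : fieldType) (phi : {rmorphism R -> k}).
Local Notation Lam := (cell_poset C).
Local Notation tab := (@cell_tab R A C).
Local Notation elt := (@cell_elt R A C _).
Local Notation B := (scext C phi).
Local Notation sc := (scin C phi).
Local Notation gram l := (map_mx phi (cell_gram l)).
Local Notation W := (cell_mod phi).
Implicit Types (l m : Lam) (V : matmod B).

Lemma cell_nz_tab l : cell_nz phi l -> (0 < #|tab l|)%N.
Proof. by move=> /matrix0Pn [i _]; apply: leq_ltn_trans (ltn_ord i). Qed.

Lemma cell_nz_form l : cell_nz phi l -> exists s t : tab l, phi (cell_form t s) != 0.
Proof.
by move=> /matrix0Pn [i [j]]; rewrite !mxE => ij; exists (enum_val j), (enum_val i).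
Qed.

Lemma gram_unit_nz l : (0 < #|tab l|)%N -> gram l \in unitmx -> cell_nz phi l.
Proof.
move=> l0 uG; apply/eqP => G0; move: uG; rewrite unitmxE G0 -(prednK l0) det0 ?unitr0 //.
Qed.

Lemma gram_unit0 l : #|tab l| = 0%N -> gram l \in unitmx.
Proof. by move=> l0; rewrite unitmxE; move: (gram l); rewrite l0 => M; rewrite det_mx00 unitr1. Qed.

(** At a minimal [l] with nonzero coefficient, the functional of [cell_mod_mult] sees only the term
    of [l]. *)
Lemma cell_span_uniq (n : Lam -> int) : (forall l, ~~ cell_nz phi l -> n l = 0) ->
  \sum_l G0_class (W l) *~ n l = 0 -> forall l, n l = 0.
Proof.
move=> n0 sum0 l1; apply/eqP; apply: contraT => nl1.
have [l nl minl] := finposet_min (P := fun l => n l != 0) nl1.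
have [s [t c0]] : exists s t : tab l, phi (cell_form t s) != 0.
  by apply: cell_nz_form; apply: contraNT nl => /n0 ->.
have [z nz] := cell_mod_mult c0.
have := congr1 (G0_mult ((phi (cell_form t s))^-1 *: sc (elt s t))) sum0.
rewrite raddf0 raddf_sum (bigD1 l) //= big1 => [|m ml].
  rewrite addr0 raddfMz G0_mult_class -mulrzr => /eqP.
  by rewrite mulf_eq0 (negPf nz) /= intz (negPf nl).
rewrite raddfMz G0_mult_class; have [nm|nm] := eqVneq (n m) 0; first by rewrite nm mulr0z.
rewrite z ?mul0rz //; apply: contraNN ml => lm.
by rewrite (minl m nm lm).
Qed.

Lemma cell_class_inj l m : cell_nz phi l -> cell_nz phi m ->
  G0_class (W l) = G0_class (W m) -> l = m.
Proof.
move=> nzl nzm E; apply/eqP; apply: contraT => lm.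
pose n (i : Lam) : int := (i == l)%:Z - (i == m)%:Z.
have : n l = 0.
  apply: cell_span_uniq => [i|].
    by rewrite /n; case: eqP => [->|_]; case: eqP => [->|_]; rewrite ?nzl ?nzm.
  under eq_bigr do rewrite /n mulrzBr.
  rewrite sumrB (bigD1 l) //= eqxx mulr1z big1 => [|i /negPf ->]; last by rewrite mulr0z.
  rewrite (bigD1 m) //= eqxx mulr1z big1 => [|i /negPf ->]; last by rewrite mulr0z.
  by rewrite !addr0 E subrr.
by rewrite /n eqxx (negPf lm).
Qed.

(** The form is contravariant for the involution: [elt t t * a] is computed directly, and through
    the involution from [cell_star C a * elt t t]. *)
Lemma gram_invariant l a :
  cell_gram l *m cell_rep l a = (cell_rep l (cell_star C a))^T *m cell_gram l.
Proof.
apply/matrixP => i j; pose t := enum_val i.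
have [y ly E] := cell_mulE (cell_star C a) t t.
have E' : elt t t * a = \sum_t' cell_coef (cell_star C a) t' t *: elt t t' + cell_star C y.
  rewrite -[LHS](@cell_starK R A C _) cell_starM cell_starE E linearD linear_sum.
  by congr (_ + _); apply: eq_bigr => t' _; rewrite linearZ /= cell_starE.
have := congr1 (fun x => cell_rep l x i j) E'.
rewrite cell_repM cell_repD [in X in _ = X]mxE mxE.
rewrite [X in _ = _ + X]mxE (cell_coef_supported _ _ (@down_closed_lt _ _ C l) (supported_star ly)) ?ltxx //.
rewrite addr0 => E2; rewrite mxE [RHS]mxE.
transitivity (\sum_w cell_rep l (elt t t) i w * cell_rep l a w j).
  by apply: eq_bigr => w _; rewrite !mxE cell_coef_elt eqxx mul1r.
rewrite E2.
have -> : cell_rep l (\sum_t' cell_coef (cell_star C a) t' t *: elt t t')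
    = \sum_t' cell_coef (cell_star C a) t' t *: cell_rep l (elt t t').
  rewrite (big_morph (cell_rep l) (@cell_repD _ _ C l) (_ : cell_rep l 0 = 0)).
    by apply: eq_bigr => t' _; rewrite cell_repZ.
  by rewrite -(scale0r 0) cell_repZ scale0r.
rewrite summxE (reindex_onto enum_val enum_rank) /=; last by move=> w _; rewrite enum_rankK.
rewrite (eq_bigl xpredT) => [|w]; last by rewrite enum_valK eqxx.
by apply: eq_bigr => w _; rewrite !mxE cell_coef_elt eqxx mul1r.
Qed.

Lemma cell_gram_tr l : (cell_gram l)^T = cell_gram l.
Proof. by apply/matrixP => i j; rewrite !mxE cell_form_sym. Qed.

Lemma submod_mx_scin V (U : 'M[k]_(mdim V)) :
  (forall i, stablemx U (V (sc (C i)))^T) -> submod_mx U.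
Proof.
move=> st b; rewrite (mod_scin_ext V) raddf_sum mulmx_sumr summx_sub // => i _.
by rewrite /= linearZ /= -scalemxAr scalemx_sub.
Qed.

Lemma rad_submod l : submod_mx (V := W l) (kermx (gram l)).
Proof.
apply: submod_mx_scin => i; apply/sub_kermxP; rewrite cell_mod_scin map_trmx.
rewrite -mulmxA -map_mxM -[cell_gram l]cell_gram_tr -trmx_mul gram_invariant.
by rewrite trmx_mul trmxK map_mxM cell_gram_tr mulmxA mulmx_ker mul0mx.
Qed.

(* A nonzero radical of the form would receive a nonzero map from some [W m]  *)
(* with [m != l].                                                             *)
Lemma gram_unit_of_scalars l (x : B) (c : k) : c != 0 -> W l x = c%:M ->
  (forall m, m != l -> W m x = 0) -> gram l \in unitmx.
Proof.
move=> c0 xl xm; rewrite -row_free_unit -kermx_eq0 -mxrank_eq0.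
have [V [i [dV hi fi iN]]] := submodule_exists (@rad_submod l).
rewrite -dV; apply/negPn/negP; rewrite -lt0n => V0.
have kV : killed_by V l.
  apply: (killed_rad (f := i) hi fi).
  by apply/eqP; rewrite -submx0 (eqmxMr _ iN) mulmx_ker submx0.
have Vx : V x = c%:M.
  by apply: (row_free_mulmxI fi); rewrite hi xl mul_mx_scalar mul_scalar_mx.
have [m [f [hf f0 _ nk]]] := nonzero_hom V0.
have ml : m != l by apply: contra_notN nk => /eqP ->.
move/eqP: f0; apply; have := hf x; rewrite Vx (xm m ml) mulmx0 mul_scalar_mx => /esym/eqP.
by rewrite scalemx_eq0 (negPf c0) => /eqP.
Qed.

(** [V] is a quotient of some [W m]; comparing multiplicities of scaled basis elements of shapes [l]
    and [m] gives [m = l]. Equal dimensions then make the quotient map bijective, so [W l] has no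
    proper nonzero submodule and its radical vanishes. *)
Lemma simple_class_unit l V : cell_nz phi l -> mod_simple V -> G0_class V = G0_class (W l) ->
  gram l \in unitmx.
Proof.
move=> nzl sV VE; have [m [f [hf ff kG nzm _]]] := simple_cover sV.
have [s [t c0]] := cell_nz_form nzl; have [zl nl] := cell_mod_mult c0.
have [s' [t' c0']] := cell_nz_form nzm; have [zm nm] := cell_mod_mult c0'.
have multE b : mod_mult b V = mod_mult b (W l) by rewrite -!G0_mult_class VE.
have ml : (m <= l)%O.
  apply: contraT => nml; move: nl; rewrite -multE mod_mult0 ?eqxx //.
  apply: (row_free_inj ff); rewrite /= mul0mx -hf mactZ cell_mod_elt0 // scaler0 mulmx0 //.
have lm : (l <= m)%O.
  apply: contraT => nlm; have := zm l nlm; rewrite -multE => z.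
  have [U [i [hi fi iK E]]] := G0_class_surj (W := W m) (V := V) hf ff.
  have := congr1 (G0_mult ((phi (cell_form t' s'))^-1 *: sc (elt s' t'))) E.
  rewrite raddfD !G0_mult_class z addr0 [mod_mult _ U]mod_mult0 => [E0|].
    by move: nm; rewrite E0 eqxx.
  have iG : i^T *m gram m = 0 by apply/eqP; rewrite -submx0 (eqmxMr _ iK) kG submx0.
  by rewrite mactZ (killed_rad (f := i) hi fi iG) scaler0.
have mE : m = l by apply/eqP; rewrite eq_le ml.
subst m; have dV : mdim V = #|tab l| by have := G0_class_dim VE.
have fT : row_free f^T by rewrite /row_free mxrank_tr (eqP ff) dV.
rewrite -row_free_unit -kermx_eq0 -mxrank_eq0.
set N := kermx (gram l); case: sV => _ /(_ <<N *m f^T>>%MS) [|/eqP|].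
- move=> b; rewrite (eqmxMr _ (genmxE _)) genmxE -mulmxA -trmx_mul -hf trmx_mul mulmxA.
  exact/submxMr/rad_submod.
- by rewrite mxrank_gen mxrankMfree.
- rewrite mxrank_gen mxrankMfree // dV /N mxrank_ker => E.
  move: nzl; rewrite /cell_nz -mxrank_eq0 => r0; exfalso.
  have := rank_leq_row (gram l); have := lt0n (\rank (gram l)); rewrite r0; lia.
Qed.

End FieldLemmas.

Section GateBijective.
Variables (R : comNzRingType) (k k' : fieldType) (A : algType R) (C : cell_datum A).
Variables (phi : {rmorphism R -> k}) (phi' : {rmorphism R -> k'}).
Variables (psi : {rmorphism k -> k'}) (psiE : forall r, psi (phi r) = phi' r).

Lemma G0_ext_cell l :
  G0_ext C psiE (G0_class (cell_mod phi l)) = G0_class (cell_mod phi' l).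
Proof. by rewrite G0_ext_class; apply/G0_class_iso/cell_mod_ext. Qed.

Lemma cell_nz_ext (l : cell_poset C) : cell_nz phi' l = cell_nz phi l.
Proof.
rewrite /cell_nz -[X in X != 0 = _](_ : map_mx psi (map_mx phi (cell_gram l)) = _).
  by rewrite map_mx_eq0.
by rewrite -map_mx_comp; apply: eq_map_mx => r /=; rewrite psiE.
Qed.

Lemma G0_ext_sum (n : cell_poset C -> int) :
  G0_ext C psiE (\sum_l G0_class (cell_mod phi l) *~ n l)
  = \sum_l G0_class (cell_mod phi' l) *~ n l.
Proof. by rewrite raddf_sum; apply: eq_bigr => l _; rewrite raddfMz; congr (_ *~ _); exact: G0_ext_cell. Qed.

(** Extension of scalars sends each cell class to the corresponding cell class and preserves which
    forms vanish, so it carries a basis to a basis. *)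
Lemma G0_ext_bij : bijective (G0_ext C psiE).
Proof.
have inj : injective (G0_ext C psiE).
  move=> x y /eqP; rewrite -subr_eq0 -raddfB => /eqP; have [n [n0 xyE]] := G0_cell_span (x - y).
  rewrite xyE G0_ext_sum => sum0; apply/eqP; rewrite -subr_eq0 xyE big1 // => l _.
  by rewrite (cell_span_uniq _ sum0) ?mulr0z // => m; rewrite cell_nz_ext; exact: n0.
have surj y : exists x, G0_ext C psiE x = y.
  have [n [_ ->]] := G0_cell_span y.
  by exists (\sum_l G0_class (cell_mod phi l) *~ n l); rewrite G0_ext_sum.
have /choice [g gK] := surj.
by exists g => // x; apply: inj; rewrite gK.
Qed.

End GateBijective.

Section SimpleClasses.
Variables (R : comNzRingType) (A : algType R) (C : cell_datum A).
Variables (k : fieldType) (phi : {rmorphism R -> k}).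
Local Notation W := (cell_mod phi).
Local Notation tab := (@cell_tab R A C).

(** It remains to see that the form of [l] is nonzero. The simple module [V] with the class of [W l]
    is a quotient of some [W m] with nonzero form, hence isomorphic to it by [simple_class_unit],
    and then [m = l] by injectivity. *)
Lemma gram_unit_of_simple_classes :
  (forall l, (0 < #|tab l|)%N -> exists2 V, mod_simple V & G0_class V = G0_class (W l)) ->
  (forall l m, (0 < #|tab l|)%N -> (0 < #|tab m|)%N ->
     G0_class (W l) = G0_class (W m) -> l = m) ->
  forall l : cell_poset C, map_mx phi (cell_gram l) \in unitmx.
Proof.
move=> sW injW l; have [l0|l0] := posnP #|tab l|; first exact: gram_unit0.
have [V sV VE] := sW l l0.
suff nzl : cell_nz phi l by exact: simple_class_unit nzl sV VE.
have [m [f [hf ff kG nzm _]]] := simple_cover sV.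
have [V' sV' VE'] := sW m (cell_nz_tab nzm).
have uG := simple_class_unit nzm sV' VE'.
have K0 : kermx f^T = 0 by rewrite -[kermx f^T](mulmxK uG) kG mul0mx.
have fT : row_free f^T by rewrite -kermx_eq0 K0.
rewrite (injW l m l0 (cell_nz_tab nzm)) // -VE.
exact/esym/(G0_class_bij (W := W m) (V := V) hf ff fT).
Qed.

End SimpleClasses.

Lemma char_poly_scalar (k : fieldType) n (a : k) : char_poly (a%:M : 'M_n) = ('X - a%:P) ^+ n.
Proof.
by rewrite /char_poly /char_poly_mx map_scalar_mx /= -raddfB det_scalar.
Qed.

Lemma char_poly_idem (k : fieldType) n (P : 'M[k]_n) : P *m P = P ->
  char_poly P = ('X - 1%:P) ^+ (\rank P) * ('X - 0%:P) ^+ (n - \rank P).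
Proof.
move=> PP; pose f := col_base P; pose g := (col_base (cokermx P^T))^T.
have rk : \rank (cokermx P^T) = (n - \rank P)%N by rewrite mxrank_coker mxrank_tr.
have gP : g *m P = 0.
  apply: (can_inj (@trmxK _ _ _)); rewrite trmx0 trmx_mul trmxK.
  apply: (row_free_inj (row_base_free (cokermx P^T))).
  by rewrite /= mul0mx -mulmxA mulmx_base mulmx_coker.
have Pf : P *m f = f.
  apply: (row_free_inj (row_base_free P)).
  by rewrite /= -mulmxA mulmx_base PP.
have gf : g *m f = 0.
  apply: (row_free_inj (row_base_free P)).
  by rewrite /= mul0mx -mulmxA mulmx_base.
rewrite (char_poly_ext (f := f) (g := g) (M1 := 1%:M) (M2 := 0%:M)) //.
- by rewrite !char_poly_scalar rk.
- by rewrite rk subnKC // rank_leq_row.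
- by rewrite /row_free mxrank_tr; exact: col_base_full.
- by rewrite /row_free mxrank_tr; exact: col_base_full.
- by rewrite mulmx1 Pf.
- by rewrite gP mul_scalar_mx scale0r.
Qed.

Lemma mup_idem (k : fieldType) a b :
  mup 1 (('X - 1%:P) ^+ a * ('X - 0%:P) ^+ b : {poly k}) = a.
Proof.
rewrite mupM ?expf_neq0 ?polyXsubC_eq0 // !mup_XsubCX eqxx.
by rewrite eq_sym oner_eq0 addn0.
Qed.

Lemma mod_mult_rank (k : fieldType) (B : algType k) (V : matmod B) b :
  V b *m V b = V b -> mod_mult b V = (\rank (V b))%:Z.
Proof. by move=> VV; rewrite /mod_mult char_poly_idem // mup_idem. Qed.

(* Both ranks are read off the characteristic polynomial of [P].              *)
Lemma rank_idem_map (S : comNzRingType) (k k' : fieldType) (f : {rmorphism S -> k})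
  (f' : {rmorphism S -> k'}) n (P : 'M[S]_n) : injective f -> P *m P = P ->
  \rank (map_mx f P) = \rank (map_mx f' P).
Proof.
move=> injf PP.
have idem (K : fieldType) (h : {rmorphism S -> K}) : map_mx h P *m map_mx h P = map_mx h P.
  by rewrite -map_mxM PP.
have polyE (K : fieldType) (h : {rmorphism S -> K}) a b :
    map_poly h (('X - 1%:P) ^+ a * ('X - 0%:P) ^+ b) = ('X - 1%:P) ^+ a * ('X - 0%:P) ^+ b.
  by rewrite rmorphM !rmorphXn !rmorphB /= !map_polyX !map_polyC /= rmorph1 rmorph0.
have E : char_poly P = ('X - 1%:P) ^+ \rank (map_mx f P) * ('X - 0%:P) ^+ (n - \rank (map_mx f P)).
  by apply: (map_inj_poly injf (rmorph0 f)); rewrite map_char_poly char_poly_idem // polyE.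
have := map_char_poly f' P; rewrite E polyE char_poly_idem // => /(congr1 (mup 1)).
by rewrite !mup_idem.
Qed.

(** * Blocks and decomposition maps *)

Section Blocks.
Variables (R : comNzRingType) (A : algType R) (C : cell_datum A).
Variables (K : fieldType) (phi : {rmorphism R -> K}).
Local Notation T := (scext C phi).
Local Notation sc := (scin C phi).
Local Notation W := (cell_mod phi).
Local Notation tab := (@cell_tab R A C).
Hypothesis gram_unit : forall l : cell_poset C, map_mx phi (cell_gram l) \in unitmx.

Lemma gram_left_inverse l : exists H, H *m map_mx phi (cell_gram l) = 1%:M :> 'M_#|tab l|.
Proof. by exists (invmx (map_mx phi (cell_gram l))); rewrite mulVmx. Qed.

(** The cell representation is onto the full matrix algebra, so [c] acts as an idempotent scalar. *)
Lemma central_idem_cell (c : T) : c * c = c -> (forall x, c * x = x * c) ->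
  forall m, W m c = 0 \/ W m c = 1%:M.
Proof.
move=> cc cx m; have [n0|n0] := posnP #|tab m|.
  by left; apply/matrixP => i; have := ltn_ord i; rewrite [X in (_ < X)%N]n0.
have comm (M : 'M[K]_#|tab m|) : W m c *m M = M *m W m c.
  have [x [<- _]] := cell_mod_surj gram_left_inverse M.
  by rewrite -mactM cx mactM.
pose i0 := Ordinal n0; set N := W m c in comm *.
have NE : N = (N i0 i0)%:M.
  apply/matrixP => i j; rewrite mxE.
  have := comm (delta_mx j i0) => /matrixP/(_ i i0); rewrite !mxE.
  rewrite (bigD1 j) //= mxE !eqxx mulr1 big1 ?addr0 => [|w /negPf wj]; last first.
    by rewrite mxE wj mulr0.
  rewrite (bigD1 i0) //= mxE eqxx andbT big1 ?addr0 => [->|w /negPf wi]; last first.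
    by rewrite mxE wi andbF mul0r.
  by rewrite mulr_natl.
have : N *m N = N by rewrite /N -mactM cc.
rewrite NE -scalar_mxM => /matrixP/(_ i0 i0); rewrite !mxE eqxx !mulr1n => /eqP.
rewrite -subr_eq0 -{3}[N i0 i0]mulr1 -mulrBr mulf_eq0 subr_eq0 => /orP [] /eqP ->.
  by left; apply/matrixP => i j; rewrite !mxE mul0rn.
by right.
Qed.

Section BlockIdempotents.
Variables (D : set T) (z : cell_poset C -> T).
Hypothesis D_basis : forall i, D (sc (C i)).
Hypothesis DB : forall x y, D x -> D y -> D (x - y).
Hypothesis Dz : forall l, D (z l).
Hypothesis zl : forall l, W l (z l) = 1%:M.
Hypothesis zm : forall l m, m != l -> W m (z l) = 0.

Let inj := cell_mod_inj gram_left_inverse.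

Let cell_z l m : W m (z l) = 0 \/ W m (z l) = 1%:M.
Proof. by case: (eqVneq m l) => [->|/zm ->]; [right|left]. Qed.

Lemma central_of_basis c : (forall x, D x -> c * x = x * c) -> forall x, c * x = x * c.
Proof.
move=> cD x; rewrite [x]scextE mulr_sumr mulr_suml; apply: eq_bigr => i _.
by rewrite -scalerAr -scalerAl cD.
Qed.

Let z_idem l : z l * z l = z l.
Proof. by apply: inj => m; rewrite mactM; case: (cell_z l m) => ->; rewrite ?mulmx1 ?mulmx0. Qed.

Let z_central l x : z l * x = x * z l.
Proof.
apply: inj => m; rewrite !mactM.
by case: (cell_z l m) => ->; rewrite ?mulmx1 ?mul1mx ?mulmx0 ?mul0mx.
Qed.

Let z_central_idempotent l : central_idempotent D (z l).
Proof. by []. Qed.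

(** Stated for a subset [D] containing the basis so as to cover both [A_p] and [A^K]: centrality can
    be tested on the basis, and central idempotents act on each cell module by 0 or 1. *)
Lemma block_idempotentP c :
  block_idempotent D c <-> exists2 l, (0 < #|tab l|)%N & c = z l.
Proof.
split=> [[[Dc cc cD] c0 prim]|[l l0 ->]].
  have cx := central_of_basis cD; have dich := central_idem_cell cc cx.
  have [l lc] : exists l, W l c <> 0.
    apply: contrapT => /forallNP H; move/eqP: c0; apply; apply: inj => l.
    by rewrite mact0; apply: contrapT; exact: H.
  have l0 : (0 < #|tab l|)%N.
    rewrite lt0n; apply/eqP => n0; apply: lc; apply/matrixP => i.
    by have := ltn_ord i; rewrite [X in (_ < X)%N]n0.
  have {}lc : W l c = 1%:M by case: (dich l).
  exists l => //.
  have cz : c * z l = z l.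
    apply: inj => m; rewrite mactM; have [->|ml] := eqVneq m l.
      by rewrite lc mul1mx.
    by rewrite zm // mulmx0.
  have cz' : z l * c = z l by rewrite z_central cz.
  have [||||z0|d0] := prim (z l) (c - z l).
  - exact: z_central_idempotent.
  - split; first exact: DB.
      by rewrite mulrBl !mulrBr cc cz cz' z_idem subrr subr0.
    by move=> x Dx; rewrite mulrBl mulrBr cx z_central.
  - by rewrite mulrBr cz' z_idem subrr.
  - by rewrite addrC subrK.
  - have := zl l; rewrite z0 mact0 => /matrixP/(_ (Ordinal l0) (Ordinal l0)) /eqP.
    by rewrite !mxE eqxx eq_sym oner_eq0.
  - by apply/eqP; rewrite -subr_eq0 d0.
split; first exact: z_central_idempotent.
  apply/eqP => z0; have := zl l; rewrite z0 mact0 => /matrixP/(_ (Ordinal l0) (Ordinal l0)) /eqP.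
  by rewrite !mxE eqxx eq_sym oner_eq0.
move=> c1 c2 [Dc1 cc1 /central_of_basis cx1] [Dc2 cc2 /central_of_basis cx2] c12 zE.
have dich1 := central_idem_cell cc1 cx1; have dich2 := central_idem_cell cc2 cx2.
have sumE m : W m c1 + W m c2 = W m (z l) by rewrite zE mactD.
have prodE m : W m c1 *m W m c2 = 0 by rewrite -mactM c12 mact0.
have c2E m : W m c2 = W m (z l) - W m c1 by rewrite -sumE addrC addKr.
have off m : m != l -> W m c1 = 0 /\ W m c2 = 0.
  move=> ml; have := prodE m; rewrite c2E zm // sub0r mulmxN => /eqP.
  by rewrite oppr_eq0 -mactM cc1 => /eqP ->; rewrite oppr0.
have [c1l|c1l] := dich1 l; [left|right]; apply: inj => m; rewrite mact0.
  by have [->//|/off []] := eqVneq m l.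
have [->|/off []//] := eqVneq m l.
by have := prodE l; rewrite c1l mul1mx.
Qed.

End BlockIdempotents.
End Blocks.

(** * The localization at [p] as a base ring *)

Section LocalizedAlgebra.
Variables (R : idomainType) (p : prime_idealr R).
Local Notation K := {fraction R}.
Local Notation toK := (@FracField.tofrac R).

Definition loc_pred : {pred K} := fun x => `[< loc_ring p x >].

Fact loc_pred_subring_closed : subring_closed loc_pred.
Proof.
have [L1 LB LM] := loc_ring_subring p.
split=> [|x y /asboolP Lx /asboolP Ly|x y /asboolP Lx /asboolP Ly]; apply/asboolP => //.
  exact: LB.
exact: LM.
Qed.
HB.instance Definition _ := GRing.isSubringClosed.Build K loc_pred loc_pred_subring_closed.

Record localization := Localization { loc_val : K; loc_valP : loc_val \in loc_pred }.
HB.instance Definition _ := [isSub for loc_val].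
HB.instance Definition _ := [Choice of localization by <:].
HB.instance Definition _ := [SubChoice_isSubComNzRing of localization by <:].

Lemma loc_ring_tofrac r : loc_ring p (toK r).
Proof. by exists r, 1; rewrite idealr1 rmorph1 divr1. Qed.

Definition to_loc (r : R) : localization := Localization (asboolT (loc_ring_tofrac r)).

Fact to_loc_zmod_morphism : zmod_morphism to_loc.
Proof. by move=> x y; apply: val_inj; rewrite /= rmorphB. Qed.
Fact to_loc_monoid_morphism : monoid_morphism to_loc.
Proof. by split=> [|x y]; apply: val_inj; rewrite /= ?rmorph1 ?rmorphM. Qed.
HB.instance Definition _ := GRing.isZmodMorphism.Build _ _ to_loc to_loc_zmod_morphism.
HB.instance Definition _ := GRing.isMonoidMorphism.Build _ _ to_loc to_loc_monoid_morphism.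

Definition loc_incl : {rmorphism localization -> K} := (\val : localization -> K).

Lemma loc_inclE r : loc_incl (to_loc r) = toK r.
Proof. by []. Qed.

Lemma to_loc_unit r : r \notin p -> exists u, u * to_loc r = 1.
Proof.
move=> rp; have Lr : loc_ring p (toK r)^-1 by exists 1, r; rewrite rmorph1 div1r.
by exists (Localization (asboolT Lr)); apply: val_inj; rewrite /= mulVf // (tofrac_notin_neq0 rp).
Qed.

End LocalizedAlgebra.

Lemma gram_left_inverse_det (R S : comNzRingType) (A : algType R) (C : cell_datum A)
  (phi : {rmorphism R -> S}) (l : cell_poset C) (u : S) :
  u * phi (\det (cell_gram l)) = 1 -> exists H, H *m map_mx phi (cell_gram l) = 1%:M.
Proof.
move=> ud; exists (u *: \adj (map_mx phi (cell_gram l))).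
by rewrite -scalemxAl mul_adj_mx det_map_mx scale_scalar_mx ud.
Qed.

(** * Both loci as the locus of invertible Gram matrices *)

Section Main.
Variables (R : idomainType) (A : algType R) (C : cell_datum A).
Local Notation K := {fraction R}.
Local Notation toK := (@FracField.tofrac R).
Local Notation WK := (cell_mod toK).
Local Notation tab := (@cell_tab R A C).
Hypothesis gramK : forall l : cell_poset C, map_mx toK (cell_gram l) \in unitmx.
Variable p : prime_idealr R.
Local Notation Wp := (cell_mod (residue_map p)).

Let scK (i : {l : cell_poset C & (tab l * tab l)%type}) : alg_loc (e := C) p (scin C toK (C i)).
Proof. by move=> j; rewrite ffunE; exact: loc_ring_tofrac. Qed.

Let nzK (l : cell_poset C) : (0 < #|tab l|)%N -> cell_nz toK l.
Proof. by move=> l0; exact: gram_unit_nz. Qed.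

Lemma alg_locB (x y : scext C toK) : alg_loc (e := C) p x -> alg_loc (e := C) p y -> alg_loc (e := C) p (x - y).
Proof.
move=> Lx Ly i; rewrite !ffunE; have [_ LB _] := loc_ring_subring p.
exact: LB.
Qed.

(** The Gram determinants are units in the localization, so the identities of the matrix factors
    exist there; their images in [A^K] are the blocks on both levels. *)
Lemma BlGen_of_gram_unit :
  (forall l : cell_poset C, map_mx (residue_map p) (cell_gram l) \in unitmx) -> BlGen C p.
Proof.
move=> up.
have inv (l : cell_poset C) : exists H, H *m map_mx (to_loc p) (cell_gram l) = 1%:M.
  have dp : \det (cell_gram l) \notin p.
    by have := up l; rewrite unitmxE det_map_mx unitfE residue_map_eq0.
  by have [u ud] := to_loc_unit dp; exact: gram_left_inverse_det ud.
have /choice [z Hz] : forall l : cell_poset C, exists x : scext C (to_loc p),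
    cell_mod (to_loc p) l x = 1%:M /\ forall m, m != l -> cell_mod (to_loc p) m x = 0.
  by move=> l; exact: (cell_mod_surj inv 1%:M).
pose zK l : scext C toK := scext_map toK (loc_incl p) (z l).
have z1 l : WK l (zK l) = 1%:M by rewrite (cell_mod_map (@loc_inclE R p)) (Hz l).1 map_mx1.
have z0 l m : m != l -> WK m (zK l) = 0.
  by move=> ml; rewrite (cell_mod_map (@loc_inclE R p)) (Hz l).2 // map_mx0.
have Lz l : alg_loc (e := C) p (zK l).
  by move=> i; rewrite ffunE; exact/asboolP/(loc_valP (z l i)).
apply/seteqP; split=> c /=.
  move=> /(block_idempotentP gramK scK alg_locB Lz z1 z0) H.
  exact/(block_idempotentP gramK (D := setT) _ _ _ z1 z0).
move=> /(block_idempotentP gramK (D := setT) (fun=> I) (fun _ _ _ _ => I) (fun=> I) z1 z0) H.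
exact/(block_idempotentP gramK scK alg_locB Lz z1 z0).
Qed.

(** The cell module over the valuation ring is a lattice whose reduction comes from the cell module
    modulo [p]; so [d] sends cell classes, simple and distinct over [K], to cell classes. *)
Lemma gram_unit_of_trivial (v : dvaluation K) (dom : dominates p v) d :
  is_decomposition_map (e := C) dom d -> trivial_decomposition d ->
  forall l : cell_poset C, map_mx (residue_map p) (cell_gram l) \in unitmx.
Proof.
move=> dd [d1 d2 _].
have dW (l : cell_poset C) : d (G0_class (WK l)) = G0_class (Wp l).
  have := dd (WK l) (cell_mod (to_dvr dom) l) (cell_mod_ext _ _).
  have -> : G0_class (special_fibre (cell_mod (to_dvr dom) l))
      = gate_map C dom (G0_class (Wp l)).
    rewrite [RHS]G0_ext_cell; apply: G0_class_iso; exact: cell_mod_ext.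
  exact: bij_inj (G0_ext_bij C _) _ _.
apply: gram_unit_of_simple_classes => [l l0|l m l0 m0 E].
  have [S sS dS] := d1 _ (cell_mod_simple l0 (gramK l)).
  by exists S; rewrite // -dS dW.
have iso : mod_iso (WK l) (WK m).
  by apply: d2; [exact: cell_mod_simple|exact: cell_mod_simple|rewrite !dW].
by apply: (@cell_class_inj _ _ _ _ toK); [exact: nzK|exact: nzK|exact: G0_class_iso].
Qed.

Lemma common_denominator (I : finType) (x : I -> K) : (forall i, loc_ring p (x i)) ->
  exists2 s, s \notin p & exists a : I -> R, forall i, toK (a i) = toK s * x i.
Proof.
move=> Lx; have /choice [f Hf] : forall i, exists as_ : R * R,
    as_.2 \notin p /\ x i = toK as_.1 / toK as_.2.
  by move=> i; have [a [s [sp E]]] := Lx i; exists (a, s).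
have prodp (P : pred I) : \prod_(i | P i) (f i).2 \notin p.
  apply: (big_ind (fun r => r \notin p)) => [|r s rp sp|i _]; last by case: (Hf i).
    by rewrite idealr1.
  by rewrite prime_idealrM negb_or rp.
exists (\prod_i (f i).2) => //; exists (fun i => (f i).1 * \prod_(j | j != i) (f j).2) => i.
have [fp ->] := Hf i.
have -> : \prod_j (f j).2 = (f i).2 * \prod_(j | j != i) (f j).2 by rewrite (bigD1 i).
move: (\prod_(j | j != i) _) => q.
by rewrite !rmorphM [RHS]mulrC mulrA divfK ?(tofrac_notin_neq0 fp).
Qed.

(** With [s] a common denominator of the block [z l], the element [b] of [A] acts by [s] on the cell
    module of [l] and by zero on the others, already over [R] and hence modulo [p], where [s] stays
    nonzero. *)
Lemma gram_unit_of_BlGen : BlGen C p ->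
  forall l : cell_poset C, map_mx (residue_map p) (cell_gram l) \in unitmx.
Proof.
move=> blp l; have [l0|l0] := posnP #|tab l|; first exact: gram_unit0.
have /choice [z Hz] : forall l : cell_poset C, exists x : scext C toK,
    WK l x = 1%:M /\ forall m, m != l -> WK m x = 0.
  by move=> m; exact: (cell_mod_surj (gram_left_inverse gramK) 1%:M).
have : block_idempotent [set: alg_frac C] (z l).
  apply/(block_idempotentP gramK (D := setT) (fun=> I) (fun _ _ _ _ => I) (fun=> I)
    (fun l => (Hz l).1) (fun l => (Hz l).2)).
  by exists l.
rewrite -blp => -[[Lz _ _] _ _].
have [s sp [a aE]] := common_denominator Lz.
pose b := \sum_i a i *: C i.
have bz : scin C toK b = toK s *: z l.
  by apply/ffunP => i; rewrite scext_scaleE ffunE (bvecK C a); exact: aE.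
have injK n : injective (map_mx toK : 'M_n -> 'M_n).
  move=> x y /matrixP xy; apply/matrixP => i j; have := xy i j.
  by rewrite !mxE => /eqP; rewrite tofrac_eq => /eqP.
have rep m : map_mx toK (cell_rep m b) = toK s *: WK m (z l).
  by rewrite -cell_mod_scin bz mactZ.
apply: (@gram_unit_of_scalars _ _ _ _ (residue_map p) l (scin C (residue_map p) b) (residue_map p s)).
- by rewrite residue_map_eq0.
- rewrite cell_mod_scin (_ : cell_rep l b = s%:M) ?map_scalar_mx //.
  by apply: injK; rewrite rep (Hz l).1 map_scalar_mx scalemx1.
- move=> m ml; rewrite cell_mod_scin (_ : cell_rep m b = 0) ?map_mx0 //.
  by apply: injK; rewrite rep (Hz l).2 // map_mx0 scaler0.
Qed.

(** [e l] acts as a diagonal matrix unit on shape [l] and as zero elsewhere, so its rank on a module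
    counts the copies of that cell module. On a lattice this rank is the same in both fibres. *)
Lemma trivial_of_gram_unit (v : dvaluation K) (dom : dominates p v) :
  (forall l : cell_poset C, map_mx (residue_map p) (cell_gram l) \in unitmx) ->
  exists2 d, is_decomposition_map (e := C) dom d & trivial_decomposition d.
Proof.
move=> up.
have inv (l : cell_poset C) : exists H, H *m map_mx (to_dvr dom) (cell_gram l) = 1%:M.
  have dp : \det (cell_gram l) \notin p.
    by have := up l; rewrite unitmxE det_map_mx unitfE residue_map_eq0.
  have Ld : (toK (\det (cell_gram l)))^-1 \in dvr_pred v.
    by apply: dom.1; exists 1, (\det (cell_gram l)); rewrite rmorph1 div1r.
  apply: (gram_left_inverse_det (u := DVR Ld)); apply: val_inj.
  by rewrite /= mulVf // (tofrac_notin_neq0 dp).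
have /choice [e He] : forall l : cell_poset C, exists x : scext C (to_dvr dom),
    ((0 < #|tab l|)%N -> exists i, cell_mod (to_dvr dom) l x = delta_mx i i) /\
    forall m, m != l -> cell_mod (to_dvr dom) m x = 0.
  move=> l; have [l0|l0] := posnP #|tab l|.
    by have [x [_ x0]] := cell_mod_surj inv (0 : 'M_#|tab l|); exists x.
  have [x [xl x0]] := cell_mod_surj inv (delta_mx (Ordinal l0) (Ordinal l0)).
  by exists x; split=> // _; exists (Ordinal l0).
have ee l : e l * e l = e l.
  apply: (cell_mod_inj inv) => m; rewrite mactM; have [->|ml] := eqVneq m l; last first.
    by rewrite (He l).2 // mulmx0.
  have [l0|l0] := posnP #|tab l|.
    by apply/matrixP => i; have := ltn_ord i; rewrite [X in (_ < X)%N]l0.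
  by have [i ->] := (He l).1 l0; rewrite mul_delta_mx.
pose eK l : scext C toK := scext_map toK (dvr_incl v) (e l).
pose em l : scext C (to_dvr_residue dom) :=
  scext_map (to_dvr_residue dom) (residue_map (dvr_max v)) (e l).
have multE (k : fieldType) (phi : {rmorphism R -> k}) (psi : {rmorphism dvr v -> k})
    (psiE : forall r, psi (to_dvr dom r) = phi r) l m : (0 < #|tab l|)%N ->
    mod_mult (scext_map phi psi (e l)) (cell_mod phi m) = (m == l)%:Z.
  move=> l0; have [->|ml] := eqVneq m l; last first.
    by apply: mod_mult0; rewrite (cell_mod_map psiE) (He l).2 // map_mx0.
  have [i ei] := (He l).1 l0.
  by rewrite mod_mult_rank (cell_mod_map psiE) ei map_delta_mx ?mul_delta_mx ?mxrank_delta.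
have resE r : residue_map (dvr_max v) (to_dvr dom r) = to_dvr_residue dom r by [].
(* The candidate map replaces each cell constituent over [K] by the cell module modulo [p], with the
   multiplicity measured by [eK l]. *)
pose h (V : matmod (alg_frac C)) : G0 (alg_spec C p) :=
  \sum_l G0_class (Wp l) *~ mod_mult (eK l) V.
have hD V' V V'' f g : @short_exact _ (alg_frac C) V' V V'' f g -> h V = h V' + h V''.
  move=> ex; rewrite /h -big_split; apply: eq_bigr => l _ /=.
  by rewrite (mod_mult_exact (eK l) ex) mulrzDr.
pose d : {additive G0 (alg_frac C) -> G0 (alg_spec C p)} := G0_lift hD.
have dE V : d (G0_class V) = h V by exact: G0_lift_class.
have dW l : (0 < #|tab l|)%N -> d (G0_class (WK l)) = G0_class (Wp l).
  move=> l0; rewrite dE /h (bigD1 l) //= (multE _ _ _ (dvr_inclE dom)) // eqxx mulr1z.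
  rewrite big1 ?addr0 // => m ml; have [m0|m0] := posnP #|tab m|.
    by rewrite (G0_class0 (V := Wp m)) // mul0rz.
  by rewrite (multE _ _ _ (dvr_inclE dom)) // eq_sym (negPf ml) mulr0z.
have simple_WK V : mod_simple V -> exists2 l, (0 < #|tab l|)%N &
    mod_iso (WK l) V /\ d (G0_class V) = G0_class (Wp l).
  move=> sV; have [l l0 iso] := simple_iso_cell gramK sV; exists l => //.
  by split=> //; rewrite -(G0_class_iso iso) dW.
exists d; last split.
- move=> V L iso; rewrite dE /h [LHS]G0_ext_sum.
  have [n [_ nE]] := G0_cell_span (C := C) (phi := to_dvr_residue dom) (G0_class (special_fibre L)).
  rewrite [RHS]nE; apply: eq_bigr => l _; have [l0|l0] := posnP #|tab l|.
    by rewrite (G0_class0 (V := cell_mod (to_dvr_residue dom) l)) // !mul0rz.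
  congr (_ *~ _).
  have LL : L (e l) *m L (e l) = L (e l) by rewrite -mactM ee.
  have <- : mod_mult (eK l) (generic_fibre L) = mod_mult (eK l) V.
    by rewrite -!G0_mult_class (G0_class_iso iso).
  (* The coefficients of the special fibre are read off by the reductions of the same
     idempotents. *)
  have -> : n l = mod_mult (em l) (special_fibre L).
    rewrite -G0_mult_class nE raddf_sum (bigD1 l) //= big1 => [|m ml].
      by rewrite addr0 raddfMz G0_mult_class (multE _ _ _ resE) // eqxx intz.
    rewrite raddfMz G0_mult_class (multE _ _ _ resE) // (negPf ml).
    by rewrite mul0rz.
  have gE : generic_fibre L (eK l) = map_mx (dvr_incl v) (L (e l)) by exact: mod_ext_map.
  have sE : special_fibre L (em l) = map_mx (residue_map (dvr_max v)) (L (e l)) by exact: mod_ext_map.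
  rewrite !mod_mult_rank ?gE ?sE; [|by rewrite -map_mxM LL|by rewrite -map_mxM LL].
  by rewrite (rank_idem_map (residue_map (dvr_max v))) //; exact: val_inj.
- move=> V /simple_WK [l l0 [_ dV]]; exists (Wp l) => //.
  exact: cell_mod_simple.
- move=> V V' /simple_WK [l l0 [iso ->]] /simple_WK [l' l'0 [iso' ->]] E.
  have ll' : l = l' by apply: cell_class_inj E; exact: gram_unit_nz.
  by apply: mod_iso_trans (mod_iso_sym iso) _; rewrite ll'.
- move=> S /(simple_iso_cell up) [l l0 iso]; exists (WK l); first exact: cell_mod_simple.
  by rewrite dW // (G0_class_iso iso).
Qed.

End Main.

Theorem lemma6p7 (R : idomainType) (A : algType R) (C : cell_datum A)
    (noethR : noetherian R) (ssAK : semisimple_ring (alg_frac C)) :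
  DecGen C = BlGen C.
Proof.
have gramK (l : cell_poset C) : map_mx (@FracField.tofrac R) (cell_gram l) \in unitmx.
  by apply: semisimple_gram_unit => a; exact: semisimple_regular.
apply/seteqP; split=> p; last first.
  move=> blp _ v dom _; apply: trivial_of_gram_unit => //.
  exact: gram_unit_of_BlGen.
move=> decp; have [p0|p0] := pselect (exists2 r, r \in p & r != 0).
  have [v dom] := dominating_valuation noethR p0.
  have [|d dd td] := decp p0 v dom; first exact: G0_ext_bij.
  by apply: BlGen_of_gram_unit => //; exact: gram_unit_of_trivial dd td.
(* If [p] is the zero ideal, every nonzero denominator is allowed and [A_p] is all of [A^K]. *)
rewrite /BlGen /mkset.
suff -> : alg_loc (e := C) p = [set: alg_frac C]%classic by [].
apply/seteqP; split=> // x _ i; have := frac_reprE (x i); set d := \d_ _ => xE.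
have d0 : FracField.tofrac d != 0 by rewrite tofrac_eq0 denom_ratioP.
exists (\n_(repr (x i))), d; split.
  apply/negP => dp; apply: p0; exists d => //; exact: denom_ratioP.
by rewrite -xE mulfK.
Qed.
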